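(* Let $(\Omega,\mathcal{H},\hat{E})$ be a sublinear expectation space and let $\{X_i\}_{i=1}^{\infty}$ be a sequence of $\mathbb{R}^d$-valued random variables in it satisfying the following conditions: (i) for every $i\ge 1$, $X_{i+1}$ is independent from $(X_1,\ldots,X_i)$; (ii) $\hat{E}[X_i]=\hat{E}[-X_i]=0$ for every $i\ge 1$ (componentwise); (iii) there is a constant $M>0$ such that $\hat{E}[|X_i|^3]\le M$ for all $i\ge 1$; (vii) for each $i$, $\Theta_i$ is a bounded, convex and closed subset of $\mathbb{S}_+(d)$ such that $G_i(A):=\frac12\hat{E}[\langle AX_i,X_i\rangle]=\frac12\sup_{Q\in\Theta_i}\mathrm{tr}[AQ]$ for all $A\in\mathbb{S}(d)$, and $\{\Theta_i\}$ is a Cauchy sequence in $(\Xi,d_H)$, i.e. $d_H(\Theta_i,\Theta_j)\to0$ as $i,j\to\infty$. Let $S_n=X_1+\cdots+X_n$. Then there exists a bounded, convex and closed subset $\Theta\subset\mathbb{S}_+(d)$ such that, with $G:\mathbb{S}(d)\to\mathbb{R}$ defined by $G(A)=\frac12\sup_{Q\in\Theta}\mathrm{tr}[AQ]$, the sequence $\{S_n/\sqrt{n}\}_{n=1}^\infty$ converges in law to the $G$-normal distribution $N(0;\Theta)$, i.e. $$\lim_{n\to\infty}\hat{E}\left[\varphi\left(\frac{S_n}{\sqrt n}\right)\right]=\hat{E}[\varphi(X)]\quad\text{for all }\varphi\in C_{b,Lip}(\mathbb{R}^d),$$ where $X\sim N(0;\Theta)$.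
   Context: Sublinear expectation space: $\Omega$ is a set and $\mathcal{H}$ is a linear space of real functions on $\Omega$ containing the constants, closed under $X\mapsto|X|$, and such that $\varphi(X_1,\ldots,X_n)\in\mathcal{H}$ whenever $X_1,\ldots,X_n\in\mathcal{H}$ and $\varphi\in C_{l,Lip}(\mathbb{R}^n)$. Here $C_{l,Lip}(\mathbb{R}^n)$ is the space of $\varphi:\mathbb{R}^n\to\mathbb{R}$ with $|\varphi(x)-\varphi(y)|\le C(1+|x|^m+|y|^m)|x-y|$ for all $x,y$, for some $C>0$, $m\in\mathbb{N}$ depending on $\varphi$; $C_{b,Lip}(\mathbb{R}^n)$ is the space of bounded Lipschitz functions. A sublinear expectation is a functional $\hat{E}:\mathcal{H}\to\mathbb{R}$ that is monotone ($X\ge Y\Rightarrow\hat{E}[X]\ge\hat{E}[Y]$), constant preserving ($\hat{E}[c]=c$), sub-additive ($\hat{E}[X+Y]\le\hat{E}[X]+\hat{E}[Y]$) and positively homogeneous ($\hat{E}[\lambda X]=\lambda\hat{E}[X]$, $\lambda\ge0$). An $\mathbb{R}^d$-valued random variable is an element of $\mathcal{H}^d$. Independence: $Y\in\mathcal{H}^n$ is independent from $X\in\mathcal{H}^m$ if $\hat{E}[\varphi(X,Y)]=\hat{E}\big[\hat{E}[\varphi(x,Y)]|_{x=X}\big]$ for all $\varphi\in C_{l,Lip}(\mathbb{R}^{n+m})$. Random vectors $X_1,X_2$ in $\mathbb{R}^n$ (possibly on different spaces with expectations $E_1,E_2$) are identically distributed, $X_1\sim X_2$, if $E_1[\varphi(X_1)]=E_2[\varphi(X_2)]$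 for all $\varphi\in C_{b,Lip}(\mathbb{R}^n)$. An independent copy $\bar X$ of $X$ is a random vector with $\bar X\sim X$ that is independent from $X$. $\mathbb{S}(d)$ is the space of real symmetric $d\times d$ matrices, $\|A\|=\sqrt{\sum_{i,j=1}^d a_{ij}^2}$ for $A=(a_{ij})$, and $\mathbb{S}_+(d)$ is the set of positive semidefinite elements of $\mathbb{S}(d)$. Hausdorff distance: for nonempty closed $\Delta_1,\Delta_2\subset\mathbb{S}_+(d)$, $d_H(\Delta_1,\Delta_2)=\inf\{\varepsilon>0:\Delta_1\subset B_\varepsilon(\Delta_2),\ \Delta_2\subset B_\varepsilon(\Delta_1)\}$, where $B_\varepsilon(\Delta)=\{x\in\mathbb{S}_+(d): d(x,\Delta)<\varepsilon\}$, $d(x,\Delta)=\inf_{y\in\Delta}\|x-y\|$. $\Xi$ is the set of all (nonempty) bounded closed subsets of $\mathbb{S}_+(d)$; all sets $\Theta,\Theta_i$ are nonempty. $G$-normal distribution: a $d$-dimensional random vector $X$ is $G$-normal distributed if $aX+b\bar X\sim\sqrt{a^2+b^2}\,X$ for all $a,b\ge0$, where $\bar X$ is an independent copy of $X$. The associated function is $G(A)=\hat{E}[\frac12\langle AX,X\rangle]$, $A\in\mathbb{S}(d)$; it determines the law of $X$. For a bounded, convex, closed set $\Theta\subset\mathbb{S}_+(d)$, $X\sim N(0;\Theta)$ means that $X$ is $G$-normal distributed with $\hat{E}[\frac12\langle AX,X\rangle]=\frac12\sup_{Q\in\Theta}\mathrm{tr}[AQ]$ for all $A\in\mathbb{S}(d)$.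 The vector $X$ may live on another sublinear expectation space, whose expectation is still denoted $\hat{E}$. Equivalently, $u(t,x)=\hat{E}[\varphi(x+\sqrt t X)]$ is the unique viscosity solution on $[0,\infty)\times\mathbb{R}^d$ of $\partial_tu-G(D^2u)=0$, $u|_{t=0}=\varphi$, for $\varphi\in C_{b,Lip}(\mathbb{R}^d)$. *)

(* Defs.v *)
From HB Require Import structures.
From mathcomp Require Import all_boot all_order all_algebra.
From mathcomp Require Import all_classical all_reals all_analysis.

Set Implicit Arguments.
Unset Strict Implicit.
Unset Printing Implicit Defensive.

Import Order.TTheory GRing.Theory Num.Theory.
Import numFieldNormedType.Exports.

Local Open Scope classical_set_scope.
Local Open Scope ring_scope.

(* The norm `|A| that the library puts on matrices is the max norm; the
   Euclidean norm on R^n = 'cV_n and the norm ||A|| on matrices are this one. *)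
Definition enorm (R : realType) (m n : nat) (A : 'M[R]_(m, n)) : R :=
  Num.sqrt (\sum_(i < m) \sum_(j < n) A i j ^+ 2).

Definition dotp (R : realType) (d : nat) (x y : 'cV[R]_d) : R :=
  \sum_(i < d) x i 0 * y i 0.

Definition C_l_Lip (R : realType) (n : nat) (phi : 'cV[R]_n -> R) : Prop :=
  exists (C : R) (m : nat), 0 < C /\
    forall x y, `|phi x - phi y|
      <= C * (1 + enorm x ^+ m + enorm y ^+ m) * enorm (x - y).

Definition C_b_Lip (R : realType) (n : nat) (phi : 'cV[R]_n -> R) : Prop :=
  (exists K : R, forall x, `|phi x| <= K) /\
  (exists L : R, forall x y, `|phi x - phi y| <= L * enorm (x - y)).

(* The functional [sl_E] is given on all functions Omega -> R so that it can be
   applied without carrying membership proofs; its values outside [sl_H] are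
   arbitrary and unconstrained. *)
Record sublinear_space (R : realType) := SublinearSpace {
  sl_Omega :> Type;
  sl_H : set (sl_Omega -> R);
  sl_E : (sl_Omega -> R) -> R;
  sl_H_cst : forall c : R, sl_H (fun=> c);
  sl_H_add : forall X Y, sl_H X -> sl_H Y -> sl_H (fun w => X w + Y w);
  sl_H_scale : forall (c : R) X, sl_H X -> sl_H (fun w => c * X w);
  sl_H_abs : forall X, sl_H X -> sl_H (fun w => `|X w|);
  sl_H_comp : forall (n : nat) (X : sl_Omega -> 'cV[R]_n) (phi : 'cV[R]_n -> R),
    (forall i, sl_H (fun w => X w i 0)) -> C_l_Lip phi ->
    sl_H (fun w => phi (X w));
  sl_E_mono : forall X Y, sl_H X -> sl_H Y ->
    (forall w, Y w <= X w) -> sl_E Y <= sl_E X;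
  sl_E_cst : forall c : R, sl_E (fun=> c) = c;
  sl_E_subadd : forall X Y, sl_H X -> sl_H Y ->
    sl_E (fun w => X w + Y w) <= sl_E X + sl_E Y;
  sl_E_poshom : forall (l : R) X, sl_H X -> 0 <= l ->
    sl_E (fun w => l * X w) = l * sl_E X
}.

Section SublinearExpectation.
Context {R : realType}.

Definition random_vector (S : sublinear_space R) (d : nat)
    (X : S -> 'cV[R]_d) : Prop :=
  forall i, sl_H (fun w => X w i 0).

(* [independent_from Y X]: Y is independent from X (not symmetric). *)
Definition independent_from (S : sublinear_space R) (m n : nat)
    (Y : S -> 'cV[R]_n) (X : S -> 'cV[R]_m) : Prop :=
  forall phi : 'cV[R]_(m + n) -> R, C_l_Lip phi ->
    sl_E (fun w => phi (col_mx (X w) (Y w)))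
    = sl_E (fun w => sl_E (fun w' => phi (col_mx (X w) (Y w')))).

Definition same_law (S1 S2 : sublinear_space R) (n : nat)
    (X1 : S1 -> 'cV[R]_n) (X2 : S2 -> 'cV[R]_n) : Prop :=
  forall phi : 'cV[R]_n -> R, C_b_Lip phi ->
    sl_E (fun w => phi (X1 w)) = sl_E (fun w => phi (X2 w)).

Definition independent_copy (S : sublinear_space R) (d : nat)
    (Xbar X : S -> 'cV[R]_d) : Prop :=
  [/\ random_vector Xbar, same_law Xbar X & independent_from Xbar X].

Definition G_normal (S : sublinear_space R) (d : nat)
    (X : S -> 'cV[R]_d) : Prop :=
  random_vector X /\
  exists Xbar : S -> 'cV[R]_d, independent_copy Xbar X /\
    forall a b : R, 0 <= a -> 0 <= b ->
      same_law (fun w => a *: X w + b *: Xbar w)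
               (fun w => Num.sqrt (a ^+ 2 + b ^+ 2) *: X w).

Definition sym_mx (d : nat) (A : 'M[R]_d) : Prop := A^T = A.

Definition S_plus (d : nat) : set 'M[R]_d :=
  [set A | sym_mx A /\ forall x : 'cV[R]_d, 0 <= dotp (A *m x) x].

(* The library topology on matrices (entrywise convergence) is the one given by
   [enorm], and [S_plus] is closed in it, so [closed] may be taken in 'M_d. *)
Definition Xi (d : nat) : set (set 'M[R]_d) :=
  [set Theta | [/\ Theta `<=` @S_plus d, Theta !=set0,
     (exists K : R, forall Q, Theta Q -> enorm Q <= K) & closed Theta]].

Definition dist_set (d : nat) (x : 'M[R]_d) (D : set 'M[R]_d) : R :=
  inf [set enorm (x - y) | y in D].

Definition nbhd_set (d : nat) (e : R) (D : set 'M[R]_d) : set 'M[R]_d :=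
  [set x | @S_plus d x /\ dist_set x D < e].

Definition hausdorff_dist (d : nat) (D1 D2 : set 'M[R]_d) : R :=
  inf [set e : R | [/\ 0 < e, D1 `<=` nbhd_set e D2 & D2 `<=` nbhd_set e D1]].

Definition hausdorff_cauchy (d : nat) (Theta : nat -> set 'M[R]_d) : Prop :=
  forall e : R, 0 < e -> exists N : nat, forall i j : nat,
    (N <= i)%N -> (N <= j)%N -> hausdorff_dist (Theta i) (Theta j) < e.

Definition G_of (d : nat) (Theta : set 'M[R]_d) (A : 'M[R]_d) : R :=
  2^-1 * sup [set \tr (A *m Q) | Q in Theta].

(* X ~ N(0; Theta) *)
Definition G_normal_law (S : sublinear_space R) (d : nat)
    (Theta : set 'M[R]_d) (X : S -> 'cV[R]_d) : Prop :=
  G_normal X /\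
  forall A : 'M[R]_d, sym_mx A ->
    sl_E (fun w => 2^-1 * dotp (A *m X w) (X w)) = G_of Theta A.

(* The limit law is carried by a random vector that may live on another space. *)
Definition cvg_in_law (S S' : sublinear_space R) (d : nat)
    (Y : nat -> S -> 'cV[R]_d) (X : S' -> 'cV[R]_d) : Prop :=
  forall phi : 'cV[R]_d -> R, C_b_Lip phi ->
    (fun n : nat => sl_E (fun w => phi (Y n w))) @ \oo
      --> sl_E (fun w => phi (X w)).

End SublinearExpectation.

(* Main.v *)
Require Import Defs.
From HB Require Import structures.
From mathcomp Require Import all_boot all_order all_algebra.
From mathcomp Require Import all_classical all_reals all_analysis.
From mathcomp Require Import ring lra zify.

Set Implicit Arguments.
Unset Strict Implicit.
Unset Printing Implicit Defensive.

Import Order.TTheory GRing.Theory Num.Theory.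
Import numFieldNormedType.Exports.

Local Open Scope classical_set_scope.
Local Open Scope ring_scope.

(* Idea. Write the expectation of phi(S_n / sqrt n) as a chain of one-step operators
   (T_i f)(x) = E[f(x + X_i / sqrt n)] applied to phi, and the expectation of phi(Z),
   for a G-normal Z, as the n-fold chain of f |-> E[f(. + Z / sqrt n)]. These operators
   are sublinear and commute with translations, so T(A f) <= A(T f) for every averaging
   A over translations. Averaging phi against a smooth density makes it C^{2,1}, and for
   such functions two one-step operators with the same mean and nearly the same
   covariance function G differ by o(1/n), by Taylor expansion and the bound on third
   moments. Running this along the chain bounds one chain by the other, and by symmetry
   the two chains are close; no regularity theory for the G-heat equation is needed. To
   avoid integration on R^d, averages are taken over a finite grid of arbitrarily small
   mesh.
   The same comparison shows that walks with the symmetric two-point increments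
   +- sqrt m B e_j, B B^T in Theta, converge; their limit is stable, and its square on
   R^d x R^d carries a G-normal vector. The limit of the Theta_i is their Kuratowski
   limit, and it is close to Theta_i by compactness. *)

(** * Euclidean norm *)

(** The length of the chain must not enter the error. Sublinear steps preserve the bound and the
    Lipschitz constant of a function, so all intermediate functions can be averaged with the same
    weights and the same constants. The averaging radius [h] is fixed first and costs [2 * L * h] in
    all, not per step. The derivative bounds blow up like powers of 1/h, but they multiply a sum of
    [n] third moments of size n^(-3/2), which tends to 0 for fixed [h]. Walks are shown to converge
    on bounded Lipschitz functions only, whereas a sublinear space needs a value for every function
    of polynomial growth, the quadratic ones included. The limit functional is therefore an
    ultralimit of the walks, finite by moment bounds uniform in the length; symmetric increments of
    bounded size give these bounds. *)

Section EuclideanNorm.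
Context {R : realType}.

Lemma sum_cauchy_schwarz (I : finType) (a b : I -> R) :
  (\sum_i a i * b i) ^+ 2 <= (\sum_i a i ^+ 2) * (\sum_i b i ^+ 2).
Proof.
set A := \sum_i a i ^+ 2; set B := \sum_i a i * b i; set C := \sum_i b i ^+ 2.
have A0 : 0 <= A by apply: sumr_ge0 => i _; apply: sqr_ge0.
have [Az|An] := eqVneq A 0.
  have az i : a i = 0.
    have /eqP := Az; rewrite psumr_eq0; last by move=> j _; apply: sqr_ge0.
    by move=> /allP /(_ i); rewrite mem_index_enum sqrf_eq0 => /(_ isT) /eqP.
  rewrite Az mul0r /B big1 ?expr0n // => i _; by rewrite az mul0r.
have : 0 <= \sum_i (A * b i - B * a i) ^+ 2.
  by apply: sumr_ge0 => i _; apply: sqr_ge0.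
have -> : \sum_i (A * b i - B * a i) ^+ 2 = A * (A * C - B ^+ 2).
  under eq_bigr => i _.
    have -> : (A * b i - B * a i) ^+ 2
      = A ^+ 2 * b i ^+ 2 + (- 2 * A * B) * (a i * b i) + B ^+ 2 * a i ^+ 2.
      by ring.
    over.
  rewrite !big_split /= -!mulr_sumr -/A -/B -/C; ring.
by rewrite pmulr_rge0 ?lt_neqAle ?A0 1?eq_sym ?An // subr_ge0.
Qed.

Lemma enorm_ge0 m n (A : 'M[R]_(m, n)) : 0 <= enorm A.
Proof. exact: sqrtr_ge0. Qed.

Lemma enorm_sqrE m n (A : 'M[R]_(m, n)) :
  enorm A ^+ 2 = \sum_(p : 'I_m * 'I_n) A p.1 p.2 ^+ 2.
Proof.
rewrite sqr_sqrtr; last by do 2![apply: sumr_ge0 => ? _]; apply: sqr_ge0.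
by rewrite pair_bigA.
Qed.

Lemma enorm_pair_sum_le m n (A B : 'M[R]_(m, n)) :
  `|\sum_(p : 'I_m * 'I_n) A p.1 p.2 * B p.1 p.2| <= enorm A * enorm B.
Proof.
rewrite -ler_sqr ?nnegrE ?mulr_ge0 ?enorm_ge0 // real_normK ?num_real //.
rewrite exprMn !enorm_sqrE; exact: sum_cauchy_schwarz.
Qed.

Lemma enormD m n (A B : 'M[R]_(m, n)) : enorm (A + B) <= enorm A + enorm B.
Proof.
rewrite -ler_sqr ?nnegrE ?addr_ge0 ?enorm_ge0 //.
have := ler_norml (\sum_(p : 'I_m * 'I_n) A p.1 p.2 * B p.1 p.2)
  (enorm A * enorm B); rewrite enorm_pair_sum_le => /esym /andP[_ h].
rewrite sqrrD !enorm_sqrE.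
have -> : \sum_(p : 'I_m * 'I_n) (A + B) p.1 p.2 ^+ 2 =
  \sum_(p : 'I_m * 'I_n) A p.1 p.2 ^+ 2
  + (\sum_(p : 'I_m * 'I_n) A p.1 p.2 * B p.1 p.2) *+ 2
  + \sum_(p : 'I_m * 'I_n) B p.1 p.2 ^+ 2.
  by rewrite -sumrMnl -!big_split /=; apply: eq_bigr => i _; rewrite mxE sqrrD.
by rewrite lerD2r lerD2l lerMn2r h orbT.
Qed.

Lemma enormZ m n (c : R) (A : 'M[R]_(m, n)) : enorm (c *: A) = `|c| * enorm A.
Proof.
apply/eqP; rewrite -(@eqrXn2 _ 2) ?mulr_ge0 ?enorm_ge0 //.
rewrite exprMn real_normK ?num_real // !enorm_sqrE mulr_sumr; apply/eqP.
by apply: eq_bigr => i _; rewrite mxE exprMn.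
Qed.

Lemma enormN m n (A : 'M[R]_(m, n)) : enorm (- A) = enorm A.
Proof. by rewrite -scaleN1r enormZ normrN1 mul1r. Qed.

Lemma enorm0 m n : enorm (0 : 'M[R]_(m, n)) = 0.
Proof. by rewrite -(scale0r 0) enormZ normr0 mul0r. Qed.

Lemma enormB m n (A B : 'M[R]_(m, n)) : enorm (A - B) = enorm (B - A).
Proof. by rewrite -enormN opprB. Qed.

Lemma enorm_distD m n (B A C : 'M[R]_(m, n)) :
  enorm (A - C) <= enorm (A - B) + enorm (B - C).
Proof. by rewrite -[A - C](subrKA B) enormD. Qed.

Lemma enorm_dist m n (A B : 'M[R]_(m, n)) :
  `|enorm A - enorm B| <= enorm (A - B).
Proof.
have h (C D : 'M[R]_(m, n)) : enorm C <= enorm D + enorm (C - D).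
  by rewrite -{1}[C](subrK D) addrC enormD.
rewrite ler_norml lerBlDl h andbT lerNl opprB lerBlDl enormB; exact: h.
Qed.

Lemma enorm_entry m n (A : 'M[R]_(m, n)) i j : `|A i j| <= enorm A.
Proof.
rewrite -ler_sqr ?nnegrE ?enorm_ge0 // real_normK ?num_real // enorm_sqrE.
by rewrite (bigD1 (i, j)) //= lerDl sumr_ge0 // => ? _; apply: sqr_ge0.
Qed.

Lemma enorm_le_sum m n (A : 'M[R]_(m, n)) :
  enorm A <= \sum_(p : 'I_m * 'I_n) `|A p.1 p.2|.
Proof.
have s0 : 0 <= \sum_(p : 'I_m * 'I_n) `|A p.1 p.2| by apply: sumr_ge0.
rewrite -ler_sqr ?nnegrE ?enorm_ge0 // enorm_sqrE [leRHS]expr2 mulr_suml.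
apply: ler_sum => p _.
rewrite -(real_normK (num_real _)) expr2 ler_wpM2l //.
by rewrite (bigD1 p) //= lerDl sumr_ge0.
Qed.

Lemma enorm_cV_le d (x : 'cV[R]_d) : enorm x <= \sum_i `|x i 0|.
Proof.
apply: le_trans (enorm_le_sum x) _.
by rewrite -(pair_bigA _ (fun i j => `|x i j|)) /=; apply: ler_sum => i _;
  rewrite big_ord1.
Qed.

Lemma enorm_cV_sqr d (x : 'cV[R]_d) : enorm x ^+ 2 = dotp x x.
Proof.
rewrite enorm_sqrE -(pair_bigA _ (fun i j => x i j ^+ 2)) /=.
by apply: eq_bigr => i _; rewrite big_ord1 expr2.
Qed.

Lemma dotp_le d (x y : 'cV[R]_d) : `|dotp x y| <= enorm x * enorm y.
Proof.
apply: le_trans (enorm_pair_sum_le x y).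
rewrite -(pair_bigA _ (fun i j => x i j * y i j)) /=.
by under [X in _ <= `|X|]eq_bigr do rewrite big_ord1.
Qed.

Lemma enorm_mulmx m n p (A : 'M[R]_(m, n)) (B : 'M[R]_(n, p)) :
  enorm (A *m B) <= enorm A * enorm B.
Proof.
rewrite -ler_sqr ?nnegrE ?mulr_ge0 ?enorm_ge0 // exprMn !enorm_sqrE.
rewrite -(pair_bigA _ (fun i j => A i j ^+ 2)) /=.
rewrite -(pair_bigA _ (fun i j => (A *m B) i j ^+ 2)) /=.
rewrite -(pair_bigA _ (fun i j => B i j ^+ 2)) /= [X in _ * X]exchange_big /=.
rewrite mulr_suml; apply: ler_sum => i _; rewrite mulr_sumr.
by apply: ler_sum => j _; rewrite mxE sum_cauchy_schwarz.
Qed.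

Lemma quad_le d (A : 'M[R]_d) (x : 'cV[R]_d) :
  `|dotp (A *m x) x| <= enorm A * enorm x ^+ 2.
Proof.
apply: le_trans (dotp_le _ _) _; rewrite expr2 mulrA ler_wpM2r ?enorm_ge0 //.
exact: enorm_mulmx.
Qed.

Lemma trace_mul_le d (A Q : 'M[R]_d) : `|\tr (A *m Q)| <= enorm A * enorm Q.
Proof.
have -> : \tr (A *m Q) = \sum_(p : 'I_d * 'I_d) A p.1 p.2 * Q^T p.1 p.2.
  rewrite -(pair_bigA _ (fun i j => A i j * Q^T i j)) /=.
  by apply: eq_bigr => i _; rewrite mxE; apply: eq_bigr => j _; rewrite mxE.
apply: le_trans (enorm_pair_sum_le _ _) _.
suff -> : enorm Q^T = enorm Q by [].
rewrite /enorm exchange_big /=; congr Num.sqrt.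
by apply: eq_bigr => i _; apply: eq_bigr => j _; rewrite mxE.
Qed.

Lemma dotpDl d (x y z : 'cV[R]_d) : dotp (x + y) z = dotp x z + dotp y z.
Proof. by rewrite -big_split; apply: eq_bigr => i _; rewrite mxE mulrDl. Qed.

Lemma dotpC d (x y : 'cV[R]_d) : dotp x y = dotp y x.
Proof. by apply: eq_bigr => i _; rewrite mulrC. Qed.

Lemma dotpDr d (x y z : 'cV[R]_d) : dotp z (x + y) = dotp z x + dotp z y.
Proof. by rewrite !(dotpC z) dotpDl. Qed.

Lemma dotpZl d c (x y : 'cV[R]_d) : dotp (c *: x) y = c * dotp x y.
Proof. by rewrite mulr_sumr; apply: eq_bigr => i _; rewrite mxE mulrA. Qed.

Lemma dotpZr d c (x y : 'cV[R]_d) : dotp y (c *: x) = c * dotp y x.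
Proof. by rewrite !(dotpC y) dotpZl. Qed.

Lemma dotpNl d (x y : 'cV[R]_d) : dotp (- x) y = - dotp x y.
Proof. by rewrite -scaleN1r dotpZl mulN1r. Qed.

Lemma dotpNr d (x y : 'cV[R]_d) : dotp y (- x) = - dotp y x.
Proof. by rewrite !(dotpC y) dotpNl. Qed.

Lemma dotp0r d (x : 'cV[R]_d) : dotp x 0 = 0.
Proof. by rewrite -(scale0r 0) dotpZr mul0r. Qed.

Lemma dotp_mulmx d (A : 'M[R]_d) (x y : 'cV[R]_d) :
  dotp (A *m x) y = dotp x (A^T *m y).
Proof.
rewrite /dotp; under eq_bigr do rewrite mxE mulr_suml.
rewrite exchange_big /=; apply: eq_bigr => i _.
by rewrite mxE mulr_sumr; apply: eq_bigr => j _; rewrite mxE; ring.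
Qed.

Lemma quadD d (A : 'M[R]_d) (x y : 'cV[R]_d) : sym_mx A ->
  dotp (A *m (x + y)) (x + y)
  = dotp (A *m x) x + 2 * dotp (A *m x) y + dotp (A *m y) y.
Proof.
move=> sA; rewrite mulmxDr !(dotpDl, dotpDr).
have -> : dotp (A *m y) x = dotp (A *m x) y by rewrite dotp_mulmx sA dotpC.
by ring.
Qed.

End EuclideanNorm.

(** * Locally Lipschitz functions of polynomial growth *)

Section LocallyLipschitz.
Context {R : realType}.

(** [1 + a + b] is at most three times its largest term, and the power of that term is one of the
    summands on the right. *)
Lemma exprD_le_sum3 (k : nat) (a b : R) : 0 <= a -> 0 <= b ->
  (1 + a + b) ^+ k <= 3 ^+ k * (1 + a ^+ k + b ^+ k).
Proof.
move=> a0 b0; have [m [m0 [hm hk]]] : exists m : R, [/\ 0 <= m,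
    1 + a + b <= 3 * m & m ^+ k <= 1 + a ^+ k + b ^+ k].
  have ak : 0 <= a ^+ k by apply: exprn_ge0.
  have bk : 0 <= b ^+ k by apply: exprn_ge0.
  have [ab|ba] := leP a b; [have [b1|b1] := leP b 1|have [a1|a1] := leP a 1].
  - exists 1; rewrite expr1n; split => //; lra.
  - exists b; split => //; lra.
  - exists 1; rewrite expr1n; split => //; lra.
  - exists a; split => //; lra.
apply: (@le_trans _ _ ((3 * m) ^+ k)); first by rewrite lerXn2r ?nnegrE //; lra.
by rewrite exprMn ler_wpM2l // exprn_ge0.
Qed.

(** Powers of a single base that is at least 1 are closed under products, and enlarging the exponent
    only weakens the bound; the closure lemmas below rely on this form. *)
Lemma C_l_LipP n (f : 'cV[R]_n -> R) :
  C_l_Lip f <-> exists (C : R) (k : nat), 0 <= C /\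
    forall x y, `|f x - f y| <= C * (1 + enorm x + enorm y) ^+ k * enorm (x - y).
Proof.
split=> [[C [k [C0 h]]]|[C [k [C0 h]]]].
  exists (3 * C), k; split=> [|x y]; first lra.
  apply: le_trans (h x y) _; rewrite ler_wpM2r ?enorm_ge0 //.
  have x0 := enorm_ge0 x; have y0 := enorm_ge0 y.
  have le1 (t : R) : 0 <= t -> t <= 1 + enorm x + enorm y ->
      t ^+ k <= (1 + enorm x + enorm y) ^+ k.
    by move=> t0 ht; rewrite lerXn2r ?nnegrE //; lra.
  have h1 : 1 <= (1 + enorm x + enorm y) ^+ k.
    by rewrite exprn_ege1 //; lra.
  have h2 := le1 _ x0 ltac:(lra); have h3 := le1 _ y0 ltac:(lra).
  rewrite (mulrC 3) -mulrA (ler_wpM2l (ltW C0)) //; move: h1 h2 h3.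
  move: (_ ^+ k) (enorm x ^+ k) (enorm y ^+ k) => *; lra.
exists (3 ^+ k * C + 1), k; split=> [|x y].
  by rewrite ltr_wpDl // mulr_ge0 // exprn_ge0.
apply: le_trans (h x y) _; rewrite ler_wpM2r ?enorm_ge0 //.
have := exprD_le_sum3 k (enorm_ge0 x) (enorm_ge0 y).
move=> /(ler_wpM2l C0) /le_trans; apply; rewrite mulrA (mulrC C).
rewrite ler_wpM2r ?lerDl // !addr_ge0 // exprn_ge0 ?enorm_ge0 //.
Qed.

Lemma one_enorm_ge1 n m (x : 'cV[R]_n) (y : 'cV[R]_m) :
  1 <= 1 + enorm x + enorm y.
Proof. by rewrite -addrA lerDl addr_ge0 ?enorm_ge0. Qed.

Lemma C_l_Lip_growth n (f : 'cV[R]_n -> R) : C_l_Lip f ->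
  exists (C : R) (k : nat), 0 <= C /\ forall x, `|f x| <= C * (1 + enorm x) ^+ k.
Proof.
move=> /C_l_LipP[C [k [C0 h]]]; exists (`|f 0| + C), k.+1.
split=> [|x]; first by rewrite addr_ge0.
have := h x 0; rewrite subr0 enorm0 addr0 => hx.
have x1 : 1 <= 1 + enorm x by rewrite lerDl enorm_ge0.
have -> : f x = f 0 + (f x - f 0) by ring.
apply: le_trans (ler_normD _ _) _; rewrite mulrDl lerD //.
  by rewrite ler_peMr // exprn_ege1.
apply: le_trans hx _; rewrite -mulrA ler_wpM2l // exprSr ler_wpM2l ?lerDr //.
by rewrite exprn_ge0 // (le_trans _ x1).
Qed.

Lemma le_growth (C C' : R) (k k' : nat) (r : R) :
  0 <= C -> C <= C' -> (k <= k')%N -> 1 <= r -> C * r ^+ k <= C' * r ^+ k'.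
Proof.
move=> C0 CC kk r1; apply: ler_pM => //; last by rewrite ler_weXn2l.
by rewrite exprn_ge0 // (le_trans _ r1).
Qed.

Lemma C_l_Lip_of_lipschitz n (f : 'cV[R]_n -> R) (L : R) :
  (forall x y, `|f x - f y| <= L * enorm (x - y)) -> C_l_Lip f.
Proof.
move=> h; apply/C_l_LipP; exists `|L|, 0%N; split=> // x y.
rewrite expr0 mulr1; apply: le_trans (h x y) _.
by rewrite ler_wpM2r ?enorm_ge0 // ler_norm.
Qed.

Lemma C_b_Lip_C_l_Lip n (f : 'cV[R]_n -> R) : C_b_Lip f -> C_l_Lip f.
Proof. by case=> _ [L hL]; apply: C_l_Lip_of_lipschitz hL. Qed.

Lemma C_l_Lip_cst n (c : R) : C_l_Lip (fun _ : 'cV[R]_n => c).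
Proof.
by apply: (@C_l_Lip_of_lipschitz _ _ 0) => x y; rewrite subrr normr0 mul0r.
Qed.

Lemma C_l_LipD n (f g : 'cV[R]_n -> R) :
  C_l_Lip f -> C_l_Lip g -> C_l_Lip (fun x => f x + g x).
Proof.
move=> /C_l_LipP[C [k [C0 hf]]] /C_l_LipP[D [l [D0 hg]]]; apply/C_l_LipP.
exists (C + D), (k + l)%N; split=> [|x y]; first by rewrite addr_ge0.
have -> : f x + g x - (f y + g y) = (f x - f y) + (g x - g y) by ring.
apply: le_trans (ler_normD _ _) _; rewrite !mulrDl lerD //.
  apply: le_trans (hf x y) _; rewrite ler_wpM2r ?enorm_ge0 //.
  by rewrite le_growth ?leq_addr ?one_enorm_ge1.
apply: le_trans (hg x y) _; rewrite ler_wpM2r ?enorm_ge0 //.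
by rewrite le_growth ?leq_addl ?one_enorm_ge1.
Qed.

Lemma C_l_LipM n (f g : 'cV[R]_n -> R) :
  C_l_Lip f -> C_l_Lip g -> C_l_Lip (fun x => f x * g x).
Proof.
move=> hf hg; have [Cf [kf [Cf0 gf]]] := C_l_Lip_growth hf.
have [Cg [kg [Cg0 gg]]] := C_l_Lip_growth hg.
move: hf hg => /C_l_LipP[C [k [C0 hf]]] /C_l_LipP[D [l [D0 hg]]]; apply/C_l_LipP.
exists (Cf * D + Cg * C), (kf + l + (kg + k))%N.
split=> [|x y]; first by rewrite addr_ge0 ?mulr_ge0.
have -> : f x * g x - f y * g y = f x * (g x - g y) + g y * (f x - f y) by ring.
apply: le_trans (ler_normD _ _) _; rewrite !normrM !mulrDl.
set r := 1 + enorm x + enorm y.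
have r1 : 1 <= r := one_enorm_ge1 x y.
have rn (j : nat) : 0 <= r ^+ j by rewrite exprn_ge0 // (le_trans _ r1).
have growth (h : 'cV[R]_n -> R) (H : R) (j : nat) z : 0 <= H ->
    (forall x, `|h x| <= H * (1 + enorm x) ^+ j) -> 1 + enorm z <= r ->
    `|h z| <= H * r ^+ j.
  move=> H0 hh hz; apply: le_trans (hh z) _; rewrite ler_wpM2l //.
  by rewrite lerXn2r // nnegrE ?addr_ge0 ?enorm_ge0 // (le_trans _ r1).
have fx : `|f x| <= Cf * r ^+ kf.
  by apply: growth => //; rewrite /r lerDl enorm_ge0.
have gy : `|g y| <= Cg * r ^+ kg.
  by apply: growth => //; rewrite /r addrAC lerDl enorm_ge0.
apply: lerD.
  apply: (@le_trans _ _ (Cf * r ^+ kf * (D * r ^+ l * enorm (x - y)))).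
    by rewrite ler_pM.
  rewrite !mulrA ler_wpM2r ?enorm_ge0 // [leLHS](_ : _ = Cf * D * r ^+ (kf + l));
    last by rewrite exprD; ring.
  by rewrite le_growth ?mulr_ge0 ?leq_addr.
apply: (@le_trans _ _ (Cg * r ^+ kg * (C * r ^+ k * enorm (x - y)))).
  by rewrite ler_pM.
rewrite !mulrA ler_wpM2r ?enorm_ge0 // [leLHS](_ : _ = Cg * C * r ^+ (kg + k));
  last by rewrite exprD; ring.
by rewrite le_growth ?mulr_ge0 ?leq_addl.
Qed.

Lemma C_l_LipZ n (c : R) (f : 'cV[R]_n -> R) :
  C_l_Lip f -> C_l_Lip (fun x => c * f x).
Proof. by move=> hf; apply: C_l_LipM => //; apply: C_l_Lip_cst. Qed.

Lemma C_l_LipN n (f : 'cV[R]_n -> R) : C_l_Lip f -> C_l_Lip (fun x => - f x).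
Proof.
by move=> /(C_l_LipZ (-1)); congr C_l_Lip; apply/funext => x; rewrite mulN1r.
Qed.

Lemma C_l_LipB n (f g : 'cV[R]_n -> R) :
  C_l_Lip f -> C_l_Lip g -> C_l_Lip (fun x => f x - g x).
Proof. by move=> hf /C_l_LipN; apply: C_l_LipD. Qed.

Lemma C_l_LipX n (f : 'cV[R]_n -> R) k :
  C_l_Lip f -> C_l_Lip (fun x => f x ^+ k).
Proof.
move=> hf; elim: k => [|k IH].
  by under eq_fun do rewrite expr0; apply: C_l_Lip_cst.
by under eq_fun do rewrite exprS; apply: C_l_LipM.
Qed.

Lemma C_l_Lip_sum n (I : Type) (s : seq I) (f : I -> 'cV[R]_n -> R) :
  (forall i, C_l_Lip (f i)) -> C_l_Lip (fun x => \sum_(i <- s) f i x).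
Proof.
move=> hf; elim: s => [|i s IH].
  by under eq_fun do rewrite big_nil; apply: C_l_Lip_cst.
by under eq_fun do rewrite big_cons; apply: C_l_LipD.
Qed.

Lemma C_l_Lip_norm n (f : 'cV[R]_n -> R) :
  C_l_Lip f -> C_l_Lip (fun x => `|f x|).
Proof.
move=> [C [k [C0 h]]]; exists C, k; split=> // x y.
exact: le_trans (ler_dist_dist _ _) (h x y).
Qed.

Lemma C_l_Lip_enorm n : C_l_Lip (@enorm R n 1).
Proof.
by apply: (@C_l_Lip_of_lipschitz _ _ 1) => x y; rewrite mul1r enorm_dist.
Qed.

Lemma C_l_Lip_coord n i : C_l_Lip (fun x : 'cV[R]_n => x i 0).
Proof.
apply: (@C_l_Lip_of_lipschitz _ _ 1) => x y; rewrite mul1r.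
by have := enorm_entry (x - y) i 0; rewrite !mxE.
Qed.

Lemma C_l_Lip_dotp n (X Y : 'cV[R]_n -> 'cV[R]_n) :
  (forall i, C_l_Lip (fun x => X x i 0)) ->
  (forall i, C_l_Lip (fun x => Y x i 0)) -> C_l_Lip (fun x => dotp (X x) (Y x)).
Proof. by move=> hX hY; apply: C_l_Lip_sum => i; apply: C_l_LipM. Qed.

Lemma C_l_Lip_linear n (g : 'cV[R]_n) : C_l_Lip (dotp g).
Proof.
apply: C_l_Lip_dotp => i; [exact: C_l_Lip_cst|exact: C_l_Lip_coord].
Qed.

Lemma C_l_Lip_quad n (A : 'M[R]_n) : C_l_Lip (fun x => dotp (A *m x) x).
Proof.
apply: C_l_Lip_dotp => i; last exact: C_l_Lip_coord.
under eq_fun do rewrite mxE; apply: C_l_Lip_sum => j.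
by apply: C_l_LipZ; apply: C_l_Lip_coord.
Qed.

(** Polynomial local Lipschitz constants compose: the increment and the size of [X x] are both
    bounded by powers of the same base [1 + enorm x + enorm y]. *)
Lemma C_l_Lip_comp n m (X : 'cV[R]_n -> 'cV[R]_m) (phi : 'cV[R]_m -> R) :
  (forall i, C_l_Lip (fun x => X x i 0)) -> C_l_Lip phi ->
  C_l_Lip (fun x => phi (X x)).
Proof.
move=> hX /C_l_LipP[C [k [C0 hphi]]].
have [D [l [D0 hD]]] : exists (D : R) (l : nat), 0 <= D /\ forall x y,
    enorm (X x - X y) <= D * (1 + enorm x + enorm y) ^+ l * enorm (x - y).
  have hloc (i : 'I_m) : exists p : R * nat, 0 <= p.1 /\ forall x y,
     `|X x i 0 - X y i 0| <= p.1 * (1 + enorm x + enorm y) ^+ p.2 * enorm (x - y).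
    by have /C_l_LipP[a [b hab]] := hX i; exists (a, b).
  have [F hF] := choice hloc.
  exists (\sum_i (F i).1), (\sum_i (F i).2)%N.
  split=> [|x y]; first by apply: sumr_ge0 => i _; have [] := hF i.
  apply: le_trans (enorm_cV_le _) _; rewrite !mulr_suml; apply: ler_sum => i _.
  have [Fi0 Fi] := hF i; rewrite !mxE; apply: le_trans (Fi x y) _.
  rewrite ler_wpM2r ?enorm_ge0 // le_growth ?one_enorm_ge1 //.
  by rewrite (bigD1 i) //= leq_addr.
have [E [p [E0 hE]]] : exists (E : R) (p : nat), 0 <= E /\ forall x y,
    1 + enorm (X x) + enorm (X y) <= E * (1 + enorm x + enorm y) ^+ p.
  have [e0 e1] : 0 <= enorm (X 0) /\ 0 <= 1 + 2 * enorm (X 0) + 2 * D.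
    by have := enorm_ge0 (X 0); lra.
  exists (1 + 2 * enorm (X 0) + 2 * D), l.+1; split=> // x y.
  set r := 1 + enorm x + enorm y; have r1 : 1 <= r := one_enorm_ge1 x y.
  have gr (z : 'cV[R]_n) : 1 + enorm z <= r ->
      enorm (X z) <= enorm (X 0) + D * r ^+ l.+1.
    move=> zr; rewrite -[X z](subrK (X 0)) addrC.
    apply: le_trans (enormD _ _) _; rewrite lerD2l.
    apply: le_trans (hD z 0) _; rewrite subr0 enorm0 addr0 -mulrA ler_wpM2l //.
    have z0 := enorm_ge0 z; rewrite exprSr ler_pM ?exprn_ge0 ?addr_ge0 //.
      by rewrite lerXn2r // nnegrE; lra.
    by lra.
  have x0 := enorm_ge0 x; have y0 := enorm_ge0 y.
  have hx := gr x ltac:(rewrite /r; lra); have hy := gr y ltac:(rewrite /r; lra).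
  have rl : 1 <= r ^+ l.+1 by rewrite exprn_ege1.
  have := ler_wpM2l e0 rl; rewrite mulr1 => he; move: hx hy rl he.
  rewrite !mulrDl -!mulrA mul1r; lra.
apply/C_l_LipP; exists (C * E ^+ k * D), (p * k + l)%N.
split=> [|x y]; first by rewrite !mulr_ge0 // exprn_ge0.
apply: le_trans (hphi _ _) _.
apply: (@le_trans _ _ (C * (E * (1 + enorm x + enorm y) ^+ p) ^+ k *
   (D * (1 + enorm x + enorm y) ^+ l * enorm (x - y)))).
  have r0 q (z z' : 'cV[R]_q) : 0 <= 1 + enorm z + enorm z'.
    exact: le_trans ler01 (one_enorm_ge1 z z').
  rewrite ler_pM ?mulr_ge0 ?exprn_ge0 ?enorm_ge0 // ?ler_wpM2l //.
  by rewrite lerXn2r ?nnegrE ?mulr_ge0 ?exprn_ge0.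
rewrite exprMn -exprM exprD le_eqVlt; apply/orP; left; apply/eqP; ring.
Qed.

Lemma C_l_Lip_affine n (x : 'cV[R]_n) (c : R) (f : 'cV[R]_n -> R) :
  C_l_Lip f -> C_l_Lip (fun y => f (x + c *: y)).
Proof.
apply: C_l_Lip_comp => i; under eq_fun do rewrite !mxE.
apply: C_l_LipD; first exact: C_l_Lip_cst.
by apply: C_l_LipZ; apply: C_l_Lip_coord.
Qed.

Lemma C_l_Lip_shift n (x : 'cV[R]_n) (f : 'cV[R]_n -> R) :
  C_l_Lip f -> C_l_Lip (fun y => f (x + y)).
Proof. by move=> /(C_l_Lip_affine x 1); under eq_fun do rewrite scale1r. Qed.

Lemma C_l_Lip_scale n (c : R) (f : 'cV[R]_n -> R) :
  C_l_Lip f -> C_l_Lip (fun y => f (c *: y)).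
Proof. by move=> /(C_l_Lip_affine 0 c); under eq_fun do rewrite add0r. Qed.

End LocallyLipschitz.

(** * Sublinear laws and chains of one-step operators *)

Section Laws.
Context {R : realType}.

(** The distribution of a random vector, kept as a functional of test functions so that vectors on
    different spaces can be compared. Outside [C_l_Lip] its values are unconstrained. *)
Record law d (p : ('cV[R]_d -> R) -> R) : Prop := Law {
  law_mono : forall f g, C_l_Lip f -> C_l_Lip g ->
    (forall x, f x <= g x) -> p f <= p g;
  law_cst : forall c, p (fun=> c) = c;
  law_subadd : forall f g, C_l_Lip f -> C_l_Lip g ->
    p (fun x => f x + g x) <= p f + p g;
  law_poshom : forall c f, C_l_Lip f -> 0 <= c ->
    p (fun x => c * f x) = c * p f }.

(** Since [- g] is also allowed, linear functions have value 0 in both directions: the mean carries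
    no uncertainty. *)
Definition centered d (p : ('cV[R]_d -> R) -> R) := forall g, p (dotp g) = 0.

(** The function G of the law. *)
Definition half_cov d (p : ('cV[R]_d -> R) -> R) (A : 'M[R]_d) :=
  p (fun y => 2^-1 * dotp (A *m y) y).

Definition moment3 d (p : ('cV[R]_d -> R) -> R) := p (fun y => enorm y ^+ 3).

Definition scale_law d (c : R) (p : ('cV[R]_d -> R) -> R) :=
  fun f : 'cV[R]_d -> R => p (fun y => f (c *: y)).

Definition step d (p : ('cV[R]_d -> R) -> R) (f : 'cV[R]_d -> R) :=
  fun x => p (fun y => f (x + y)).

(** The operator of index [n - 1] acts on [f] first and that of index 0 last: a later increment is
    independent from the earlier ones, so its expectation is the inner one. *)
Fixpoint chain d (ps : nat -> ('cV[R]_d -> R) -> R) n (f : 'cV[R]_d -> R) :=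
  if n is k.+1 then chain ps k (step (ps k) f) else f.

Definition bounded_lip d (K L : R) (f : 'cV[R]_d -> R) :=
  (forall x, `|f x| <= K) /\ (forall x y, `|f x - f y| <= L * enorm (x - y)).

Lemma bounded_lip_C_b_Lip d (K L : R) (f : 'cV[R]_d -> R) :
  bounded_lip K L f -> C_b_Lip f.
Proof. by move=> [hK hL]; split; [exists K|exists L]. Qed.

Lemma bounded_lip_C_l_Lip d (K L : R) (f : 'cV[R]_d -> R) :
  bounded_lip K L f -> C_l_Lip f.
Proof. by move=> /bounded_lip_C_b_Lip; exact: C_b_Lip_C_l_Lip. Qed.

Lemma C_l_Lip_enorm3 d : C_l_Lip (fun y : 'cV[R]_d => enorm y ^+ 3).
Proof. by apply: C_l_LipX; apply: C_l_Lip_enorm. Qed.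

Lemma C_l_Lip_halfquad d (A : 'M[R]_d) :
  C_l_Lip (fun y : 'cV[R]_d => 2^-1 * dotp (A *m y) y).
Proof. by apply: C_l_LipZ; apply: C_l_Lip_quad. Qed.

Section OneLaw.
Context (d : nat) (p : ('cV[R]_d -> R) -> R) (hp : law p).

(** Sub-additivity gives one inequality; applied to [c + f] and the constant [- c] it gives the
    other. *)
Lemma law_addc c f : C_l_Lip f -> p (fun y => c + f y) = c + p f.
Proof.
move=> hf; have hc := @C_l_Lip_cst R d.
apply/eqP; rewrite eq_le; apply/andP; split.
  by have := law_subadd hp (hc c) hf; rewrite (law_cst hp).
have := law_subadd hp (hc (- c)) (C_l_LipD (hc c) hf).
rewrite (law_cst hp); under eq_fun do rewrite addKr; lra.
Qed.

Lemma law_le_norm f : C_l_Lip f -> `|p f| <= p (fun y => `|f y|).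
Proof.
move=> hf; have hn := C_l_Lip_norm hf; have hN := C_l_LipN hf.
rewrite ler_norml; apply/andP; split; last first.
  by apply: (law_mono hp) => // x; exact: ler_norm.
rewrite lerNl.
have := law_subadd hp hf hN; under eq_fun do rewrite subrr.
rewrite (law_cst hp) => h; apply: (@le_trans _ _ (p (fun y => - f y))); first lra.
by apply: (law_mono hp) => // x; rewrite -normrN; exact: ler_norm.
Qed.

Lemma law_dist f g : C_l_Lip f -> C_l_Lip g ->
  `|p f - p g| <= p (fun y => `|f y - g y|).
Proof.
have h u v : C_l_Lip u -> C_l_Lip v -> p u - p v <= p (fun y => `|u y - v y|).
  move=> hu hv; have huv := C_l_LipB hu hv.
  rewrite lerBlDl; apply: le_trans (law_subadd hp hv (C_l_Lip_norm huv)).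
  apply: (law_mono hp) => //; first exact: C_l_LipD (C_l_Lip_norm _).
  by move=> x; rewrite -lerBlDl; exact: ler_norm.
move=> hf hg; rewrite ler_norml h // andbT lerNl opprB.
by apply: le_trans (h _ _ hg hf) _; under eq_fun do rewrite distrC.
Qed.

Lemma law_dist_le c f g : C_l_Lip f -> C_l_Lip g ->
  (forall y, `|f y - g y| <= c) -> `|p f - p g| <= c.
Proof.
move=> hf hg h; apply: le_trans (law_dist hf hg) _; rewrite -[leRHS](law_cst hp).
apply: (law_mono hp) => //; last exact: C_l_Lip_cst.
exact: C_l_Lip_norm (C_l_LipB hf hg).
Qed.

Lemma law_ge0 f : C_l_Lip f -> (forall y, 0 <= f y) -> 0 <= p f.
Proof.
move=> hf h; rewrite -{1}(law_cst hp 0).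
by apply: (law_mono hp) => //; apply: C_l_Lip_cst.
Qed.

Lemma moment3_ge0 : 0 <= moment3 p.
Proof.
apply: law_ge0; first exact: C_l_Lip_enorm3.
by move=> y; rewrite exprn_ge0 // enorm_ge0.
Qed.

(** A linear function and its opposite both have value 0, so adding one and removing it again costs
    nothing and sub-additivity becomes an equality. *)
Lemma law_linear_add (hc : centered p) c g f : C_l_Lip f ->
  p (fun y => c + dotp g y + f y) = c + p f.
Proof.
move=> hf.
have lin u := @C_l_Lip_linear R d u; have hcst := @C_l_Lip_cst R d c.
under eq_fun do rewrite -addrA.
rewrite law_addc; last exact: C_l_LipD.
congr (c + _); apply/eqP; rewrite eq_le; apply/andP; split.
  by have := law_subadd hp (lin g) hf; rewrite hc add0r.
have := law_subadd hp (lin (- g)) (C_l_LipD (lin g) hf).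
by under eq_fun do rewrite dotpNl addKr; rewrite hc add0r.
Qed.

Lemma law_sum_le (I : finType) (lam : I -> R) (f : I -> 'cV[R]_d -> R) :
  (forall i, 0 <= lam i) -> (forall i, C_l_Lip (f i)) ->
  p (fun y => \sum_i lam i * f i y) <= \sum_i lam i * p (f i).
Proof.
move=> l0 hf; elim: (index_enum I) => [|i s IH].
  by under eq_fun do rewrite big_nil; rewrite big_nil (law_cst hp).
under eq_fun do rewrite big_cons; rewrite big_cons -(law_poshom hp) //.
apply: le_trans (law_subadd hp _ _) _; rewrite ?lerD2l //; first exact: C_l_LipZ.
by apply: C_l_Lip_sum => j; apply: C_l_LipZ.
Qed.

Lemma scale_law_law c : law (scale_law c p).
Proof.
have hs := @C_l_Lip_scale R d c.
split=> [f g hf hg h|x|f g hf hg|x f hf x0]; rewrite /scale_law.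
- by apply: (law_mono hp); [exact: hs|exact: hs|].
- exact: (law_cst hp).
- by apply: (law_subadd hp); exact: hs.
- by rewrite (law_poshom hp) //; exact: hs.
Qed.

Lemma scale_law_centered c : centered p -> centered (scale_law c p).
Proof.
move=> hc g; rewrite /scale_law -(hc (c *: g)).
by under eq_fun do rewrite dotpZr -dotpZl.
Qed.

Lemma scale_law_half_cov c A : half_cov (scale_law c p) A = c ^+ 2 * half_cov p A.
Proof.
rewrite /half_cov /scale_law -(law_poshom hp) ?sqr_ge0 //; last first.
  exact: C_l_Lip_halfquad.
congr p; apply/funext => y; rewrite -scalemxAr dotpZl dotpZr; ring.
Qed.

Lemma scale_law_moment3 c : 0 <= c -> moment3 (scale_law c p) = c ^+ 3 * moment3 p.
Proof.
move=> c0; rewrite /moment3 /scale_law -(law_poshom hp) ?exprn_ge0 //.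
  by under eq_fun do rewrite enormZ ger0_norm // exprMn.
exact: C_l_Lip_enorm3.
Qed.

(** Since r^2 is at most 1 + r^3, the third moment controls the covariance. *)
Lemma half_cov_le A : `|half_cov p A| <= enorm A * (1 + moment3 p).
Proof.
apply: le_trans (law_le_norm (C_l_Lip_halfquad A)) _.
rewrite -(law_addc _ (@C_l_Lip_enorm3 d)) -(law_poshom hp) ?enorm_ge0 //; last first.
  by apply: C_l_LipD; [exact: C_l_Lip_cst|exact: C_l_Lip_enorm3].
apply: (law_mono hp).
- by apply: C_l_Lip_norm; exact: C_l_Lip_halfquad.
- apply: C_l_LipZ; apply: C_l_LipD; [exact: C_l_Lip_cst|exact: C_l_Lip_enorm3].
move=> x; rewrite normrM.
have := quad_le A x; have := enorm_ge0 x; have := enorm_ge0 A.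
have -> : `|2^-1 : R| = 2^-1 by rewrite ger0_norm ?invr_ge0.
move: (enorm x) (enorm A) `|dotp _ _| => r a q a0 r0 h.
have : r ^+ 2 <= 1 + r ^+ 3.
  have [r1|r1] := leP r 1.
    by apply: (@le_trans _ _ 1); rewrite ?exprn_ile1 // lerDl exprn_ge0.
  apply: (@le_trans _ _ (r ^+ 3)); last by rewrite lerDr.
  by rewrite ler_weXn2l // ltW.
move=> /(ler_wpM2l a0); have : 0 <= a * r ^+ 2 by rewrite mulr_ge0 ?sqr_ge0.
move: h; move: (a * _) (a * _) => u v; lra.
Qed.

(** Under a centered law the gradient term drops out and the quadratic term contributes exactly
    [half_cov p A]; only the remainder is estimated. *)
Lemma law_taylor (hc : centered p) v x g A C eta : C_l_Lip v -> 0 <= C ->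
  (forall y, `|v (x + y) - v x - dotp g y - 2^-1 * dotp (A *m y) y|
     <= C * enorm y ^+ 3 + eta) ->
  `|step p v x - v x - half_cov p A| <= C * moment3 p + eta.
Proof.
move=> hv C0 h.
rewrite /step -addrA -opprD /half_cov.
rewrite -(law_linear_add hc (v x) g (C_l_Lip_halfquad A)).
have hq : C_l_Lip (fun y => v x + dotp g y + 2^-1 * dotp (A *m y) y).
  apply: C_l_LipD (C_l_Lip_halfquad A); apply: C_l_LipD (C_l_Lip_linear g).
  exact: C_l_Lip_cst.
apply: le_trans (law_dist (C_l_Lip_shift x hv) hq) _.
rewrite [leRHS]addrC /moment3 -(law_poshom hp) //; last exact: C_l_Lip_enorm3.
have hm : C_l_Lip (fun y : 'cV[R]_d => C * enorm y ^+ 3).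
  by apply: C_l_LipZ; apply: C_l_Lip_enorm3.
rewrite -(law_addc _ hm); apply: (law_mono hp).
- by apply: C_l_Lip_norm; apply: C_l_LipB => //; apply: C_l_Lip_shift.
- by apply: C_l_LipD => //; exact: C_l_Lip_cst.
by move=> y; rewrite [leRHS]addrC !opprD !addrA.
Qed.

End OneLaw.

End Laws.

(** * Iterated one-step operators and their comparison *)

Section Chains.
Context {R : realType}.

Lemma enorm_col_mx_le m n (x : 'cV[R]_m) (y : 'cV[R]_n) :
  enorm (col_mx x y) <= enorm x + enorm y.
Proof.
rewrite -ler_sqr ?nnegrE ?addr_ge0 ?enorm_ge0 // enorm_cV_sqr /dotp.
rewrite big_split_ord /=; under eq_bigr do rewrite col_mxEu.
under [X in _ + X <= _]eq_bigr do rewrite col_mxEd.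
rewrite -!/(dotp _ _) -!enorm_cV_sqr sqrrD lerD2r lerDl.
by rewrite mulrn_wge0 // mulr_ge0 ?enorm_ge0.
Qed.

(** The weight splits as 1 + |(x,y)| + |(x',y)| <= (1 + |x| + |x'|) (1 + 2 |y|), so its [y] part
    integrates to the constant [D]. This keeps iterated expectations within the test functions. *)
Lemma C_l_Lip_law_param m n (p : ('cV[R]_n -> R) -> R) (Phi : 'cV[R]_(m + n) -> R) :
  law p -> C_l_Lip Phi -> C_l_Lip (fun x => p (fun y => Phi (col_mx x y))).
Proof.
move=> hp hPhi.
have hy x : C_l_Lip (fun y => Phi (col_mx x y)).
  apply: C_l_Lip_comp => // i; rewrite -(splitK i).
  case: (fintype.split i) => j /=.
    by under eq_fun do rewrite col_mxEu; exact: C_l_Lip_cst.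
  by under eq_fun do rewrite col_mxEd; exact: C_l_Lip_coord.
have /C_l_LipP[C [k [C0 h]]] := hPhi.
have hg : C_l_Lip (fun y : 'cV[R]_n => (1 + 2 * enorm y) ^+ k).
  apply: C_l_LipX; apply: C_l_LipD; first exact: C_l_Lip_cst.
  by apply: C_l_LipZ; exact: C_l_Lip_enorm.
set D := p (fun y => (1 + 2 * enorm y) ^+ k).
have D0 : 0 <= D.
  by apply: law_ge0 => // y; rewrite exprn_ge0 // addr_ge0 ?mulr_ge0 ?enorm_ge0.
apply/C_l_LipP; exists (C * D), k; split=> [|x x']; first exact: mulr_ge0.
apply: le_trans (law_dist hp (hy x) (hy x')) _.
have -> : C * D * (1 + enorm x + enorm x') ^+ k * enorm (x - x') =
    C * (1 + enorm x + enorm x') ^+ k * enorm (x - x') * D by ring.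
have hx0 : 0 <= C * (1 + enorm x + enorm x') ^+ k * enorm (x - x').
  by rewrite !mulr_ge0 ?exprn_ge0 ?addr_ge0 ?enorm_ge0.
rewrite -(law_poshom hp) //; apply: (law_mono hp).
- exact: C_l_Lip_norm (C_l_LipB _ _).
- exact: C_l_LipZ.
move=> y; apply: le_trans (h _ _) _.
have -> : col_mx x y - col_mx x' y = col_mx (x - x') 0.
  by rewrite opp_col_mx add_col_mx subrr.
have hd : enorm (col_mx (x - x') (0 : 'cV[R]_n)) <= enorm (x - x').
  by apply: le_trans (enorm_col_mx_le _ _) _; rewrite enorm0 addr0.
have e1 := enorm_col_mx_le x y; have e2 := enorm_col_mx_le x' y.
have [x0 x'0 y0] := And3 (enorm_ge0 x) (enorm_ge0 x') (enorm_ge0 y).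
have c0 : 0 <= 1 + enorm (col_mx x y) + enorm (col_mx x' y).
  by rewrite !addr_ge0 ?enorm_ge0.
have [xx xy] : 0 <= enorm x * enorm y /\ 0 <= enorm x' * enorm y.
  by rewrite !mulr_ge0.
have hb : (1 + enorm (col_mx x y) + enorm (col_mx x' y)) ^+ k <=
    ((1 + enorm x + enorm x') * (1 + 2 * enorm y)) ^+ k.
  rewrite lerXn2r ?nnegrE //; last nra.
  by rewrite mulr_ge0 ?addr_ge0 ?mulr_ge0.
rewrite [leRHS](_ : _ = C * ((1 + enorm x + enorm x') * (1 + 2 * enorm y)) ^+ k
  * enorm (x - x')); last by rewrite exprMn; ring.
by rewrite ler_pM ?enorm_ge0 ?mulr_ge0 ?exprn_ge0 // ler_wpM2l.
Qed.

Context (d : nat).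
Implicit Types (f g : 'cV[R]_d -> R) (p : ('cV[R]_d -> R) -> R).

Section Step.
Context (p : ('cV[R]_d -> R) -> R) (hp : law p).

Lemma step_C_l_Lip f : C_l_Lip f -> C_l_Lip (step p f).
Proof.
move=> hf; pose F (v : 'cV[R]_(d + d)) := f (usubmx v + dsubmx v).
have -> : step p f = fun x => p (fun y => F (col_mx x y)).
  apply/funext => x; congr p; apply/funext => y.
  by rewrite /F col_mxKu col_mxKd.
apply: C_l_Lip_law_param => //; apply: C_l_Lip_comp => // i.
by under eq_fun do rewrite !mxE; apply: C_l_LipD; exact: C_l_Lip_coord.
Qed.

Lemma step_mono f g : C_l_Lip f -> C_l_Lip g -> (forall x, f x <= g x) ->
  forall x, step p f x <= step p g x.
Proof. by move=> hf hg h x; apply: (law_mono hp) => //; exact: C_l_Lip_shift. Qed.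

(** Neither constant grows, because a step is a sublinear average of translates of [f]; the
    constants therefore survive chains of any length. *)
Lemma step_bounded_lip K L f : bounded_lip K L f -> bounded_lip K L (step p f).
Proof.
move=> hf; have hcl := bounded_lip_C_l_Lip hf; case: hf => hK hL.
split=> [x|x y].
  rewrite -[step p f x]subr0 -(law_cst hp 0).
  apply: law_dist_le => //; [exact: C_l_Lip_shift|exact: C_l_Lip_cst|].
  by move=> y; rewrite subr0.
apply: (law_dist_le hp); try exact: C_l_Lip_shift.
by move=> z; apply: le_trans (hL _ _) _; rewrite opprD addrACA subrr addr0.
Qed.

End Step.

Section Chain.
Context (ps : nat -> ('cV[R]_d -> R) -> R) (hps : forall k, law (ps k)).

Lemma chain_C_l_Lip n f : C_l_Lip f -> C_l_Lip (chain ps n f).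
Proof. by elim: n f => //= n IH f hf; apply: IH; apply: step_C_l_Lip. Qed.

Lemma chain_bounded_lip K L n f :
  bounded_lip K L f -> bounded_lip K L (chain ps n f).
Proof. by elim: n f => //= n IH f hf; apply: IH; apply: step_bounded_lip. Qed.

Lemma chain_mono n f g : C_l_Lip f -> C_l_Lip g -> (forall x, f x <= g x) ->
  forall x, chain ps n f x <= chain ps n g x.
Proof.
elim: n f g => [|n IH] f g hf hg h x //=.
by apply: IH; [exact: step_C_l_Lip|exact: step_C_l_Lip|exact: step_mono].
Qed.

Lemma chain_addc n c f x : C_l_Lip f ->
  chain ps n (fun y => c + f y) x = c + chain ps n f x.
Proof.
elim: n f => //= n IH f hf; rewrite -IH; last exact: step_C_l_Lip.
congr chain; apply/funext => y; rewrite /step law_addc //; exact: C_l_Lip_shift.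
Qed.

Lemma chain_cst n c x : chain ps n (fun=> c) x = c.
Proof.
elim: n => //= n IH; rewrite -[RHS]IH; congr chain; apply/funext => y.
by rewrite /step (law_cst (hps n)).
Qed.

Lemma chain_subadd n f g x : C_l_Lip f -> C_l_Lip g ->
  chain ps n (fun y => f y + g y) x <= chain ps n f x + chain ps n g x.
Proof.
elim: n f g x => //= n IH f g x hf hg.
have hs := step_C_l_Lip (hps n).
apply: le_trans (IH _ _ _ (hs _ hf) (hs _ hg)); apply: chain_mono.
- by apply: hs; apply: C_l_LipD.
- by apply: C_l_LipD; apply: hs.
by move=> y; apply: (law_subadd (hps n)); apply: C_l_Lip_shift.
Qed.

Lemma chain_poshom n c f x : C_l_Lip f -> 0 <= c ->
  chain ps n (fun y => c * f y) x = c * chain ps n f x.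
Proof.
elim: n f => //= n IH f hf c0; rewrite -IH //; last exact: step_C_l_Lip.
congr chain; apply/funext => y; rewrite /step (law_poshom (hps n)) //.
exact: C_l_Lip_shift.
Qed.

Lemma chain_law n : law (fun f => chain ps n f 0).
Proof.
split=> [f g hf hg h|c|f g hf hg|c f hf c0].
- exact: chain_mono.
- exact: chain_cst.
- exact: chain_subadd.
- exact: chain_poshom.
Qed.

Lemma chain_dist_le n c f g x : C_l_Lip f -> C_l_Lip g ->
  (forall y, `|f y - g y| <= c) -> `|chain ps n f x - chain ps n g x| <= c.
Proof.
move=> hf hg h.
have key u v : C_l_Lip u -> C_l_Lip v -> (forall y, `|u y - v y| <= c) ->
    chain ps n u x - chain ps n v x <= c.
  move=> hu hv huv; rewrite lerBlDr -chain_addc //; apply: chain_mono => //.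
    by apply: C_l_LipD => //; exact: C_l_Lip_cst.
  by move=> y; rewrite -lerBlDr; apply: le_trans (huv y); exact: ler_norm.
rewrite ler_norml key // andbT lerNl opprB key // => y; by rewrite distrC.
Qed.

Lemma chain_shift n f x z :
  chain ps n (fun y => f (x + y)) z = chain ps n f (x + z).
Proof.
elim: n f => //= n IH f; rewrite -IH; congr chain; apply/funext => y.
by rewrite /step; under eq_fun do rewrite addrA.
Qed.

(** By translation invariance a whole block of steps is one step of the law that the block has when
    started at 0. *)
Lemma step_chain n f x :
  step (fun h => chain ps n h 0) f x = chain ps n f x.
Proof. by rewrite /step chain_shift addr0. Qed.

Lemma chain_linear (hc : forall k, centered (ps k)) n (g x : 'cV[R]_d) :
  chain ps n (dotp g) x = dotp g x.
Proof.
elim: n => //= n IH; rewrite -[RHS]IH; congr chain; apply/funext => y.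
rewrite /step; under eq_fun do rewrite dotpDr -[_ + _]addr0.
rewrite law_linear_add //; last exact: C_l_Lip_cst.
by rewrite (law_cst (hps n)) addr0.
Qed.

Lemma chain_centered n : (forall k, centered (ps k)) ->
  centered (fun f => chain ps n f 0).
Proof. by move=> hc g; rewrite chain_linear // dotp0r. Qed.

(** Expanding the form at [y + z], the cross term is linear in the new increment [z] and vanishes by
    centering. Hence the functions G of successive increments add exactly, although the operators
    are only sublinear. *)
Lemma chain_quad (hc : forall k, centered (ps k)) n (A : 'M[R]_d) (x : 'cV[R]_d) :
  sym_mx A ->
  chain ps n (fun y => 2^-1 * dotp (A *m y) y) x
  = 2^-1 * dotp (A *m x) x + \sum_(k < n) half_cov (ps k) A.
Proof.
move=> sA; elim: n => [|n IH]; first by rewrite big_ord0 addr0.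
rewrite big_ord_recr /= addrA -IH addrC -chain_addc; last exact: C_l_Lip_halfquad.
congr chain; apply/funext => y; rewrite /step.
under eq_fun => z.
  have -> : 2^-1 * dotp (A *m (y + z)) (y + z) =
    2^-1 * dotp (A *m y) y + dotp (A *m y) z + 2^-1 * dotp (A *m z) z.
    by rewrite quadD //; field.
  over.
by rewrite law_linear_add //; [exact: addrC|exact: C_l_Lip_halfquad].
Qed.

Lemma chain_half_cov (hc : forall k, centered (ps k)) n A : sym_mx A ->
  half_cov (fun f => chain ps n f 0) A = \sum_(k < n) half_cov (ps k) A.
Proof. by move=> sA; rewrite /half_cov chain_quad // dotp0r mulr0 add0r. Qed.

End Chain.

Lemma eq_chain ps qs n f : (forall k, (k < n)%N -> ps k = qs k) ->
  chain ps n f = chain qs n f.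
Proof.
elim: n f => //= n IH f h; rewrite h // IH // => k kn; apply: h; exact: ltnW.
Qed.

Lemma chain_cat ps m n f :
  chain ps (m + n) f = chain ps m (chain (fun k => ps (m + k)%N) n f).
Proof. by elim: n f => [|n IH] f; rewrite ?addn0 // addnS /= IH. Qed.

Lemma chain_scale c ps n f x :
  chain (fun k => scale_law c (ps k)) n f (c *: x)
  = chain ps n (fun y => f (c *: y)) x.
Proof.
elim: n f => //= n IH f; rewrite IH; congr chain; apply/funext => y.
rewrite /step /scale_law; congr (ps n); apply/funext => z.
by rewrite scalerDr.
Qed.

Definition average (I : finType) (lam : I -> R) (z : I -> 'cV[R]_d) f :=
  fun x => \sum_i lam i * f (x + z i).

(* [C] does not depend on [eta], which is the contribution of the mesh of the grid
   of points [z]. *)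
Definition smoothing (h C : R) : Prop := forall K L eta : R,
  0 <= K -> 0 <= L -> 0 < eta ->
  exists (I : finType) (lam : I -> R) (z : I -> 'cV[R]_d),
    [/\ forall i, 0 <= lam i, \sum_i lam i = 1,
        forall i, lam i * enorm (z i) <= lam i * h
      & forall f, bounded_lip K L f -> forall x, exists (g : 'cV[R]_d) (A : 'M[R]_d),
        [/\ sym_mx A, enorm A <= C * K & forall y,
          `|average lam z f (x + y) - average lam z f x - dotp g y
            - 2^-1 * dotp (A *m y) y| <= C * K * enorm y ^+ 3 + eta]].

Section Average.
Context (I : finType) (lam : I -> R) (z : I -> 'cV[R]_d).
Hypotheses (lam0 : forall i, 0 <= lam i) (lam1 : \sum_i lam i = 1).

(** The weight on both sides of the hypothesis on [z] restricts only the points of nonzero weight to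
    the ball of radius [h]. *)
Lemma average_dist h K L f x : 0 <= L ->
  (forall i, lam i * enorm (z i) <= lam i * h) ->
  bounded_lip K L f -> `|average lam z f x - f x| <= L * h.
Proof.
move=> L0 hz [_ hL]; rewrite /average -[f x]mul1r -lam1 mulr_suml -sumrB.
apply: le_trans (ler_norm_sum _ _ _) _.
rewrite -[leRHS]mul1r -lam1 mulr_suml; apply: ler_sum => i _.
rewrite -mulrBr normrM ger0_norm // (mulrC L) mulrA.
apply: (@le_trans _ _ (lam i * (L * enorm (z i)))); last first.
  by rewrite (mulrC L) mulrA ler_wpM2r.
by rewrite ler_wpM2l // (le_trans (hL _ _)) // addrC addKr.
Qed.

Lemma average_C_l_Lip f : C_l_Lip f -> C_l_Lip (average lam z f).
Proof.
move=> hf; apply: C_l_Lip_sum => i; apply: C_l_LipZ.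
by under eq_fun do rewrite addrC; exact: C_l_Lip_shift.
Qed.

Lemma step_average_le p f x : law p -> C_l_Lip f ->
  step p (average lam z f) x <= average lam z (step p f) x.
Proof.
move=> hp hf; rewrite /step /average.
have := @law_sum_le _ _ p hp I lam (fun i y => f (x + z i + y)) lam0
  (fun i => C_l_Lip_shift _ hf).
by under eq_fun do under eq_bigr do rewrite addrAC.
Qed.

End Average.

(* A sublinear functional decreases the average of functions, so along one of the
   chains the averaged function is at most the average of the function, while
   for averaged functions the two one-step operators agree by Taylor expansion. *)
Lemma chain_compare_average (I : finType) (lam : I -> R) (z : I -> 'cV[R]_d)
  (ps qs : nat -> ('cV[R]_d -> R) -> R) (e : nat -> R) (C K L eta : R) :
  (forall i, 0 <= lam i) -> \sum_i lam i = 1 -> 0 <= C * K ->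
  (forall f, bounded_lip K L f -> forall x, exists (g : 'cV[R]_d) (A : 'M[R]_d),
     [/\ sym_mx A, enorm A <= C * K & forall y,
       `|average lam z f (x + y) - average lam z f x - dotp g y
         - 2^-1 * dotp (A *m y) y| <= C * K * enorm y ^+ 3 + eta]) ->
  (forall k, law (ps k) /\ centered (ps k)) ->
  (forall k, law (qs k) /\ centered (qs k)) ->
  (forall k, 0 <= e k) ->
  forall n, (forall k A, (k < n)%N -> sym_mx A ->
    `|half_cov (ps k) A - half_cov (qs k) A| <= e k * enorm A) ->
  forall f x, bounded_lip K L f ->
  chain ps n (average lam z f) x <= average lam z (chain qs n f) x
    + \sum_(k < n) (C * K * (e k + moment3 (ps k) + moment3 (qs k)) + 2 * eta).
Proof.
move=> lam0 lam1 CK0 hsm hps hqs e0; elim=> [|n IH] hcov f x hf.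
  by rewrite big_ord0 addr0.
have hp k := (hps k).1; have hq k := (hqs k).1.
have hcl := bounded_lip_C_l_Lip hf.
have hav := @average_C_l_Lip _ lam z f hcl.
have hsq := step_bounded_lip (hq n) hf.
have hasq := @average_C_l_Lip _ lam z _ (bounded_lip_C_l_Lip hsq).
set err := C * K * (e n + moment3 (ps n) + moment3 (qs n)) + 2 * eta.
have one y : step (ps n) (average lam z f) y
    <= err + average lam z (step (qs n) f) y.
  apply: (@le_trans _ _ (err + step (qs n) (average lam z f) y)); last first.
    by rewrite lerD2l step_average_le.
  (* The averaged function is expanded at [y] under both laws: the gradient terms vanish, the
     quadratic terms differ by at most [e n * enorm A], and each remainder brings one [eta]. *)
  have [g [A [sA hA hT]]] := hsm f hf y.
  have := law_taylor (hp n) (hps n).2 hav CK0 hT.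
  have := law_taylor (hq n) (hqs n).2 hav CK0 hT.
  have := hcov n A (ltnSn n) sA; have := ler_wpM2l (e0 n) hA.
  rewrite !ler_norml => h1 /andP[h2 h2'] /andP[h3 h3'] /andP[h4 h4'].
  rewrite /err !mulrDr; move: h1 h2 h2' h3 h3' h4 h4'.
  rewrite (mulrC (e n) (C * K)); move: (half_cov _ _) (half_cov _ _) => a b.
  move: (e n * _) (C * K * _) (C * K * _) (C * K * _) => u v w t *; lra.
rewrite big_ord_recr /= addrA -/err.
apply: (@le_trans _ _ (chain ps n (fun y => err + average lam z (step (qs n) f) y) x)).
  apply: chain_mono => //; first exact: step_C_l_Lip.
  by apply: C_l_LipD => //; exact: C_l_Lip_cst.
rewrite (chain_addc hp); last exact: average_C_l_Lip (bounded_lip_C_l_Lip hsq).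
rewrite [leLHS]addrC lerD2r; apply: IH => // k A kn.
by apply: hcov; rewrite ltnS ltnW.
Qed.

(** Each [L * h] pays for one removal of the average: from [f] at the start of one chain, and from
    the result of the other chain. Exchanging the two chains gives the absolute value. *)
Lemma chain_compare (h C : R) : 0 <= C -> smoothing h C ->
  forall (K L : R) (n : nat) (ps qs : nat -> ('cV[R]_d -> R) -> R) (e : nat -> R),
  0 <= K -> 0 <= L ->
  (forall k, law (ps k) /\ centered (ps k)) ->
  (forall k, law (qs k) /\ centered (qs k)) ->
  (forall k, 0 <= e k) ->
  (forall k A, (k < n)%N -> sym_mx A ->
    `|half_cov (ps k) A - half_cov (qs k) A| <= e k * enorm A) ->
  forall f x, bounded_lip K L f ->
  `|chain ps n f x - chain qs n f x|
    <= 2 * L * h + C * K * \sum_(k < n) (e k + moment3 (ps k) + moment3 (qs k)).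
Proof.
move=> C0 hsm K L n ps qs e K0 L0 hps hqs e0 hcov f x hf.
have CK0 : 0 <= C * K by rewrite mulr_ge0.
have hcl := bounded_lip_C_l_Lip hf.
have key (us vs : nat -> ('cV[R]_d -> R) -> R) eta : 0 < eta ->
    (forall k, law (us k) /\ centered (us k)) ->
    (forall k, law (vs k) /\ centered (vs k)) ->
    (forall k A, (k < n)%N -> sym_mx A ->
      `|half_cov (us k) A - half_cov (vs k) A| <= e k * enorm A) ->
    chain us n f x - chain vs n f x <= 2 * L * h
      + C * K * \sum_(k < n) (e k + moment3 (us k) + moment3 (vs k)) + n%:R * (2 * eta).
  move=> eta0 hus hvs huv.
  have [I [lam [z [l0 l1 lz hT]]]] := hsm K L eta K0 L0 eta0.
  have := chain_compare_average l0 l1 CK0 hT hus hvs e0 huv x hf.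
  rewrite big_split /= sumr_const card_ord -mulr_sumr -(mulr_natl (2 * eta) n).
  have hvf := chain_bounded_lip (fun k => (hvs k).1) n hf.
  have := average_dist l0 l1 x L0 lz hvf.
  have := @chain_dist_le us (fun k => (hus k).1) n (L * h) f (average lam z f) x.
  move=> /(_ hcl (average_C_l_Lip lam z hcl)).
  have fa y : `|f y - average lam z f y| <= L * h.
    by rewrite distrC (average_dist l0 l1 y L0 lz hf).
  move=> /(_ fa); rewrite !ler_norml => /andP[_ h1] /andP[_ h2] h3.
  rewrite -(mulrA 2 L); move: h1 h2 h3.
  by move: (C * K * _) (n%:R * _) (L * h) => *; lra.
apply/ler_addgt0Pr => eps eps0.
have n0 : 0 < n.+1%:R :> R by rewrite ltr0n.
(* The mesh error accumulates to [n * (2 * eta)]. As [C] does not depend on [eta], this can be made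
   smaller than [eps] once [n] is known. The successor avoids a division by 0. *)
set eta := eps / (2 * n.+1%:R).
have eta0 : 0 < eta by rewrite divr_gt0 ?mulr_gt0.
have neta : n%:R * (2 * eta) <= eps.
  have -> : n%:R * (2 * eta) = eps * (n%:R / n.+1%:R).
    by rewrite /eta; field; rewrite addrC natr1 pnatr_eq0.
  by rewrite ler_piMr ?(ltW eps0) // ler_pdivrMr // mul1r ler_nat.
have := key ps qs eta eta0 hps hqs hcov.
have hcov' k A : (k < n)%N -> sym_mx A ->
    `|half_cov (qs k) A - half_cov (ps k) A| <= e k * enorm A.
  by move=> kn sA; rewrite distrC hcov.
have := key qs ps eta eta0 hqs hps hcov'.
under [X in C * K * X]eq_bigr do rewrite addrAC.
move=> h1 h2; rewrite ler_norml; apply/andP; split; lra.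
Qed.

End Chains.

(** * Smoothing by averages over a grid *)

Section Kernel.
Context {R : realType}.

(** The cube of the positive part has a third derivative bounded by 6, hence a Taylor remainder of
    at most |r|^3. The four cases are the signs of [s] and [s + r]. *)
Lemma cube_pos_taylor (s r : R) : let t := Num.max s 0 in
  `|Num.max (s + r) 0 ^+ 3 - t ^+ 3 - 3 * t ^+ 2 * r - 3 * t * r ^+ 2| <= `|r| ^+ 3.
Proof.
rewrite -normrX /=; have [s0|s0] := leP s 0; have [sr0|sr0] := leP (s + r) 0.
- by rewrite [X in `|X| <= _](_ : _ = 0) ?normr0 //; ring.
- rewrite [X in `|X| <= _](_ : _ = (s + r) ^+ 3); last by ring.
  by rewrite !ger0_norm ?exprn_ge0 ?lerXn2r ?nnegrE //; lra.
- rewrite [X in `|X| <= _](_ : _ = r ^+ 3 - (s + r) ^+ 3); last by ring.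
  have h : r ^+ 3 <= (s + r) ^+ 3.
    have : 0 <= s * ((s + 3 / 2 * r) ^+ 2 + 3 / 4 * r ^+ 2).
      apply: mulr_ge0; first exact: ltW.
      by have := sqr_ge0 (s + 3 / 2 * r); have := sqr_ge0 r; lra.
    rewrite -(lerDl (r ^+ 3)) => /le_trans; apply; rewrite le_eqVlt.
    by apply/orP; left; apply/eqP; field.
  have h2 : (s + r) ^+ 3 <= 0 by rewrite exprn_odd_le0.
  have h3 : r ^+ 3 <= 0 := le_trans h h2.
  have h4 : r ^+ 3 - (s + r) ^+ 3 <= 0 by rewrite subr_le0.
  rewrite (ler0_norm h3) (ler0_norm h4).
  by rewrite opprB gerDr.
- by rewrite [X in `|X| <= _](_ : _ = r ^+ 3) //; ring.
Qed.
Context (d : nat).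

(** A piecewise polynomial bump supported in the unit ball. The exponent 3 makes its second
    derivatives Lipschitz; the weights are normalized later, on the grid. *)
Definition mollifier (u : 'cV[R]_d) : R := Num.max (1 - dotp u u) 0 ^+ 3.

(** The opposite of the gradient at [u], since the expansion below is that of [mollifier (u - y)] in
    [y]. *)
Definition mollifier_grad (u : 'cV[R]_d) : 'cV[R]_d :=
  (6 * Num.max (1 - dotp u u) 0 ^+ 2) *: u.

Definition mollifier_hess (u : 'cV[R]_d) : 'M[R]_d :=
  let s := Num.max (1 - dotp u u) 0 in
  (- 6 * s ^+ 2) *: 1%:M + (24 * s) *: (u *m u^T).

Lemma dotp_ge0 (u : 'cV[R]_d) : 0 <= dotp u u.
Proof. by rewrite -enorm_cV_sqr sqr_ge0. Qed.

Lemma mollifier_ge0 u : 0 <= mollifier u.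
Proof. by rewrite exprn_ge0 // le_max lexx orbT. Qed.

Lemma mollifier_eq0 u : 1 <= dotp u u -> mollifier u = 0.
Proof. by move=> h; rewrite /mollifier max_r ?expr0n // subr_le0. Qed.

Lemma bump_bounds (u : 'cV[R]_d) : 0 <= Num.max (1 - dotp u u) 0 <= 1.
Proof.
by rewrite le_max lexx orbT /= ge_max ler01 andbT gerBl dotp_ge0.
Qed.

Lemma quad_rank1 (u y : 'cV[R]_d) : dotp (u *m u^T *m y) y = dotp u y ^+ 2.
Proof.
have -> : u *m u^T *m y = dotp u y *: u.
  rewrite -mulmxA; apply/matrixP => i j.
  rewrite ord1 mxE big_ord1 [in RHS]mxE mulrC; congr (_ * _).
  by rewrite mxE; apply: eq_bigr => k _; rewrite mxE.
by rewrite dotpZl expr2.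
Qed.

Lemma mollifier_hess_sym u : sym_mx (mollifier_hess u).
Proof.
by rewrite /sym_mx /mollifier_hess linearD /= !linearZ /= trmx1 trmx_mul trmxK.
Qed.

Lemma mollifier_hess_quad u y : 2^-1 * dotp (mollifier_hess u *m y) y =
  let s := Num.max (1 - dotp u u) 0 in
  - 3 * s ^+ 2 * dotp y y + 12 * s * dotp u y ^+ 2.
Proof.
rewrite /mollifier_hess mulmxDl dotpDl -!scalemxAl mul1mx !dotpZl quad_rank1 /=.
by field.
Qed.

Lemma mollifier_grad_le rho u : enorm u <= rho -> enorm (mollifier_grad u) <= 6 * rho.
Proof.
move=> hu; have /andP[s0 s1] := bump_bounds u.
rewrite enormZ ger0_norm ?mulr_ge0 ?exprn_ge0 // -mulrA ler_wpM2l //.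
by rewrite -[leRHS]mul1r ler_pM ?exprn_ge0 ?enorm_ge0 ?exprn_ile1.
Qed.

Lemma mollifier_hess_le rho u : enorm u <= rho ->
  enorm (mollifier_hess u) <= 6 * enorm (1%:M : 'M[R]_d) + 24 * rho ^+ 2.
Proof.
move=> hu; have /andP[s0 s1] := bump_bounds u.
have rho0 := le_trans (enorm_ge0 u) hu.
apply: le_trans (enormD _ _) _; rewrite !enormZ lerD //.
  rewrite normrM normrN !ger0_norm ?exprn_ge0 // ler_wpM2r ?enorm_ge0 //.
  by rewrite ler_piMr // exprn_ile1.
rewrite ger0_norm ?mulr_ge0 // -mulrA ler_wpM2l //.
rewrite -[leRHS]mul1r ler_pM ?enorm_ge0 //.
apply: le_trans (enorm_mulmx _ _) _; rewrite expr2 ler_pM ?enorm_ge0 //.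
suff -> : enorm u^T = enorm u by [].
rewrite /enorm exchange_big /=; congr Num.sqrt.
by apply: eq_bigr => i _; apply: eq_bigr => j _; rewrite mxE.
Qed.

(** The one-variable expansion applies with [r], the increment of 1 - |u|^2, and leaves at most
    |r|^3. The part of its r and r^2 terms that the gradient and the Hessian do not account for is 3
    s |y|^2 (|y|^2 - 4 <u,y>), which gives 12 rho + 6. The bound on [y] turns |y|^2 into a multiple
    of |y|. *)
Lemma mollifier_taylor rho u y : enorm u <= rho -> enorm y <= 2 ->
  `|mollifier (u - y) - mollifier u - dotp (mollifier_grad u) y
    - 2^-1 * dotp (mollifier_hess u *m y) y|
  <= ((2 * rho + 2) ^+ 3 + 12 * rho + 6) * enorm y ^+ 3.
Proof.
move=> hu hy; have /andP[s0 s1] := bump_bounds u.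
rewrite mollifier_hess_quad /mollifier_grad dotpZl /mollifier.
pose r := 2 * dotp u y - dotp y y.
have -> : 1 - dotp (u - y) (u - y) = (1 - dotp u u) + r.
  by rewrite !(dotpDl, dotpDr) !(dotpNl, dotpNr) (dotpC y u) /r; ring.
have := cube_pos_taylor (1 - dotp u u) r; move: s0 s1 => /=.
move: (Num.max (1 - dotp u u) 0) (Num.max (_ + r) 0) => s t s0 s1 h.
have y0 := enorm_ge0 y; have u0 := enorm_ge0 u.
have uy : `|dotp u y| <= rho * enorm y.
  by apply: le_trans (dotp_le _ _) _; rewrite ler_wpM2r.
have yy : dotp y y = enorm y ^+ 2 by rewrite enorm_cV_sqr.
have hr : `|r| <= (2 * rho + 2) * enorm y.
  rewrite /r; apply: le_trans (ler_normB _ _) _.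
  rewrite normrM (ger0_norm (dotp_ge0 _)) yy ger0_norm //.
  have : enorm y ^+ 2 <= 2 * enorm y by rewrite expr2 ler_wpM2r.
  lra.
have rho0 := le_trans u0 hu.
have hr3 : `|r| ^+ 3 <= (2 * rho + 2) ^+ 3 * enorm y ^+ 3.
  by rewrite -exprMn lerXn2r ?nnegrE ?mulr_ge0 //; lra.
rewrite [X in `|X| <= _](_ : _ =
  (t ^+ 3 - s ^+ 3 - 3 * s ^+ 2 * r - 3 * s * r ^+ 2)
  + 3 * s * (dotp y y * (dotp y y - 4 * dotp u y))); last by rewrite /r; ring.
apply: le_trans (ler_normD _ _) _.
rewrite [leRHS](_ : _ = (2 * rho + 2) ^+ 3 * enorm y ^+ 3
  + (12 * rho + 6) * enorm y ^+ 3); last by ring.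
rewrite lerD //.
  exact: le_trans h hr3.
rewrite !normrM (ger0_norm s0) (ger0_norm (dotp_ge0 _)) ger0_norm // yy.
have : `|enorm y ^+ 2 - 4 * dotp u y| <= (4 * rho + 2) * enorm y.
  apply: le_trans (ler_normB _ _) _;
  rewrite (ger0_norm (sqr_ge0 _)) normrM (@ger0_norm _ 4) //.
  have : enorm y ^+ 2 <= 2 * enorm y by rewrite expr2 ler_wpM2r.
  by move: uy; lra.
move=> /(ler_wpM2l (sqr_ge0 (enorm y))) h4.
apply: (@le_trans _ _ (3 * 1 * (enorm y ^+ 2 * ((4 * rho + 2) * enorm y)))).
  by rewrite ler_pM ?mulr_ge0 ?exprn_ge0 // ler_wpM2l.
by rewrite le_eqVlt; apply/orP; left; apply/eqP; ring.
Qed.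

End Kernel.

(** * From a net of the unit ball to all increments *)

Section Smoothing.
Context {R : realType} (d : nat).

Lemma quad_dist (A : 'M[R]_d) (y y' : 'cV[R]_d) :
  `|dotp (A *m y) y - dotp (A *m y') y'|
    <= enorm A * (enorm y + enorm y') * enorm (y - y').
Proof.
have -> : dotp (A *m y) y - dotp (A *m y') y' =
    dotp (A *m (y - y')) y + dotp (A *m y') (y - y').
  by rewrite mulmxBr !(dotpDl, dotpDr, dotpNl, dotpNr); ring.
apply: le_trans (ler_normD _ _) _; rewrite mulrDr mulrDl lerD //.
  apply: le_trans (dotp_le _ _) _; rewrite mulrAC ler_wpM2r ?enorm_ge0 //.
  exact: enorm_mulmx.
apply: le_trans (dotp_le _ _) _; rewrite ler_wpM2r ?enorm_ge0 //.
exact: enorm_mulmx.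
Qed.

(** Beyond the unit ball every term is at most a constant times |y|^3. Inside, [y] is moved to the
    net: [v] changes by [e * L], the gradient term by [e * (G * K)], the quadratic term by 3/2 of
    that and the cubic bound by 7 times that, in all less than [10 * (G * K)] times [e]. *)
Lemma taylor_of_net (v : 'cV[R]_d -> R) x (g : 'cV[R]_d) (A : 'M[R]_d) (G K L e : R) :
  bounded_lip K L v -> 0 <= K -> 0 <= L -> 0 <= G -> 0 <= e <= 1 ->
  enorm g <= G * K -> enorm A <= G * K ->
  (forall y, enorm y <= 1 -> exists y', enorm (y - y') <= e /\
    `|v (x + y') - v x - dotp g y' - 2^-1 * dotp (A *m y') y'|
      <= G * K * enorm y' ^+ 3) ->
  forall y, `|v (x + y) - v x - dotp g y - 2^-1 * dotp (A *m y) y|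
    <= (2 + 3 * G) * K * enorm y ^+ 3 + e * (L + 10 * (G * K)).
Proof.
move=> [vK vL] K0 L0 G0 /andP[e0 e1] hg hA hnet y.
have y0 := enorm_ge0 y; have GK0 : 0 <= G * K by rewrite mulr_ge0.
have [y1|y1] := leP (enorm y) 1; last first.
  have r2 : enorm y ^+ 2 <= enorm y ^+ 3 by rewrite ler_weXn2l // ltW.
  have r1 : enorm y <= enorm y ^+ 3 by rewrite -{1}[enorm y]expr1 ler_weXn2l // ltW.
  have r0 : 1 <= enorm y ^+ 3 by rewrite exprn_ege1 // ltW.
  have a1 := vK (x + y); have a2 := vK x.
  have a3 : `|dotp g y| <= G * K * enorm y ^+ 3.
    by apply: le_trans (dotp_le _ _) _; rewrite ler_pM ?enorm_ge0.
  have a4 : `|dotp (A *m y) y| <= G * K * enorm y ^+ 3.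
    apply: le_trans (quad_le _ _) _.
    by rewrite ler_pM ?enorm_ge0 ?sqr_ge0.
  have a5 : 0 <= e * (L + 10 * (G * K)) by rewrite mulr_ge0 ?addr_ge0 ?mulr_ge0.
  have a6 : K <= K * enorm y ^+ 3 by rewrite ler_peMr.
  have a7 : (2 + 3 * G) * K * enorm y ^+ 3
    = 2 * (K * enorm y ^+ 3) + 3 * (G * K * enorm y ^+ 3) by ring.
  have a8 : 0 <= G * K * enorm y ^+ 3 by rewrite mulr_ge0 ?exprn_ge0.
  rewrite a7; move: a1 a2 a3 a4 a5 a6 a8.
  move: (K * _) (G * K * _) (e * _) => a b c.
  by rewrite !ler_norml => /andP[? ?] /andP[? ?] /andP[? ?] /andP[? ?] *;
    apply/andP; split; lra.
have [y' [hy' hT]] := hnet y y1.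
have y'0 := enorm_ge0 y'.
have hyy' : enorm y' <= enorm y + e.
  rewrite -[y'](subKr y); apply: le_trans (enormD _ _) _.
  by rewrite enormN lerD2l.
have b1 : `|v (x + y) - v (x + y')| <= e * L.
  apply: le_trans (vL _ _) _; rewrite mulrC ler_wpM2r //.
  by rewrite opprD addrACA subrr add0r.
have b2 : `|dotp g y - dotp g y'| <= e * (G * K).
  have -> : dotp g y - dotp g y' = dotp g (y - y') by rewrite dotpDr dotpNr.
  by apply: le_trans (dotp_le _ _) _; rewrite mulrC ler_pM ?enorm_ge0.
have b3 : `|dotp (A *m y) y - dotp (A *m y') y'| <= e * (G * K) * 3.
  apply: le_trans (quad_dist _ _ _) _.
  rewrite mulrC -mulrA ler_pM ?mulr_ge0 ?addr_ge0 ?enorm_ge0 //.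
  by rewrite ler_pM ?addr_ge0 ?enorm_ge0 //; lra.
have b4 : enorm y' ^+ 3 <= enorm y ^+ 3 + 7 * e.
  apply: (@le_trans _ _ ((enorm y + e) ^+ 3)).
    by rewrite lerXn2r ?nnegrE ?addr_ge0.
  have c1 : enorm y ^+ 2 <= 1 by rewrite exprn_ile1.
  have c2 : e ^+ 2 <= 1 by rewrite exprn_ile1.
  have c3 := ler_wpM2l e0 c1; have c4 := ler_wpM2l e0 c2.
  have c5 : enorm y * e <= 1 by rewrite mulr_ile1.
  have c6 := ler_wpM2l e0 c5.
  rewrite [leLHS](_ : _ = enorm y ^+ 3 + 3 * (e * enorm y ^+ 2)
    + 3 * (e * (enorm y * e)) + e * e ^+ 2); last by ring.
  lra.
have b5 := ler_wpM2l GK0 b4.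
have b6 : 0 <= G * K * enorm y ^+ 3 by rewrite mulr_ge0 ?exprn_ge0.
have b7 : 0 <= K * enorm y ^+ 3 by rewrite mulr_ge0 ?exprn_ge0.
have b8 : G * K * (enorm y ^+ 3 + 7 * e)
  = G * K * enorm y ^+ 3 + 7 * (e * (G * K)) by ring.
have b9 : 0 <= e * (G * K) by rewrite mulr_ge0.
have -> : (2 + 3 * G) * K * enorm y ^+ 3
    = 2 * (K * enorm y ^+ 3) + 3 * (G * K * enorm y ^+ 3) by ring.
have -> : e * (L + 10 * (G * K)) = e * L + 10 * (e * (G * K)) by ring.
move: hT b1 b2 b3 b5 b6 b7 b8 b9.
move: (enorm y' ^+ 3) => r'.
move: (K * _) (G * K * _) (G * K * _) (G * K * _) (e * L) (e * _) => a b c t u w.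
rewrite !ler_norml => /andP[? ?] /andP[? ?] /andP[? ?] /andP[? ?] *.
by apply/andP; split; lra.
Qed.

Lemma average_bounded_lip (I : finType) (lam : I -> R) (z : I -> 'cV[R]_d) K L f :
  (forall i, 0 <= lam i) -> \sum_i lam i = 1 ->
  bounded_lip K L f -> bounded_lip K L (average lam z f).
Proof.
move=> l0 l1 [hK hL]; split=> [x|x y].
  apply: le_trans (ler_norm_sum _ _ _) _; rewrite -[K]mul1r -l1 mulr_suml.
  by apply: ler_sum => i _; rewrite normrM ger0_norm // ler_wpM2l.
rewrite /average -sumrB; apply: le_trans (ler_norm_sum _ _ _) _.
rewrite -[leRHS]mul1r -l1 mulr_suml; apply: ler_sum => i _.
rewrite -mulrBr normrM ger0_norm // ler_wpM2l //.
by apply: le_trans (hL _ _) _; rewrite opprD addrACA subrr addr0.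
Qed.

End Smoothing.

(** * Translations of a finite grid *)

Section Grid.
Context {R : realType} (d m : nat) (m0 : (0 < m)%N).

Notation grid := {ffun 'I_d -> 'I_(6 * m).+1}.

(** Mesh 1/m on the cube of half-side 3. In each coordinate the indices form a cyclic group, and the
    cube is so large that wrapping around only concerns points where the kernel vanishes. *)
Definition grid_point (z : grid) : 'cV[R]_d :=
  \col_i (((z i : nat)%:R - (3 * m)%:R) / m%:R).

Lemma grid_point_norm z : enorm (grid_point z) <= 3 * d%:R.
Proof.
apply: le_trans (enorm_cV_le _) _.
apply: (@le_trans _ _ (\sum_(i < d) 3)); last first.
  by rewrite sumr_const card_ord mulr_natr.
have mR : 0 < m%:R :> R by rewrite ltr0n.
apply: ler_sum => i _; rewrite mxE normrM normfV (ger0_norm (ltW mR)).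
rewrite ler_pdivrMr // -natrM ler_norml lerBlDr lerBrDr.
have h : (z i <= 6 * m)%N by rewrite -ltnS ltn_ord.
by rewrite addNr ler0n -natrD ler_nat; lia.
Qed.

(** Modulo [(6 * m).+1] the number [(5 * m).+1] is [- m], so the shift is by [a - m], of size at
    most [m]. Either nothing wraps, or the index jumps from one end of the range to the other. *)
Lemma mod_shift_cases j a : (j <= 6 * m)%N -> (a <= 2 * m)%N ->
  let j' := ((j + (a + (5 * m).+1) %% (6 * m).+1) %% (6 * m).+1)%N in
  [\/ (j' + m = j + a)%N, (j < m)%N /\ (5 * m < j')%N | (5 * m < j)%N /\ (j' < m)%N].
Proof.
move=> hj ha /=; rewrite modnDmr.
have [h1|h1] := ltnP (j + (a + (5 * m).+1)) (6 * m).+1.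
  by rewrite modn_small //; apply: Or32; lia.
have -> : (j + (a + (5 * m).+1) = (j + a - m) + (6 * m).+1)%N by lia.
rewrite modnDr; have [h2|h2] := ltnP (j + a - m) (6 * m).+1.
  by rewrite modn_small //; apply: Or31; lia.
have -> : (j + a - m = (j + a - m - (6 * m).+1) + (6 * m).+1)%N by lia.
by rewrite modnDr modn_small; [apply: Or33; split|]; lia.
Qed.

Lemma mollifier_coord_eq0 (u : 'cV[R]_d) i : 1 <= `|u i 0| -> mollifier u = 0.
Proof.
move=> h; apply: mollifier_eq0; rewrite -enorm_cV_sqr.
by rewrite exprn_ege1 // (le_trans h) // enorm_entry.
Qed.

(** Discrete change of variables: reindexing by a translation of the cyclic group moves the shift
    [y] from [F] to the kernel. Where a coordinate wraps around, both kernel values are 0, because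
    that coordinate exceeds 2 in absolute value and [y] moves it by at most 1. *)
Lemma grid_shift (a : 'I_d -> nat) (F : 'cV[R]_d -> R) :
  (forall i, a i <= 2 * m)%N ->
  let y : 'cV[R]_d := \col_i (((a i)%:R - m%:R) / m%:R) in
  \sum_z mollifier (grid_point z) * F (y + grid_point z)
  = \sum_z mollifier (grid_point z - y) * F (grid_point z).
Proof.
move=> ha y; have mR : 0 < m%:R :> R by rewrite ltr0n.
pose kap : grid := [ffun i => inZp (a i + (5 * m).+1)].
rewrite [RHS](reindex_inj (addIr kap)) /=; apply: eq_bigr => z _.
have E i : ((z + kap) i = ((z i + (a i + (5 * m).+1) %% (6 * m).+1)
    %% (6 * m).+1)%N :> nat) by rewrite !ffunE.
have hz i : (z i <= 6 * m)%N by rewrite -ltnS ltn_ord.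
have big (j b : nat) : (m <= b)%N -> (j + b <= 3 * m)%N ->
    1 <= `|(j%:R - (3 * m)%:R) / m%:R : R|.
  move=> hb hj; rewrite normrM normfV (ger0_norm (ltW mR)) ler_pdivlMr // mul1r.
  rewrite distrC ger0_norm ?subr_ge0 ?ler_nat; last by lia.
  by rewrite lerBrDr -natrD ler_nat; lia.
have big' (j : nat) : (4 * m <= j)%N -> 1 <= `|(j%:R - (3 * m)%:R) / m%:R : R|.
  move=> hj; rewrite normrM normfV (ger0_norm (ltW mR)) ler_pdivlMr // mul1r.
  rewrite ger0_norm ?subr_ge0 ?ler_nat; last by lia.
  by rewrite lerBrDr -natrD ler_nat; lia.
have [/existsP[i /orP hi]|] := boolP [exists i, ((z i < m) && (5 * m < (z + kap)%R i))%N
    || ((5 * m < z i) && ((z + kap)%R i < m))%N].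
  rewrite (@mollifier_coord_eq0 (grid_point z) i); last first.
    rewrite mxE; case: hi => /andP[h1 h2]; first by apply: (big _ (2 * m)%N); lia.
    by apply: big'; lia.
  rewrite (@mollifier_coord_eq0 (grid_point (z + kap) - y) i) ?mul0r //.
  have -> : (grid_point (z + kap) - y) i 0
      = (((z + kap)%R i : nat)%:R + m%:R - (a i)%:R - (3 * m)%:R) / m%:R.
    by rewrite !mxE; field; rewrite gt_eqF.
  have hai := ha i; case: hi => /andP[h1 h2].
    have -> : (((z + kap)%R i : nat)%:R + m%:R - (a i)%:R : R)
      = (((z + kap)%R i + m - a i)%N)%:R by rewrite natrB ?natrD //; lia.
    by apply: big'; lia.
  rewrite normrM normfV (ger0_norm (ltW mR)) ler_pdivlMr // mul1r distrC.
  have : (((z + kap)%R i : nat)%:R : R) <= m%:R by rewrite ler_nat ltnW.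
  have : 0 <= (a i)%:R :> R by [].
  by rewrite natrM => h3 h4; apply: le_trans (ler_norm _); lra.
rewrite negb_exists => /forallP hno.
have -> : grid_point (z + kap) = y + grid_point z.
  apply/matrixP => i j; rewrite ord1 !mxE.
  have [h|h|h] := mod_shift_cases (hz i) (ha i); rewrite -E in h.
  - have : (((z + kap)%R i : nat)%:R + m%:R : R) = (z i : nat)%:R + (a i)%:R.
      by rewrite -!natrD h.
    move=> /(canRL (addrK _)) ->; rewrite !natrM; field; by rewrite gt_eqF.
  - by have := hno i; rewrite negb_or; case: h => -> ->.
  - by have := hno i; rewrite negb_or; case: h => -> ->; rewrite andbF.
by rewrite (addrC y) addrK.
Qed.

End Grid.

(** * Total weight of the kernel on the grid *)

Section GridWeight.
Context {R : realType} (d q : nat) (q0 : (0 < q)%N).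

Notation m := (2 * d.+1 * q)%N.
Notation grid := {ffun 'I_d -> 'I_(6 * m).+1}.
Notation pt := (@grid_point R d m).

(** Indices from [3 * m] to [3 * m + q] give coordinates between 0 and 1/(2(d + 1)), hence points of
    squared norm at most 1/4, where the kernel is at least (3/4)^3. There are (q + 1)^d such
    points. *)
Lemma grid_mollifier_sum_ge :
  27 / 64 * q.+1%:R ^+ d <= \sum_(z : grid) mollifier (pt z).
Proof.
have m0 : (0 < m)%N by rewrite !muln_gt0.
have mR : 0 < m%:R :> R by rewrite ltr0n.
have small (t : {ffun 'I_d -> 'I_q.+1}) i : (3 * m + t i < (6 * m).+1)%N.
  have h : (t i <= q)%N by rewrite -ltnS ltn_ord.
  have h' : (q <= m)%N by rewrite leq_pmull ?muln_gt0.
  by lia.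
pose iota (t : {ffun 'I_d -> 'I_q.+1}) : grid :=
  [ffun i => Ordinal (small t i)].
have iota_inj : injective iota.
  move=> t t' /ffunP h; apply/ffunP => i; have := h i; rewrite !ffunE.
  by move=> /(congr1 (fun k : 'I__ => k : nat)) /= /addnI /val_inj.
rewrite (bigID (mem (iota @: predT))) /= -[leLHS]addr0 lerD //; last first.
  by apply: sumr_ge0 => z _; exact: mollifier_ge0.
rewrite big_imset /=; last by move=> t t' _ _; exact: iota_inj.
apply: (@le_trans _ _ (\sum_(t : {ffun 'I_d -> 'I_q.+1}) 27 / 64)).
  by rewrite sumr_const card_ffun !card_ord -natrX mulr_natr.
rewrite [leRHS](eq_bigl xpredT) //.
apply: ler_sum => t _; rewrite /mollifier.
have hc i : pt (iota t) i 0 ^+ 2 <= (4 * d.+1%:R)^-1.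
  rewrite mxE ffunE /= natrD addrAC subrr add0r expr_div_n.
  have h : ((t i : nat)%:R : R) <= q%:R by rewrite ler_nat -ltnS ltn_ord.
  have dR : 0 < d.+1%:R :> R by rewrite ltr0n.
  have qR : 0 < q%:R :> R by rewrite ltr0n.
  have d1 : 1 <= d.+1%:R :> R by rewrite ler1n.
  rewrite ler_pdivrMr ?exprn_gt0 // !natrM.
  rewrite [leRHS](_ : _ = d.+1%:R * q%:R ^+ 2); last by field; rewrite nat1r pnatr_eq0.
  apply: (@le_trans _ _ (q%:R ^+ 2)); first by rewrite lerXn2r ?nnegrE.
  by rewrite ler_peMl ?sqr_ge0.
have hd : dotp (pt (iota t)) (pt (iota t)) <= 1 / 4.
  apply: (@le_trans _ _ (\sum_(i < d) (4 * d.+1%:R)^-1)).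
    by apply: ler_sum => i _; rewrite -expr2.
  rewrite sumr_const card_ord -(mulr_natr _ d) [leLHS]mulrC ler_pdivrMr ?mulr_gt0 //.
  by rewrite mulrA div1r mulVf ?mul1r ?ler_nat.
have -> : 27 / 64 = (3 / 4) ^+ 3 :> R by field.
rewrite lerXn2r ?nnegrE ?divr_ge0 //; first by rewrite le_max lexx orbT.
by rewrite le_max; apply/orP; left; lra.
Qed.

(** The ratio of the number of points to the total kernel weight is bounded independently of [q];
    this is what frees the smoothing constant from the mesh. *)
Lemma grid_card_le (c : R) : 0 <= c ->
  \sum_(z : grid) c <=
  (64 / 27 * (12 * d.+1%:R) ^+ d * c) * \sum_(z : grid) mollifier (pt z).
Proof.
move=> c0; rewrite sumr_const card_ffun !card_ord -[leLHS]mulr_natl natrX.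
have h : ((6 * m).+1%:R : R) <= 12 * d.+1%:R * q.+1%:R.
  by rewrite -!natrM ler_nat; nia.
apply: (@le_trans _ _ ((12 * d.+1%:R * q.+1%:R) ^+ d * c)).
  by rewrite ler_wpM2r // lerXn2r ?nnegrE ?mulr_ge0.
have h2 : 0 <= 64 / 27 * (12 * d.+1%:R) ^+ d * c :> R.
  by rewrite !mulr_ge0 ?exprn_ge0 ?mulr_ge0.
apply: le_trans (ler_wpM2l h2 grid_mollifier_sum_ge).
by rewrite exprMn le_eqVlt; apply/orP; left; apply/eqP; field.
Qed.

End GridWeight.

(** * Existence of smoothing averages and uniform comparison of chains *)

Section SmoothingExists.
Context {R : realType} (d : nat).

Lemma enorm_sum_le m n (I : Type) (s : seq I) (F : I -> 'M[R]_(m, n)) :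
  enorm (\sum_(i <- s) F i) <= \sum_(i <- s) enorm (F i).
Proof.
elim: s => [|i s IH]; first by rewrite !big_nil enorm0.
by rewrite !big_cons; apply: le_trans (enormD _ _) _; rewrite lerD2l.
Qed.

Lemma dotp_suml n (I : Type) (s : seq I) (F : I -> 'cV[R]_n) y :
  dotp (\sum_(i <- s) F i) y = \sum_(i <- s) dotp (F i) y.
Proof.
elim: s => [|i s IH]; first by rewrite !big_nil dotpC dotp0r.
by rewrite !big_cons dotpDl IH.
Qed.

Lemma grid_approx m (y : 'cV[R]_d) : (0 < m)%N -> enorm y <= 1 ->
  exists a : 'I_d -> nat, (forall i, a i <= 2 * m)%N /\
    enorm (y - \col_i (((a i)%:R - m%:R) / m%:R)) <= d%:R / m%:R.
Proof.
move=> m0 y1; have mR : 0 < m%:R :> R by rewrite ltr0n.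
pose a i := Num.truncn (m%:R * (y i 0 + 1)).
have hy i : -1 <= y i 0 <= 1 by rewrite -ler_norml (le_trans (enorm_entry _ _ _)).
have pos i : 0 <= m%:R * (y i 0 + 1).
  by rewrite mulr_ge0 //; have := hy i; lra.
exists a; split=> [i|].
  rewrite -(@ler_nat R); have /andP[h _] := truncn_itv (pos i).
  apply: le_trans h _; rewrite natrM mulrC ler_wpM2r //.
  by have := hy i; lra.
apply: le_trans (enorm_cV_le _) _.
apply: (@le_trans _ _ (\sum_(i < d) m%:R^-1)); last first.
  by rewrite sumr_const card_ord -[leLHS]mulr_natl.
apply: ler_sum => i _; rewrite !mxE.
have /andP[h1 h2] := truncn_itv (pos i); rewrite -/(a i) in h1 h2.
have -> : y i 0 - ((a i)%:R - m%:R) / m%:R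
    = (m%:R * (y i 0 + 1) - (a i)%:R) / m%:R by field; rewrite gt_eqF.
rewrite normrM normfV (ger0_norm (ltW mR)) ler_pdivrMr // mulVf ?gt_eqF //.
rewrite ger0_norm ?subr_ge0 // lerBlDr; move: h2; rewrite -natr1 => h2.
by rewrite [leRHS]addrC ltW.
Qed.

(** After the change of variables the shift sits in the kernel, so [g] and [A] are averages of [f]
    against derivatives of the kernel and are bounded through [K] alone. [L] enters only in the
    choice of the mesh. *)
Lemma smoothing_unit : exists C, 0 <= C /\ @smoothing R d 1 C.
Proof.
pose rho : R := 3 * d%:R.
have rho0 : 0 <= rho by rewrite mulr_ge0.
pose c0 : R := 64 / 27 * (12 * d.+1%:R) ^+ d.
have c00 : 0 <= c0 by rewrite !mulr_ge0 ?exprn_ge0 ?mulr_ge0.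
pose k1 : R := (2 * rho + 2) ^+ 3 + 12 * rho + 6.
pose k2 : R := 6 * rho.
pose k3 : R := 6 * enorm (1%:M : 'M[R]_d) + 24 * rho ^+ 2.
have k10 : 0 <= k1 by rewrite !addr_ge0 ?exprn_ge0 ?addr_ge0 ?mulr_ge0.
have k20 : 0 <= k2 by rewrite mulr_ge0.
have k30 : 0 <= k3 by rewrite addr_ge0 ?mulr_ge0 ?enorm_ge0 ?sqr_ge0.
pose G := c0 * (k1 + k2 + k3).
have G0 : 0 <= G by apply: mulr_ge0 => //; apply: addr_ge0 => //; exact: addr_ge0.
exists (2 + 3 * G); split=> [|K L eta K0 L0 eta0]; first by lra.
have B0 : 0 <= L + 10 * (G * K).
  by apply: addr_ge0 => //; apply: mulr_ge0 => //; exact: mulr_ge0.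
(* Since the mesh parameter [e] is at most 1/q, this makes the error [e * (L + 10 * (G * K))] of
   [taylor_of_net] at most [eta]. *)
pose q := (Num.truncn ((L + 10 * (G * K)) / eta)).+1.
have hq : (L + 10 * (G * K)) / eta <= q%:R by rewrite ltW // truncnS_gt.
have q0 : (0 < q)%N by [].
pose m := (2 * d.+1 * q)%N.
have m0 : (0 < m)%N by rewrite !muln_gt0.
have mR : 0 < m%:R :> R by rewrite ltr0n.
have qR : 0 < q%:R :> R by rewrite ltr0n.
pose e : R := d%:R / m%:R.
have eq : e * q%:R <= 1.
  rewrite /e mulrAC ler_pdivrMr // mul1r -natrM ler_nat /m.
  by rewrite leq_mul2r (leq_trans (leqnSn d)) ?leq_pmull ?orbT.
have e0 : 0 <= e by rewrite divr_ge0.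
have e1 : e <= 1.
  by apply: le_trans eq; rewrite ler_peMr // ler1n.
have eeta : e * (L + 10 * (G * K)) <= eta.
  apply: (@le_trans _ _ (e * (q%:R * eta))).
    by rewrite ler_wpM2l // -ler_pdivrMr.
  by rewrite mulrA ler_piMl // ltW.
pose grid : finType := {ffun 'I_d -> 'I_(6 * m).+1}.
pose pt : grid -> 'cV[R]_d := @grid_point R d m.
pose W := \sum_(z : grid) mollifier (pt z).
have W0 : 0 < W.
  apply: lt_le_trans (@grid_mollifier_sum_ge R d q q0).
  by rewrite mulr_gt0 ?divr_gt0 ?exprn_gt0.
pose lam z := mollifier (pt z) / W.
have lam0 z : 0 <= lam z by rewrite divr_ge0 ?mollifier_ge0 ?ltW.
have lam1 : \sum_z lam z = 1 by rewrite -mulr_suml mulfV ?gt_eqF.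
have avg_le n p (F : grid -> 'M[R]_(n, p)) (B : R) : 0 <= B ->
    (forall z, enorm (F z) <= B) -> enorm (W^-1 *: \sum_z F z) <= c0 * B.
  move=> HB hF; rewrite enormZ normfV (ger0_norm (ltW W0)) mulrC.
  rewrite ler_pdivrMr //; apply: le_trans (enorm_sum_le _ _) _.
  apply: le_trans (@grid_card_le R d q q0 B HB).
  by apply: ler_sum.
exists grid, lam, pt; split=> //.
  move=> z; rewrite mulr1 -[leRHS]mulr1.
  have [h|h] := leP 1 (dotp (pt z) (pt z)).
    by rewrite /lam mollifier_eq0 // !mul0r.
  rewrite ler_wpM2l // -(@expr_le1 _ 2) ?enorm_ge0 // enorm_cV_sqr.
  exact: ltW.
move=> f hf x; have [fK fL] := hf.
pose g := W^-1 *: \sum_z f (x + pt z) *: mollifier_grad (pt z).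
pose A := W^-1 *: \sum_z f (x + pt z) *: mollifier_hess (pt z).
have ptr z : enorm (pt z) <= rho by apply: grid_point_norm.
have hg : enorm g <= c0 * (K * k2).
  apply: avg_le => [|z]; first by rewrite mulr_ge0.
  by rewrite enormZ ler_pM ?enorm_ge0 // mollifier_grad_le.
have hA : enorm A <= c0 * (K * k3).
  apply: avg_le => [|z]; first by rewrite mulr_ge0.
  by rewrite enormZ ler_pM ?enorm_ge0 // mollifier_hess_le.
have GK k : k <= k1 + k2 + k3 -> c0 * (K * k) <= G * K.
  by move=> hk; rewrite /G -mulrA ler_wpM2l // mulrC ler_wpM2r.
have hA' : enorm A <= G * K by apply: le_trans hA (GK _ _); lra.
have hg' : enorm g <= G * K by apply: le_trans hg (GK _ _); lra.
exists g, A; split.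
- rewrite /sym_mx /A linearZ linear_sum /=; congr (_ *: _).
  by apply: eq_bigr => z _; rewrite linearZ /= mollifier_hess_sym.
- apply: le_trans hA' _; rewrite ler_wpM2r //; lra.
suff hnet : forall y, enorm y <= 1 -> exists y', enorm (y - y') <= e /\
    `|average lam pt f (x + y') - average lam pt f x - dotp g y'
       - 2^-1 * dotp (A *m y') y'| <= G * K * enorm y' ^+ 3.
  move=> y; have hav := average_bounded_lip pt lam0 lam1 hf.
  have ee : 0 <= e <= 1 by rewrite e0.
  apply: le_trans (taylor_of_net hav K0 L0 G0 ee hg' hA' hnet y) _.
  by rewrite lerD2l.
move=> y y1; have [a [ha hya]] := grid_approx m0 y1.
pose y' : 'cV[R]_d := \col_i (((a i)%:R - m%:R) / m%:R).
exists y'; split=> //.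
have y'2 : enorm y' <= 2.
  rewrite -[y'](subKr y); apply: le_trans (enormD _ _) _.
  by rewrite enormN; have : enorm (y - y') <= e by []; lra.
pose rem z := mollifier (pt z - y') - mollifier (pt z)
  - dotp (mollifier_grad (pt z)) y' - 2^-1 * dotp (mollifier_hess (pt z) *m y') y'.
have remE : average lam pt f (x + y') - average lam pt f x - dotp g y'
       - 2^-1 * dotp (A *m y') y' = W^-1 * \sum_z f (x + pt z) * rem z.
  have -> : average lam pt f (x + y')
      = W^-1 * \sum_z f (x + pt z) * mollifier (pt z - y').
    rewrite /average /lam mulr_sumr.
    under eq_bigr do rewrite -addrA mulrC mulrA mulrC.
    rewrite -!mulr_sumr; congr (_ * _).
    under [RHS]eq_bigr do rewrite mulrC.
    rewrite -(@grid_shift R d m m0 a (fun u => f (x + u)) ha).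
    by apply: eq_bigr => z _; rewrite mulrC.
  have -> : average lam pt f x = W^-1 * \sum_z f (x + pt z) * mollifier (pt z).
    by rewrite mulr_sumr; apply: eq_bigr => z _; rewrite /lam; ring.
  have -> : dotp g y'
      = W^-1 * \sum_z f (x + pt z) * dotp (mollifier_grad (pt z)) y'.
    rewrite dotpZl dotp_suml; congr (_ * _).
    by apply: eq_bigr => z _; rewrite dotpZl.
  have -> : 2^-1 * dotp (A *m y') y' = W^-1 * \sum_z
      f (x + pt z) * (2^-1 * dotp (mollifier_hess (pt z) *m y') y').
    rewrite -scalemxAl dotpZl mulrCA; congr (_ * _).
    rewrite mulmx_suml dotp_suml mulr_sumr; apply: eq_bigr => z _.
    by rewrite -scalemxAl dotpZl mulrCA.
  rewrite -!mulrBr -!sumrB; congr (_ * _); apply: eq_bigr => z _.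
  by rewrite /rem !mulrBr.
rewrite remE normrM normfV (ger0_norm (ltW W0)) mulrC ler_pdivrMr //.
apply: le_trans (ler_norm_sum _ _ _) _.
have B1 : 0 <= K * (k1 * enorm y' ^+ 3) by rewrite !mulr_ge0 ?exprn_ge0 ?enorm_ge0.
apply: (@le_trans _ _ (c0 * (K * (k1 * enorm y' ^+ 3)) * W)).
  apply: le_trans (@grid_card_le R d q q0 _ B1).
  apply: ler_sum => z _; rewrite normrM ler_pM //.
  exact: mollifier_taylor.
rewrite ler_wpM2r ?(ltW W0) //.
rewrite (mulrA K) (mulrA c0) ler_wpM2r ?exprn_ge0 ?enorm_ge0 //.
by apply: GK; lra.
Qed.

(** The unit radius is applied to [f (h *: u)] and scaled back, which costs h^-2 on the Hessian and
    h^-3 on the remainder; one constant covers both. *)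
Lemma smoothing_exists (h : R) : 0 < h -> exists C, 0 <= C /\ @smoothing R d h C.
Proof.
move=> h0; have [C [C0 hC]] := smoothing_unit.
have hi : 0 < h^-1 by rewrite invr_gt0.
exists (C * (h^-1 ^+ 2 + h^-1 ^+ 3)); split=> [|K L eta K0 L0 eta0].
  by apply: mulr_ge0 => //; rewrite addr_ge0 ?exprn_ge0 ?(ltW hi).
have Lh0 : 0 <= L * h by rewrite mulr_ge0 ?(ltW h0).
have [I [lam [z [l0 l1 lz hT]]]] := hC K (L * h) eta K0 Lh0 eta0.
exists I, lam, (fun i => h *: z i); split=> // [i|f hf x].
  rewrite enormZ (gtr0_norm h0) mulrCA (mulrC _ h) (ler_wpM2l (ltW h0)) //.
  by have := lz i; rewrite mulr1.
pose fh u := f (h *: u).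
have hfh : bounded_lip K (L * h) fh.
  case: hf => fK fL; split=> [u|u u']; first exact: fK.
  by apply: le_trans (fL _ _) _; rewrite -scalerBr enormZ (gtr0_norm h0) mulrA.
have [g [A [sA hA hy]]] := hT fh hfh (h^-1 *: x).
have avE u : average lam (fun i => h *: z i) f u = average lam z fh (h^-1 *: u).
  by apply: eq_bigr => i _; rewrite /fh scalerDr scalerA mulfV ?gt_eqF // scale1r.
exists (h^-1 *: g), (h^-1 ^+ 2 *: A); split.
- by rewrite /sym_mx linearZ /= sA.
- rewrite enormZ ger0_norm ?exprn_ge0 ?(ltW hi) // mulrC.
  apply: (@le_trans _ _ (C * K * h^-1 ^+ 2)).
    by rewrite ler_wpM2r ?exprn_ge0 // ltW.
  rewrite mulrAC ler_wpM2r // ler_wpM2l // lerDl exprn_ge0 // ltW //.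
move=> y; rewrite !avE scalerDr; have := hy (h^-1 *: y).
have -> : dotp g (h^-1 *: y) = dotp (h^-1 *: g) y by rewrite dotpZr dotpZl.
have -> : dotp (A *m (h^-1 *: y)) (h^-1 *: y) = dotp (h^-1 ^+ 2 *: A *m y) y.
  by rewrite -scalemxAr -scalemxAl !dotpZr !dotpZl mulrA expr2.
move=> /le_trans; apply; rewrite lerD2r enormZ (gtr0_norm hi) exprMn.
rewrite mulrA ler_wpM2r ?exprn_ge0 ?enorm_ge0 // mulrAC ler_wpM2r //.
by rewrite ler_wpM2l // lerDr exprn_ge0 // ltW.
Qed.

(** [C] is independent of [n], of the laws and of [f]. With [h] fixed, the sum on the right tends to
    0 as soon as the steps have scale n^(-1/2), bounded third moments before scaling, and
    covariances that agree up to o(1/n). *)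
Lemma chain_compare_uniform (h : R) : 0 < h -> exists C : R, 0 <= C /\
  forall (K L : R) (n : nat) (ps qs : nat -> ('cV[R]_d -> R) -> R) (e : nat -> R),
  0 <= K -> 0 <= L ->
  (forall k, law (ps k) /\ centered (ps k)) ->
  (forall k, law (qs k) /\ centered (qs k)) ->
  (forall k, 0 <= e k) ->
  (forall k A, (k < n)%N -> sym_mx A ->
    `|half_cov (ps k) A - half_cov (qs k) A| <= e k * enorm A) ->
  forall f x, bounded_lip K L f ->
  `|chain ps n f x - chain qs n f x|
    <= 2 * L * h + C * K * \sum_(k < n) (e k + moment3 (ps k) + moment3 (qs k)).
Proof.
move=> h0; have [C [C0 hC]] := smoothing_exists h0.
by exists C; split=> //; apply: chain_compare.
Qed.

End SmoothingExists.

(** * Limits along an ultrafilter *)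

Section UltraLimit.
Context {R : realType} (U : set_system nat) (hU : UltraFilter U).
Hypothesis (U_oo : \oo `<=` U).

(** It gives every bounded sequence a value that respects order, sums and multiples, before any
    convergence is known. *)
Definition ultralim (u : nat -> R) : R := lim (u n @[n --> U]).

Lemma ultralim_cvg (u : nat -> R) (K : R) : (forall n, `|u n| <= K) ->
  u n @[n --> U] --> ultralim u.
Proof.
move=> hK; suff : cvg (u n @[n --> U]) by [].
have hI : (u n @[n --> U]) [set` `[- K, K]].
  apply: (@filterS _ U _ setT); last exact: filterT.
  by move=> n _ /=; rewrite in_itv /= -ler_norml.
have [l [_ hl]] := @segment_compact R (- K) K _ _ hI.
apply/cvg_ex; exists l => B /= nB.
have [//|hC] := in_ultra_setVsetC (u @^-1` B) hU.
by have [x [/= nBx Bx]] := hl (~` B) B hC nB.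
Qed.

Lemma ultralim_eq (u : nat -> R) l : u n @[n --> U] --> l -> ultralim u = l.
Proof. by move=> h; apply: cvg_lim => //; exact: Rhausdorff. Qed.

Lemma ultralim_cst c : ultralim (fun=> c) = c.
Proof. by apply: ultralim_eq; exact: cvg_cst. Qed.

Lemma ultralim_near (u v : nat -> R) K : (forall n, `|u n| <= K) ->
  (forall n, `|v n| <= K) -> (exists N, forall n, (N <= n)%N -> u n <= v n) ->
  ultralim u <= ultralim v.
Proof.
move=> hu hv [N hN].
apply: (ler_cvg_to (ultralim_cvg hu) (ultralim_cvg hv)).
by apply: U_oo; exists N => // n /= /hN.
Qed.

Lemma ultralim_le (u v : nat -> R) K : (forall n, `|u n| <= K) ->
  (forall n, `|v n| <= K) -> (forall n, u n <= v n) -> ultralim u <= ultralim v.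
Proof. by move=> hu hv h; apply: (ultralim_near hu hv); exists 0%N. Qed.

Lemma ultralimD (u v : nat -> R) K : (forall n, `|u n| <= K) ->
  (forall n, `|v n| <= K) ->
  ultralim (fun n => u n + v n) = ultralim u + ultralim v.
Proof.
by move=> hu hv; apply: ultralim_eq; apply: cvgD; apply: ultralim_cvg; eauto.
Qed.

Lemma ultralimZ (u : nat -> R) c K : (forall n, `|u n| <= K) ->
  ultralim (fun n => c * u n) = c * ultralim u.
Proof.
by move=> hu; apply: ultralim_eq; apply: cvgM; [exact: cvg_cst|exact: ultralim_cvg hu].
Qed.

Lemma ultralim_eq_near (u : nat -> R) c N :
  (forall n, (N <= n)%N -> u n = c) -> ultralim u = c.
Proof.
move=> h; apply: ultralim_eq; apply: cvg_near_cst.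
by apply: U_oo; exists N => // n /= /h.
Qed.

Lemma ultralim_dist_le (u : nat -> R) c e K N : (forall n, `|u n| <= K) ->
  (forall n, (N <= n)%N -> `|c - u n| <= e) -> `|c - ultralim u| <= e.
Proof.
move=> hu h.
have hb c' n : `|u n| <= K + `|c'|.
  by apply: le_trans (hu n) _; rewrite lerDl.
have hc c' (n : nat) : `|c'| <= K + `|c'|.
  by rewrite lerDr; apply: le_trans (hu 0%N).
rewrite ler_distlC.
have h1 : ultralim (fun=> c - e) <= ultralim u.
  apply: (@ultralim_near _ _ (K + `|c - e|)) => [n|n|]; [exact: hc|exact: hb|].
  by exists N => n /h; rewrite ler_distlC => /andP[].
have h2 : ultralim u <= ultralim (fun=> c + e).
  apply: (@ultralim_near _ _ (K + `|c + e|)) => [n|n|]; [exact: hb|exact: hc|].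
  by exists N => n /h; rewrite ler_distlC => /andP[].
by move: h1 h2; rewrite !ultralim_cst => -> ->.
Qed.

End UltraLimit.

Lemma ultrafilter_exists : exists U : set_system nat, UltraFilter U /\ \oo `<=` U.
Proof. exact: ultraFilterLemma. Qed.

(** * The stable limit of a walk *)

Section StableLimit.
Context {R : realType}.

Lemma div_sqrt_small (a e : R) : 0 <= a -> 0 < e ->
  exists N, (0 < N)%N /\ forall n, (N <= n)%N -> a / Num.sqrt n%:R <= e.
Proof.
move=> a0 e0; exists (Num.truncn ((a / e) ^+ 2)).+1; split=> // n hn.
have n0 : 0 < n%:R :> R by rewrite ltr0n (leq_trans _ hn).
have s0 : 0 < Num.sqrt n%:R :> R by rewrite sqrtr_gt0.
rewrite ler_pdivrMr // mulrC -ler_pdivrMr //.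
rewrite -(@ler_pXn2r _ 2) ?nnegrE ?divr_ge0 ?(ltW e0) ?(ltW s0) //.
rewrite sqr_sqrtr ?(ltW n0) //; apply: le_trans (ltW (truncnS_gt _)) _.
by rewrite ler_nat.
Qed.

Lemma inv_sqrt_sqr n : (0 < n)%N -> (Num.sqrt n%:R : R)^-1 ^+ 2 = n%:R^-1.
Proof. by move=> n0; rewrite exprVn sqr_sqrtr. Qed.

Context (d : nat) (t : ('cV[R]_d -> R) -> R) (ht : law t) (ct : centered t).

Definition even_moment k := fun y : 'cV[R]_d => (1 + enorm y ^+ 2) ^+ k.

(** The increase is of second order in the step size [c], so [n] steps of size n^(-1/2) multiply the
    moment by at most (1 + C/n)^n, which stays below e^C. *)
Definition moment_stable := forall k, exists C, 0 <= C /\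
  forall c, 0 <= c <= 1 -> forall x,
    step (scale_law c t) (even_moment k) x <= (1 + C * c ^+ 2) * even_moment k x.

Hypothesis ht_mom : moment_stable.
Context (U : set_system nat) (hU : UltraFilter U) (U_oo : \oo `<=` U).

Let iid (c : R) := fun _ : nat => scale_law c t.

Definition walk n f := chain (fun _ => scale_law (Num.sqrt n%:R)^-1 t) n f 0.

(** Defined through an ultralimit to have values on all of [C_l_Lip]; on bounded Lipschitz functions
    [walk_cvg] shows that it is a true limit. *)
Definition stable f := ultralim U (fun n => walk n f).

Lemma iid_law c k : law (iid c k).
Proof. exact: scale_law_law. Qed.

Lemma iid_centered c k : centered (iid c k).
Proof. exact: scale_law_centered. Qed.

Lemma iid_both c k : law (iid c k) /\ centered (iid c k).
Proof. by split; [exact: iid_law|exact: iid_centered]. Qed.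

Lemma walk_law n : law (walk n).
Proof. by apply: chain_law => k; exact: iid_law. Qed.

Lemma C_l_Lip_even_moment k : C_l_Lip (even_moment k).
Proof.
apply: C_l_LipX; apply: C_l_LipD; first exact: C_l_Lip_cst.
by apply: C_l_LipX; exact: C_l_Lip_enorm.
Qed.

Lemma walk_moment k : exists M, 0 <= M /\ forall n, walk n (even_moment k) <= M.
Proof.
have [C [C0 hC]] := ht_mom k.
have hV := C_l_Lip_even_moment k.
have grow c n x : 0 <= c <= 1 ->
    chain (iid c) n (even_moment k) x <= (1 + C * c ^+ 2) ^+ n * even_moment k x.
  move=> c01; elim: n => [|n IH]; first by rewrite expr0 mul1r.
  have D0 : 0 <= 1 + C * c ^+ 2 by rewrite addr_ge0 // mulr_ge0 // sqr_ge0.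
  rewrite exprS -mulrA /=.
  apply: le_trans (ler_wpM2l D0 IH).
  rewrite -(chain_poshom (iid_law c)) //; apply: chain_mono; first exact: iid_law.
  - by apply: step_C_l_Lip => //; exact: iid_law.
  - exact: C_l_LipZ.
  - exact: hC.
exists (expR C); split=> [|n]; first exact: expR_ge0.
set c : R := (Num.sqrt n%:R)^-1.
have c01 : 0 <= c <= 1.
  rewrite invr_ge0 sqrtr_ge0 /=; case: n @c => [|n] c.
    by rewrite /c sqrtr0 invr0.
  by rewrite invf_le1 ?sqrtr_gt0 // -{1}sqrtr1 ler_sqrt ?ler1n.
apply: le_trans (grow c n 0 c01) _.
rewrite /even_moment enorm0 expr0n /= addr0 expr1n mulr1.
have hc1 : 1 + C * c ^+ 2 <= expR (C * c ^+ 2) by exact: expR_ge1Dx.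
apply: (@le_trans _ _ (expR (C * c ^+ 2) ^+ n)).
  by rewrite lerXn2r ?nnegrE ?expR_ge0 // addr_ge0 // mulr_ge0 // sqr_ge0.
rewrite -expRM_natl ler_expR.
case: n @c {c01 hc1} => [|n] c; first by rewrite mul0r.
by rewrite /c inv_sqrt_sqr // mulrCA mulfV ?mulr1 ?pnatr_eq0.
Qed.

Lemma walk_bound f : C_l_Lip f -> exists M, forall n, `|walk n f| <= M.
Proof.
move=> hf; have [C [k [C0 hC]]] := C_l_Lip_growth hf.
have [M [M0 hM]] := walk_moment k; exists (C * 2 ^+ k * M) => n.
have hw := walk_law n; have hV := C_l_Lip_even_moment k.
apply: le_trans (law_le_norm hw hf) _.
apply: (@le_trans _ _ (walk n (fun x => C * 2 ^+ k * even_moment k x))).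
  apply: (law_mono hw); [exact: C_l_Lip_norm|exact: C_l_LipZ|].
  move=> x; apply: le_trans (hC x) _; rewrite -mulrA ler_wpM2l // -exprMn.
  have x0 := enorm_ge0 x.
  rewrite lerXn2r ?nnegrE ?addr_ge0 ?mulr_ge0 // ?addr_ge0 ?sqr_ge0 //.
  by have := sqr_ge0 (enorm x - 1); have := sqr_ge0 (enorm x); rewrite sqrrB; lra.
by rewrite (law_poshom hw) ?ler_wpM2l ?mulr_ge0 ?exprn_ge0.
Qed.

Lemma stable_law : law stable.
Proof.
split=> [f g hf hg h|c|f g hf hg|c f hf c0]; rewrite /stable.
- have [M1 h1] := walk_bound hf; have [M2 h2] := walk_bound hg.
  apply: (@ultralim_le _ _ hU U_oo _ _ (Num.max M1 M2)) => n.
  + by rewrite le_max h1.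
  + by rewrite le_max h2 orbT.
  by apply: (law_mono (walk_law n)).
- under eq_fun do rewrite (law_cst (walk_law _)); exact: ultralim_cst.
- have [M1 h1] := walk_bound hf; have [M2 h2] := walk_bound hg.
  have [M3 h3] := walk_bound (C_l_LipD hf hg).
  pose M := Num.max (Num.max M1 M2) (Num.max M3 (M1 + M2)).
  rewrite -(@ultralimD _ _ hU _ _ M) => [|n|n]; last 2 first.
    by rewrite !le_max h1.
    by rewrite !le_max h2 ?orbT.
  apply: (@ultralim_le _ _ hU U_oo _ _ M) => n.
  + by rewrite !le_max h3 ?orbT.
  + rewrite !le_max; apply/orP; right; apply/orP; right.
    by apply: le_trans (ler_normD _ _) _; rewrite lerD.
  exact: (law_subadd (walk_law n)).
- have [M1 h1] := walk_bound hf; rewrite -(@ultralimZ _ _ hU _ _ M1) //.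
  by under eq_fun do rewrite (law_poshom (walk_law _)) //.
Qed.

Lemma chain_iid_half_cov c n A : sym_mx A ->
  half_cov (fun f => chain (iid c) n f 0) A = n%:R * (c ^+ 2 * half_cov t A).
Proof.
move=> sA; rewrite chain_half_cov //; [|exact: iid_law|exact: iid_centered].
by rewrite -scale_law_half_cov // sumr_const card_ord mulr_natl.
Qed.

(** Covariances add exactly along a chain, so every walk of positive length already has the function
    G of [t]: the ultralimit is that of an eventually constant sequence. *)
Lemma stable_half_cov A : sym_mx A -> half_cov stable A = half_cov t A.
Proof.
move=> sA; rewrite {1}/half_cov /stable; apply: (@ultralim_eq_near _ _ hU U_oo _ _ 1%N).
move=> n n1; have := @chain_iid_half_cov (Num.sqrt n%:R)^-1 n A sA.
rewrite /half_cov /walk => ->; rewrite inv_sqrt_sqr // mulrA mulfV ?mul1r //.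
by rewrite pnatr_eq0 -lt0n.
Qed.

Lemma walk_moment3 : exists M, 0 <= M /\ forall n, moment3 (walk n) <= M.
Proof.
have [M hM] := walk_bound (@C_l_Lip_enorm3 R d); exists `|M|; split=> // n.
by apply: le_trans (ler_norm _) (le_trans (hM n) (ler_norm _)).
Qed.

Lemma chain_iid_scale a c n f x :
  chain (iid (a * c)) n f x = chain (iid c) n (fun y => f (x + a *: y)) 0.
Proof.
have E : iid (a * c) = (fun k => scale_law a (iid c k)).
  apply/funext => k; apply/funext => g; rewrite /iid /scale_law.
  by congr t; apply/funext => y; rewrite scalerA.
rewrite E -{1}[x]addr0 -chain_shift -{1}(scaler0 _ a); exact: chain_scale.
Qed.

Lemma chain_blocks (p : ('cV[R]_d -> R) -> R) n m f x :
  chain (fun _ => p) (n * m) f x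
  = chain (fun _ g => chain (fun _ => p) m g 0) n f x.
Proof.
elim: n f => //= n IH f; rewrite mulSn addnC chain_cat IH; congr (chain _ n _ x).
by apply/funext => y; rewrite step_chain.
Qed.

Lemma bounded_lip_affine K L f (x : 'cV[R]_d) (a : R) : 0 <= a ->
  bounded_lip K L f -> bounded_lip K (L * a) (fun y => f (x + a *: y)).
Proof.
move=> a0 [hK hL]; split=> [y|y y']; first exact: hK.
apply: le_trans (hL _ _) _.
by rewrite opprD addrACA subrr add0r -scalerBr enormZ ger0_norm // mulrA.
Qed.

(** The longer walk is cut into [n] blocks of [m] steps. A block has the same function G as one step
    of the shorter walk, and by the moment bound on walks its third moment is of order n^(-3/2)
    uniformly in [m]; the error beyond [2 * L * h] is thus of order n^(-1/2). *)
Lemma walk_cauchy K L e : 0 <= K -> 0 <= L -> 0 < e ->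
  exists N, (0 < N)%N /\ forall n m f, (N <= n)%N -> (0 < m)%N ->
    bounded_lip K L f -> `|walk n f - walk (n * m) f| <= e.
Proof.
move=> K0 L0 e0; pose h := e / (4 * (L + 1)).
have L1 : 0 < 4 * (L + 1) by lra.
have h0 : 0 < h by rewrite divr_gt0.
have hLh : 2 * L * h <= e / 2.
  rewrite /h mulrA ler_pdivrMr // [leRHS](_ : _ = 2 * (L + 1) * e); last by field.
  by rewrite ler_wpM2r ?(ltW e0) //; lra.
have [C [C0 hC]] := @chain_compare_uniform R d h h0.
have [M [M0 hM]] := walk_moment3.
have m30 := moment3_ge0 ht.
have a0 : 0 <= C * K * (moment3 t + M) by rewrite !mulr_ge0 ?addr_ge0.
have e20 : 0 < e / 2 by rewrite divr_gt0.
have [N [N0 hN]] := div_sqrt_small a0 e20.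
exists N; split=> // n m f Nn m0 hf.
have n0 : (0 < n)%N := leq_trans N0 Nn.
have nR : 0 < n%:R :> R by rewrite ltr0n.
pose c : R := (Num.sqrt n%:R)^-1.
have c0 : 0 <= c by rewrite invr_ge0 sqrtr_ge0.
pose c' : R := (Num.sqrt (n * m)%:R)^-1.
have c'E : c' = c * (Num.sqrt m%:R)^-1.
  by rewrite /c' natrM sqrtrM ?ler0n // invfM.
pose q g := chain (iid c') m g 0.
have qE g : q g = scale_law c (walk m) g.
  rewrite /q c'E chain_iid_scale /scale_law /walk.
  by congr chain; apply/funext => y; rewrite add0r.
have hq : law q by apply: chain_law => k; exact: iid_law.
have cq : centered q.
  by apply: chain_centered => k; [exact: iid_law|exact: iid_centered].
have cov_eq A : sym_mx A -> `|half_cov (iid c 0) A - half_cov q A| <= 0 * enorm A.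
  move=> sA; rewrite mul0r chain_iid_half_cov // scale_law_half_cov //.
  rewrite c'E exprMn !inv_sqrt_sqr // (mulrC _ m%:R^-1) !mulrA mulfV ?pnatr_eq0 -?lt0n //.
  by rewrite mul1r subrr normr0.
have -> : walk (n * m) f = chain (fun _ => q) n f 0 by rewrite /walk chain_blocks.
have := hC K L n (iid c) (fun _ => q) (fun _ => 0) K0 L0 (iid_both c)
  (fun _ => conj hq cq) (fun _ => lexx 0) (fun k A _ => cov_eq A) f 0 hf.
move=> /le_trans; apply.
rewrite [leRHS](_ : _ = e / 2 + e / 2); last by field.
apply: lerD => //; apply: le_trans (hN n Nn).
have mq : moment3 q <= c ^+ 3 * M.
  have -> : moment3 q = moment3 (scale_law c (walk m)) by rewrite /moment3 qE.
  rewrite scale_law_moment3 //; last exact: walk_law.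
  by rewrite ler_wpM2l ?exprn_ge0.
have mi : moment3 (iid c 0) = c ^+ 3 * moment3 t by rewrite scale_law_moment3.
under eq_bigr do rewrite add0r mi.
rewrite sumr_const card_ord -[X in C * K * X]mulr_natl.
rewrite -[leRHS]mulrA ler_wpM2l ?mulr_ge0 //.
apply: (@le_trans _ _ (n%:R * (c ^+ 3 * (moment3 t + M)))).
  by rewrite ler_wpM2l ?ler0n // mulrDr lerD2l.
rewrite exprS /c inv_sqrt_sqr // le_eqVlt; apply/orP; left; apply/eqP.
field; by rewrite ?(gt_eqF nR) ?(@gt_eqF _ _ (Num.sqrt _) 0) ?sqrtr_gt0.
Qed.

(** Two lengths [n] and [m] are compared through their common multiple [n * m]. *)
Lemma walk_cvg K L e : 0 <= K -> 0 <= L -> 0 < e ->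
  exists N, (0 < N)%N /\ forall n f, (N <= n)%N ->
    bounded_lip K L f -> `|walk n f - stable f| <= e.
Proof.
move=> K0 L0 e0; have e20 : 0 < e / 2 by rewrite divr_gt0.
have [N [N0 hN]] := walk_cauchy K0 L0 e20; exists N; split=> // n f Nn hf.
have [M hM] := walk_bound (bounded_lip_C_l_Lip hf).
apply: (@ultralim_dist_le _ _ hU U_oo _ _ _ M N hM) => m Nm.
have h1 := hN n m f Nn (leq_trans N0 Nm) hf.
have := hN m n f Nm (leq_trans N0 Nn) hf; rewrite mulnC => h2.
have -> : walk n f - walk m f =
  (walk n f - walk (n * m) f) - (walk m f - walk (n * m) f) by ring.
by apply: le_trans (ler_normB _ _) _; lra.
Qed.

Lemma chain_iid_cvg a K L e : 0 <= a -> 0 <= K -> 0 <= L -> 0 < e ->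
  exists N, (0 < N)%N /\ forall n f x, (N <= n)%N -> bounded_lip K L f ->
    `|chain (iid (a / Num.sqrt n%:R)) n f x - stable (fun y => f (x + a *: y))| <= e.
Proof.
move=> a0 K0 L0 e0; have La0 : 0 <= L * a by rewrite mulr_ge0.
have [N [N0 hN]] := walk_cvg K0 La0 e0; exists N; split=> // n f x Nn hf.
rewrite chain_iid_scale; apply: hN => //; exact: bounded_lip_affine.
Qed.

End StableLimit.

(** * Stability of the limit law *)

Section Semigroup.
Context {R : realType}.
Context (d : nat) (t : ('cV[R]_d -> R) -> R) (ht : law t) (ct : centered t).
Hypothesis ht_mom : moment_stable t.
Context (U : set_system nat) (hU : UltraFilter U) (U_oo : \oo `<=` U).

Let iid (c : R) := fun _ : nat => scale_law c t.
Let P := stable t U.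
Let hP : law P. Proof. exact: stable_law. Qed.

Lemma C_b_Lip_bounded_lip (f : 'cV[R]_d -> R) : C_b_Lip f ->
  exists K L, [/\ 0 <= K, 0 <= L & bounded_lip K L f].
Proof.
move=> [[K hK] [L hL]]; exists `|K|, `|L|; split=> //; split=> [x|x y].
  exact: le_trans (hK x) (ler_norm _).
by apply: le_trans (hL x y) _; rewrite ler_wpM2r ?enorm_ge0 // ler_norm.
Qed.

(** When [k] and [l] are nearly in the ratio of a^2 to b^2, the step variances a^2/k, b^2/l and
    r^2/(k + l) nearly agree: rounding [k] down costs at most r^2/(k + l) over each block. The two
    blocks are then close to one uniform walk of length [k + l]. *)
Lemma two_block_compare K L (a b e : R) : 0 < a -> 0 < b -> 0 <= K -> 0 <= L ->
  0 < e -> let r := Num.sqrt (a ^+ 2 + b ^+ 2) in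
  forall N0, exists k l, [/\ (N0 <= k)%N, (N0 <= l)%N, (0 < k)%N, (0 < l)%N &
  forall f, bounded_lip K L f ->
   `|chain (iid (a / Num.sqrt k%:R)) k (chain (iid (b / Num.sqrt l%:R)) l f) 0
     - chain (iid (r / Num.sqrt (k + l)%:R)) (k + l) f 0| <= e].
Proof.
move=> a0 b0 K0 L0 e0 r N0.
have r2 : r ^+ 2 = a ^+ 2 + b ^+ 2.
  by rewrite sqr_sqrtr // addr_ge0 ?sqr_ge0.
have a20 : 0 < a ^+ 2 by rewrite exprn_gt0.
have b20 : 0 < b ^+ 2 by rewrite exprn_gt0.
have r20 : 0 < r ^+ 2 by rewrite r2 addr_gt0.
have rn0 : r != 0 by rewrite -sqrf_eq0 (gt_eqF r20).
have r0 : 0 <= r by exact: sqrtr_ge0.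
pose h := e / (4 * (L + 1)).
have L1 : 0 < 4 * (L + 1) by lra.
have h0 : 0 < h by rewrite divr_gt0.
have hLh : 2 * L * h <= e / 2.
  rewrite /h mulrA ler_pdivrMr // [leRHS](_ : _ = 2 * (L + 1) * e); last by field.
  by rewrite ler_wpM2r ?(ltW e0) //; lra.
have [C [C0 hC]] := @chain_compare_uniform R d h h0.
have CK0 : 0 <= C * K by rewrite mulr_ge0.
have m30 := moment3_ge0 ht.
pose m := moment3 t.
(* The first summand collects the covariance mismatch of the two blocks, the second the third
   moments of the two blocks and of the uniform walk. *)
pose B := C * K * (2 * r ^+ 2 * (1 + m) + (a ^+ 3 + b ^+ 3 + 2 * r ^+ 3) * m).
have B0 : 0 <= B.
  have ? : 0 <= a ^+ 3 by rewrite exprn_ge0 // ltW.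
  have ? : 0 <= b ^+ 3 by rewrite exprn_ge0 // ltW.
  have ? : 0 <= r ^+ 3 by rewrite exprn_ge0.
  apply: mulr_ge0 => //; apply: addr_ge0; apply: mulr_ge0 => //; last lra.
    by apply: mulr_ge0 => //; exact: ltW.
  by rewrite /m; lra.
have e20 : 0 < e / 2 by rewrite divr_gt0.
have [N1 [N10 hN1]] := div_sqrt_small B0 e20.
pose n1 := (N0 + N1)%N.
pose p := a ^+ 2 / r ^+ 2.
have p0 : 0 < p by rewrite divr_gt0.
have q0 : 0 < 1 - p.
  by rewrite subr_gt0 ltr_pdivrMr // mul1r r2 ltrDl.
(* The first block should have length [N * p]; [N] is large enough for both blocks to have at least
   [n1] steps after rounding. *)
pose N := ((Num.truncn (n1.+1%:R / p)).+1 + (Num.truncn (n1.+1%:R / (1 - p))).+1)%N.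
have hN1' : n1.+1%:R <= N%:R * p.
  rewrite -ler_pdivrMr //; apply: le_trans (ltW (truncnS_gt _)) _.
  by rewrite ler_nat /N leq_addr.
have hN2' : n1.+1%:R <= N%:R * (1 - p).
  rewrite -ler_pdivrMr //; apply: le_trans (ltW (truncnS_gt _)) _.
  by rewrite ler_nat /N leq_addl.
have Np0 : 0 <= N%:R * p by rewrite mulr_ge0 // ltW.
pose k := Num.truncn (N%:R * p).
have /andP[k1 k2] := truncn_itv Np0; rewrite -/k in k1 k2.
have n1k : (n1 <= k)%N.
  rewrite -ltnS -(@ltr_nat R); apply: le_lt_trans k2.
  by apply: le_trans hN1'; rewrite ler_nat.
have kN : (k + n1 <= N)%N.
  rewrite -(@ler_nat R) natrD; move: hN2' k1; rewrite -natr1 mulrBr mulr1; lra.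
pose l := (N - k)%N.
have klN : (k + l = N)%N by rewrite /l subnKC // (leq_trans (leq_addr _ _) kN).
have n1l : (n1 <= l)%N by rewrite /l leq_subRL ?(leq_trans (leq_addr _ _) kN).
have n1N1 : (N1 <= n1)%N by rewrite leq_addl.
have k0 : (0 < k)%N := leq_trans (leq_trans N10 n1N1) n1k.
have l0 : (0 < l)%N := leq_trans (leq_trans N10 n1N1) n1l.
have N0' : (0 < N)%N by rewrite -klN addn_gt0 k0.
exists k, l; split=> //; try by [].
- by apply: leq_trans n1k; rewrite leq_addr.
- by apply: leq_trans n1l; rewrite leq_addr.
move=> f hf; rewrite klN.
have kR : 0 < k%:R :> R by rewrite ltr0n.
have lR : 0 < l%:R :> R by rewrite ltr0n.
have NR : 0 < N%:R :> R by rewrite ltr0n.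
have klR : k%:R + l%:R = N%:R :> R by rewrite -natrD klN.
pose ca := a / Num.sqrt k%:R; pose cb := b / Num.sqrt l%:R.
pose cr := r / Num.sqrt N%:R.
have sq (u : R) n : (0 < n)%N -> (u / Num.sqrt n%:R) ^+ 2 = u ^+ 2 / n%:R.
  by move=> n0; rewrite exprMn inv_sqrt_sqr.
pose ps i := if (i < k)%N then scale_law ca t else scale_law cb t.
pose e1 := `|ca ^+ 2 - cr ^+ 2| * (1 + m).
pose e2 := `|cb ^+ 2 - cr ^+ 2| * (1 + m).
pose es (i : nat) := if (i < k)%N then e1 else e2.
have m10 : 0 <= 1 + m by rewrite addr_ge0.
have -> : chain (iid ca) k (chain (iid cb) l f) 0 = chain ps N f 0.
  rewrite -klN chain_cat.
  rewrite (@eq_chain _ _ (fun i => ps (k + i)%N) (iid cb)); last first.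
    by move=> i _; rewrite /ps ltnNge leq_addr.
  rewrite (@eq_chain _ _ ps (iid ca)) //.
  by move=> i ik; rewrite /ps ik.
have hps i : law (ps i) /\ centered (ps i).
  by rewrite /ps; case: ifP => _; split;
    [exact: scale_law_law|exact: scale_law_centered|exact: scale_law_law
    |exact: scale_law_centered].
have hqs i : law (iid cr i) /\ centered (iid cr i).
  by split; [exact: scale_law_law|exact: scale_law_centered].
have hes i : 0 <= es i.
  by rewrite /es /e1 /e2; case: ifP => _; exact: mulr_ge0.
have covd (u v : R) A : `|half_cov (scale_law u t) A - half_cov (scale_law v t) A|
    <= `|u ^+ 2 - v ^+ 2| * (1 + m) * enorm A.
  rewrite !scale_law_half_cov // -mulrBl normrM -mulrA ler_wpM2l //.
  by rewrite mulrC; exact: half_cov_le.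
have hcov i A : (i < N)%N -> sym_mx A ->
    `|half_cov (ps i) A - half_cov (iid cr i) A| <= es i * enorm A.
  by move=> _ _; rewrite /ps /es /e1 /e2; case: ifP => _; exact: covd.
have := hC K L N ps (iid cr) es K0 L0 hps hqs hes hcov f 0 hf.
move=> /le_trans; apply.
rewrite [leRHS](_ : _ = e / 2 + e / 2); last by field.
have N1N : (N1 <= N)%N by rewrite -klN (leq_trans n1N1) // (leq_trans n1k) // leq_addr.
have N1k : (N1 <= k)%N by rewrite (leq_trans n1N1).
have N1l : (N1 <= l)%N by rewrite (leq_trans n1N1).
apply: lerD => //; apply: le_trans (hN1 N1 (leqnn _)).
pose w : R := (Num.sqrt N1%:R)^-1.
have w_le n : (N1 <= n)%N -> (Num.sqrt n%:R)^-1 <= w.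
  move=> hn; rewrite lef_pV2 ?posrE ?sqrtr_gt0 ?ltr0n //; last exact: leq_trans hn.
  by rewrite ler_sqrt ?ler_nat // ltr0n (leq_trans N10).
have w0 : 0 <= w by rewrite invr_ge0 sqrtr_ge0.
have wN : N%:R^-1 <= w.
  apply: le_trans (w_le _ N1N).
  rewrite -inv_sqrt_sqr // expr2 ler_piMl ?invr_ge0 ?sqrtr_ge0 //.
  rewrite invf_le1 ?sqrtr_gt0 // -{1}sqrtr1 ler_sqrt ?ler1n //.
have cube (u : R) n : (0 < n)%N ->
    n%:R * (u / Num.sqrt n%:R) ^+ 3 = u ^+ 3 / Num.sqrt n%:R.
  move=> n0; have nR : 0 < n%:R :> R by rewrite ltr0n.
  rewrite exprS sq //; field.
  by rewrite (gt_eqF nR) (@gt_eqF _ _ (Num.sqrt _) 0) ?sqrtr_gt0.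
rewrite /B -!mulrA ler_wpM2l // ler_wpM2l // -/w.
rewrite -klN big_split_ord /=.
under eq_bigr => i _.
  rewrite /es /ps (ltn_ord i) !scale_law_moment3 ?divr_ge0 ?sqrtr_ge0 ?(ltW a0) //.
  over.
under [X in _ + X <= _]eq_bigr => i _.
  rewrite /es /ps ltnNge leq_addr /= !scale_law_moment3 ?divr_ge0 ?sqrtr_ge0 ?(ltW b0) //.
  over.
rewrite !sumr_const !card_ord -[leLHS](_ : k%:R * (e1 + ca ^+ 3 * m + cr ^+ 3 * m)
  + l%:R * (e2 + cb ^+ 3 * m + cr ^+ 3 * m) = _); last by rewrite !mulr_natl.
have rN : k%:R * `|ca ^+ 2 - cr ^+ 2| <= r ^+ 2 * N%:R^-1 /\
    l%:R * `|cb ^+ 2 - cr ^+ 2| <= r ^+ 2 * N%:R^-1.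
  have E1 : k%:R * (ca ^+ 2 - cr ^+ 2) = r ^+ 2 / N%:R * (N%:R * p - k%:R).
    rewrite /ca /cr !sq // /p; field.
    by rewrite (gt_eqF kR) (gt_eqF NR) rn0.
  have E2 : l%:R * (cb ^+ 2 - cr ^+ 2) = - (r ^+ 2 / N%:R * (N%:R * p - k%:R)).
    have lE : l%:R = N%:R - k%:R :> R by rewrite -klR; ring.
    have bE : b ^+ 2 = r ^+ 2 - a ^+ 2 by rewrite r2; ring.
    rewrite /cb /cr !sq // /p bE lE; field.
    by rewrite -lE (gt_eqF lR) (gt_eqF NR) rn0.
  have bd : `|r ^+ 2 / N%:R * (N%:R * p - k%:R)| <= r ^+ 2 * N%:R^-1.
    rewrite normrM (@ger0_norm _ (_ / _)) ?divr_ge0 ?(ltW r20) //.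
    rewrite ler_piMr ?divr_ge0 ?(ltW r20) //.
    by rewrite ger0_norm ?subr_ge0 // lerBlDr; move: k2; rewrite -natr1 addrC => /ltW.
  by rewrite -(@ger0_norm _ k%:R) // -(@ger0_norm _ l%:R) // -!normrM E1 E2 normrN.
case: rN => rk rl.
have wr : r ^+ 2 * N%:R^-1 <= r ^+ 2 * w by rewrite ler_wpM2l // ltW.
have f1 : k%:R * ca ^+ 3 <= a ^+ 3 * w.
  by rewrite cube // ler_wpM2l ?w_le // exprn_ge0 // ltW.
have f2 : l%:R * cb ^+ 3 <= b ^+ 3 * w.
  by rewrite cube // ler_wpM2l ?w_le // exprn_ge0 // ltW.
have f3 : (k%:R + l%:R) * cr ^+ 3 <= r ^+ 3 * w.
  by rewrite klR cube // ler_wpM2l ?w_le // exprn_ge0.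
have rw0 : 0 <= r ^+ 3 * w by rewrite mulr_ge0 // exprn_ge0.
rewrite [leLHS](_ : _ = (k%:R * `|ca ^+ 2 - cr ^+ 2| + l%:R * `|cb ^+ 2 - cr ^+ 2|)
  * (1 + m) + (k%:R * ca ^+ 3 + l%:R * cb ^+ 3 + (k%:R + l%:R) * cr ^+ 3) * m); last first.
  by rewrite /e1 /e2; ring.
rewrite [leRHS](_ : _ = (r ^+ 2 * w + r ^+ 2 * w) * (1 + m)
  + (a ^+ 3 * w + b ^+ 3 * w + (r ^+ 3 * w + r ^+ 3 * w)) * m); last by ring.
apply: lerD; rewrite ler_wpM2r //.
  by apply: lerD; [exact: le_trans rk wr|exact: le_trans rl wr].
by apply: lerD; [exact: lerD|apply: le_trans f3 _; rewrite lerDl].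
Qed.

(** Four errors of e/4: the inner limit, the outer limit, the comparison of two blocks with one
    walk, and the limit on the right. The cases [a = 0] and [b = 0] are separate because the right
    proportion would leave one block empty. *)
Lemma stable_semigroup (f : 'cV[R]_d -> R) (a b : R) : C_b_Lip f ->
  0 <= a -> 0 <= b ->
  P (fun x => P (fun y => f (a *: x + b *: y)))
  = P (fun x => f (Num.sqrt (a ^+ 2 + b ^+ 2) *: x)).
Proof.
move=> hf a0 b0; set r := Num.sqrt _.
have [K [L [K0 L0 hKL]]] := C_b_Lip_bounded_lip hf.
have [az|an] := eqVneq a 0.
  have -> : r = b by rewrite /r az expr0n /= add0r sqrtr_sqr ger0_norm.
  rewrite -[RHS](law_cst hP); congr P; apply/funext => x.
  by congr P; apply/funext => y; rewrite az scale0r add0r.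
have [bz|bn] := eqVneq b 0.
  have -> : r = a by rewrite /r bz expr0n /= addr0 sqrtr_sqr ger0_norm.
  congr P; apply/funext => x; rewrite -[RHS](law_cst hP).
  by congr P; apply/funext => y; rewrite bz scale0r addr0.
have a1 : 0 < a by rewrite lt_neqAle eq_sym an.
have b1 : 0 < b by rewrite lt_neqAle eq_sym bn.
have r0 : 0 <= r by exact: sqrtr_ge0.
pose V u := P (fun y => f (u + b *: y)).
have hV : bounded_lip K L V.
  exact: (step_bounded_lip (scale_law_law hP b) hKL).
apply/eqP; rewrite -subr_eq0 -normr_le0; apply/ler_addgt0Pr => e e0.
have e4 : 0 < e / 4 by rewrite divr_gt0.
have [Na [_ hNa]] := chain_iid_cvg ht ct ht_mom hU U_oo a0 K0 L0 e4.
have [Nb [_ hNb]] := chain_iid_cvg ht ct ht_mom hU U_oo b0 K0 L0 e4.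
have [Nr [_ hNr]] := chain_iid_cvg ht ct ht_mom hU U_oo r0 K0 L0 e4.
have [k [l [hk hl k0 l0 hkl]]] :=
  @two_block_compare K L a b (e / 4) a1 b1 K0 L0 e4 (Na + Nb + Nr)%N.
have ka : (Na <= k)%N by apply: leq_trans hk; rewrite -addnA leq_addr.
have lb : (Nb <= l)%N by apply: leq_trans hl; rewrite addnAC leq_addl.
have nr : (Nr <= k + l)%N.
  by apply: leq_trans (leq_addr _ _); apply: leq_trans hk; rewrite leq_addl.
have h1 := hNa k V 0 ka hV; have h3 := hNr _ f 0 nr hKL; have h4 := hkl f hKL.
have hcl := bounded_lip_C_l_Lip hKL.
have hlaw c i : law (iid c i) by exact: scale_law_law.
have h2 := @chain_dist_le _ _ _ (hlaw (a / Num.sqrt k%:R)) k (e / 4)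
  (chain (iid (b / Num.sqrt l%:R)) l f) V 0
  (chain_C_l_Lip (hlaw _) l hcl) (bounded_lip_C_l_Lip hV)
  (fun y => hNb l f y lb hKL).
have E1 : stable t U (fun y => V (0 + a *: y))
   = P (fun x => P (fun y => f (a *: x + b *: y))).
  by congr stable; apply/funext => y; rewrite add0r.
have E2 : stable t U (fun y => f (0 + r *: y)) = P (fun y => f (r *: y)).
  by congr stable; apply/funext => y; rewrite add0r.
rewrite E1 in h1; rewrite E2 in h3; rewrite -/r in h4; rewrite add0r.
set u4 := P _ in h1 *; set u5 := P _ in h3 *.
have -> : u4 - u5 = - (chain (iid (a / Num.sqrt k%:R)) k V 0 - u4)
  - (chain (iid (a / Num.sqrt k%:R)) k (chain (iid (b / Num.sqrt l%:R)) l f) 0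
     - chain (iid (a / Num.sqrt k%:R)) k V 0)
  + (chain (iid (a / Num.sqrt k%:R)) k (chain (iid (b / Num.sqrt l%:R)) l f) 0
     - chain (iid (r / Num.sqrt (k + l)%:R)) (k + l) f 0)
  + (chain (iid (r / Num.sqrt (k + l)%:R)) (k + l) f 0 - u5) by ring.
have -> : e = e / 4 + e / 4 + e / 4 + e / 4 by field.
apply: le_trans (ler_normD _ _) _; apply: lerD => //.
apply: le_trans (ler_normD _ _) _; apply: lerD => //.
by apply: le_trans (ler_normB _ _) _; rewrite normrN; apply: lerD.
Qed.

End Semigroup.

(** * Square of a sublinear law *)

Section ProductSpace.
Context {R : realType} (d : nat) (P : ('cV[R]_d -> R) -> R) (hP : law P).

Let E (Phi : 'cV[R]_(d + d) -> R) := P (fun x => P (fun y => Phi (col_mx x y))).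

Lemma C_l_Lip_col_mx (Phi : 'cV[R]_(d + d) -> R) x :
  C_l_Lip Phi -> C_l_Lip (fun y => Phi (col_mx x y)).
Proof.
apply: C_l_Lip_comp => i; rewrite -(splitK i); case: (fintype.split i) => j /=.
  by under eq_fun do rewrite col_mxEu; exact: C_l_Lip_cst.
by under eq_fun do rewrite col_mxEd; exact: C_l_Lip_coord.
Qed.

Let mono Phi Psi : C_l_Lip Phi -> C_l_Lip Psi ->
  (forall w, Psi w <= Phi w) -> E Psi <= E Phi.
Proof.
move=> h1 h2 h; apply: (law_mono hP); try exact: (C_l_Lip_law_param hP).
by move=> x; apply: (law_mono hP); try exact: C_l_Lip_col_mx.
Qed.

Let cst c : E (fun=> c) = c.
Proof. by rewrite /E (law_cst hP) (law_cst hP). Qed.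

Let subadd Phi Psi : C_l_Lip Phi -> C_l_Lip Psi ->
  E (fun w => Phi w + Psi w) <= E Phi + E Psi.
Proof.
move=> h1 h2; have h3 := C_l_Lip_law_param hP h1; have h4 := C_l_Lip_law_param hP h2.
apply: le_trans (law_subadd hP h3 h4); apply: (law_mono hP).
- exact: C_l_Lip_law_param hP (C_l_LipD h1 h2).
- exact: C_l_LipD.
by move=> x; apply: (law_subadd hP); exact: C_l_Lip_col_mx.
Qed.

Let poshom l Phi : C_l_Lip Phi -> 0 <= l -> E (fun w => l * Phi w) = l * E Phi.
Proof.
move=> h1 l0; rewrite /E -(law_poshom hP) //; last exact: (C_l_Lip_law_param hP).
congr P; apply/funext => x; rewrite (law_poshom hP) //; exact: C_l_Lip_col_mx.
Qed.

Let comp n (X : 'cV[R]_(d + d) -> 'cV[R]_n) (phi : 'cV[R]_n -> R) :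
  (forall i, C_l_Lip (fun w => X w i 0)) -> C_l_Lip phi ->
  C_l_Lip (fun w => phi (X w)).
Proof. exact: C_l_Lip_comp. Qed.

(** The second half of the coordinates is integrated first, so it is independent from the first half
    by construction; it supplies the independent copy that [G_normal] requires on the same space. *)
Definition product_space : sublinear_space R :=
  @SublinearSpace R 'cV[R]_(d + d) (fun Phi => C_l_Lip Phi) E
    (@C_l_Lip_cst R _) (@C_l_LipD R _) (@C_l_LipZ R _) (@C_l_Lip_norm R _) comp
    mono cst subadd poshom.

Definition product_fst : product_space -> 'cV[R]_d := @usubmx R d d 1.
Definition product_snd : product_space -> 'cV[R]_d := @dsubmx R d d 1.

Lemma product_fst_E f : sl_E (fun w => f (product_fst w)) = P f.
Proof.
congr P; apply/funext => x; rewrite -[RHS](law_cst hP); congr P.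
by apply/funext => y; rewrite /product_fst col_mxKu.
Qed.

Lemma product_snd_E f : sl_E (fun w => f (product_snd w)) = P f.
Proof.
rewrite -[RHS](law_cst hP); congr P; apply/funext => x.
by congr P; apply/funext => y; rewrite /product_snd col_mxKd.
Qed.

Lemma product_joint_E f :
  sl_E (fun w => f (col_mx (product_fst w) (product_snd w)))
  = P (fun x => P (fun y => f (col_mx x y))).
Proof.
by congr P; apply/funext => x; congr P; apply/funext => y;
  rewrite /product_fst /product_snd col_mxKu col_mxKd.
Qed.

Lemma product_fst_G_normal :
  (forall f a b, C_b_Lip f -> 0 <= a -> 0 <= b ->
    P (fun x => P (fun y => f (a *: x + b *: y)))
    = P (fun x => f (Num.sqrt (a ^+ 2 + b ^+ 2) *: x))) ->
  G_normal product_fst.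
Proof.
move=> semi; split=> [i|].
  rewrite /sl_H /=; under eq_fun do rewrite mxE; exact: C_l_Lip_coord.
exists product_snd; split; first split.
- move=> i; rewrite /sl_H /=; under eq_fun do rewrite mxE; exact: C_l_Lip_coord.
- by move=> f _; rewrite product_fst_E product_snd_E.
- move=> f hf; rewrite product_joint_E.
  rewrite -(product_fst_E (fun x => P (fun y => f (col_mx x y)))).
  congr (@sl_E R _ _); apply/funext => w.
  exact: esym (product_snd_E (fun y => f (col_mx (product_fst w) y))).
move=> a b a0 b0 f hf.
apply: etrans _ (esym (product_fst_E (fun x => f (Num.sqrt (a ^+ 2 + b ^+ 2) *: x)))).
rewrite -semi //.
pose g (v : 'cV[R]_(d + d)) := f (a *: usubmx v + b *: dsubmx v).
transitivity (E g); last first.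
  by congr P; apply/funext => x; congr P; apply/funext => y;
    rewrite /g col_mxKu col_mxKd.
by [].
Qed.

End ProductSpace.

(** * Two-point laws and existence of G-normal vectors *)

Section PsdFactor.
Context {R : realType} (d : nat).

Lemma sym_mxE (Q : 'M[R]_d) i j : sym_mx Q -> Q i j = Q j i.
Proof. by move=> sQ; rewrite -{1}sQ mxE. Qed.

Lemma dotp_delta (x : 'cV[R]_d) i : dotp x (delta_mx i 0) = x i 0.
Proof.
rewrite /dotp (bigD1 i) //= big1 ?addr0; last first.
  by move=> j ji; rewrite mxE (negbTE ji) mulr0.
by rewrite mxE !eqxx mulr1.
Qed.

Lemma mulmx_row_dotp (Q : 'M[R]_d) x i : sym_mx Q ->
  (Q *m x) i 0 = dotp (col i Q) x.
Proof.
move=> sQ; rewrite mxE; apply: eq_bigr => j _.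
by rewrite mxE (sym_mxE _ _ sQ).
Qed.

Lemma quad_add_delta (Q : 'M[R]_d) x (s : R) i : sym_mx Q ->
  dotp (Q *m (x + s *: delta_mx i 0)) (x + s *: delta_mx i 0)
  = dotp (Q *m x) x + 2 * s * dotp (col i Q) x + s ^+ 2 * Q i i.
Proof.
move=> sQ; rewrite quadD // -scalemxAr dotpZl !dotpZr !dotp_delta.
rewrite !mulmx_row_dotp // dotp_delta [col i Q i 0]mxE; ring.
Qed.

Lemma row_mx_mul_tr m n (u : 'M[R]_(d, m)) (B : 'M[R]_(d, n)) :
  row_mx u B *m (row_mx u B)^T = u *m u^T + B *m B^T.
Proof. by rewrite tr_row_mx mul_row_col. Qed.

(** Cholesky factorization by induction on the number of rows that may be nonzero: a positive pivot
    is removed by a Schur complement, a zero pivot forces its row to vanish. The base case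
    contributes a zero column, so the number of columns is positive even in dimension 0, as the
    two-point laws require. *)
Lemma psd_factor_aux k (Q : 'M[R]_d) : S_plus Q ->
  (forall i j : 'I_d, (k <= i)%N -> Q i j = 0) ->
  exists B : 'M[R]_(d, k.+1), Q = B *m B^T.
Proof.
elim: k Q => [|k IH] Q [sQ pQ] hQ.
  by exists 0; rewrite mul0mx; apply/matrixP => i j; rewrite mxE hQ.
have [dk|kd] := leqP d k.
  have [|B hB] := IH Q (conj sQ pQ).
    by move=> i j ki; have := leq_trans (ltn_ord i) (leq_trans dk ki); rewrite ltnn.
  exists (row_mx (0 : 'cV_d) B).
  by apply: etrans _ (esym (row_mx_mul_tr (0 : 'cV_d) B)); rewrite mul0mx add0r.
pose i0 := Ordinal kd; pose a := Q i0 i0; pose v := col i0 Q.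
have a0 : 0 <= a.
  have := pQ (0 + 1 *: delta_mx i0 0); rewrite quad_add_delta // !dotp0r.
  by rewrite mulr0 !add0r expr1n mul1r.
have [az|an] := eqVneq a 0.
  (* With a zero pivot the form is affine in [s] along a line in the pivot direction, and an affine
     function that stays nonnegative has slope 0. *)
  have v0 j : Q i0 j = 0.
    have hs s : 0 <= Q j j + 2 * s * Q i0 j.
      have := pQ (delta_mx j 0 + s *: delta_mx i0 0).
      rewrite quad_add_delta // -/a az mulr0 addr0.
      by rewrite !dotp_delta mulmx_row_dotp // dotp_delta !mxE (sym_mxE j i0 sQ).
    apply/eqP/negPn/negP => n0.
    have := hs (- (Q j j + 1) / (2 * Q i0 j)).
    have -> : 2 * (- (Q j j + 1) / (2 * Q i0 j)) * Q i0 j = - (Q j j + 1) by field.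
    lra.
  have [|B hB] := IH Q (conj sQ pQ).
    move=> i j ki; have [ik|ik] := eqVneq i i0; first by rewrite ik v0.
    apply: hQ; rewrite ltn_neqAle ki andbT.
    by apply: contraNneq ik => ik; apply/eqP/val_inj.
  exists (row_mx (0 : 'cV_d) B).
  by apply: etrans _ (esym (row_mx_mul_tr (0 : 'cV_d) B)); rewrite mul0mx add0r.
have a1 : 0 < a by rewrite lt_neqAle eq_sym an.
pose Q' := Q - a^-1 *: (v *m v^T).
have Q'E i j : Q' i j = Q i j - a^-1 * (Q i i0 * Q j i0).
  by rewrite !mxE big_ord1 !mxE.
have sQ' : sym_mx Q'.
  by apply/matrixP => i j; rewrite mxE !Q'E (sym_mxE j i sQ) (mulrC (Q j i0)).
have [||B hB] := IH Q'.
- split=> // x.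
  have -> : dotp (Q' *m x) x = dotp (Q *m x) x - a^-1 * dotp v x ^+ 2.
    by rewrite mulmxBl dotpDl dotpNl -scalemxAl dotpZl quad_rank1.
  (* This shift along the pivot direction minimizes the form, and the minimum is the Schur
     complement at [x]. *)
  have := pQ (x + (- (dotp v x / a)) *: delta_mx i0 0); rewrite quad_add_delta //.
  rewrite -/a -/v (_ : _ + _ + _ = dotp (Q *m x) x - a^-1 * dotp v x ^+ 2) //.
  by field.
- move=> i j ki; rewrite Q'E; have [ik|ik] := eqVneq i i0.
    rewrite ik -/a (sym_mxE j i0 sQ) mulrA mulVf // mul1r subrr //.
  have ki' : (k < i)%N.
    rewrite ltn_neqAle ki andbT.
    by apply: contraNneq ik => ik; apply/eqP/val_inj.
  by rewrite (hQ i j) // (hQ i i0) // mul0r mulr0 subr0.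
exists (row_mx ((Num.sqrt a)^-1 *: v) B).
apply: etrans _ (esym (row_mx_mul_tr ((Num.sqrt a)^-1 *: v) B)).
rewrite -hB linearZ /= -scalemxAl -scalemxAr scalerA.
by rewrite -expr2 exprVn sqr_sqrtr // addrC subrK.
Qed.

Lemma psd_factor (Q : 'M[R]_d) : S_plus Q -> exists B : 'M[R]_(d, d.+1), Q = B *m B^T.
Proof. by move=> h; apply: psd_factor_aux => // i j; rewrite leqNgt ltn_ord. Qed.

End PsdFactor.

(** * Suprema of families of laws *)

Section SupLaw.
Context {R : realType}.

Lemma sup_imageZ (T : Type) (D : set T) (F : T -> R) (c : R) : D !=set0 ->
  (exists M, forall i, D i -> F i <= M) -> 0 <= c ->
  sup [set c * F i | i in D] = c * sup [set F i | i in D].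
Proof.
move=> [i0 Di0] [M hM] c0.
have leF i : D i -> F i <= sup [set F i | i in D].
  by move=> Di; apply: ub_le_sup; [exists M => _ [j Dj <-]; exact: hM|exists i].
have lecF i : D i -> c * F i <= sup [set c * F i | i in D].
  move=> Di; apply: ub_le_sup; last by exists i.
  by exists (c * M) => _ [j Dj <-]; rewrite ler_wpM2l ?hM.
apply/eqP; rewrite eq_le; apply/andP; split.
  apply: ge_sup; first by exists (c * F i0); exists i0.
  by move=> _ [i Di <-]; rewrite ler_wpM2l // leF.
have [cz|cn] := eqVneq c 0.
  by rewrite {1}cz mul0r -[leLHS](mul0r (F i0)) -{1}cz lecF.
have c1 : 0 < c by rewrite lt_neqAle eq_sym cn.
rewrite mulrC -ler_pdivlMr //; apply: ge_sup; first by exists (F i0); exists i0.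
by move=> _ [i Di <-]; rewrite ler_pdivlMr // mulrC lecF.
Qed.

Context (d : nat) (T : Type) (D : set T) (p : T -> ('cV[R]_d -> R) -> R).
Hypotheses (D0 : D !=set0) (hp : forall i, D i -> law (p i)).
Hypothesis hbound : forall f, C_l_Lip f -> exists M, forall i, D i -> p i f <= M.

Definition sup_law f := sup [set p i f | i in D].

Lemma sup_law_ge f i : C_l_Lip f -> D i -> p i f <= sup_law f.
Proof.
move=> hf Di; have [M hM] := hbound hf; apply: ub_le_sup; last by exists i.
by exists M => _ [j Dj <-]; exact: hM.
Qed.

Lemma sup_law_le f c : (forall i, D i -> p i f <= c) -> sup_law f <= c.
Proof.
move=> h; apply: ge_sup; last by move=> _ [i Di <-]; exact: h.
by case: D0 => i Di; exists (p i f); exists i.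
Qed.

Lemma sup_law_cst f c : (forall i, D i -> p i f = c) -> sup_law f = c.
Proof.
move=> h; rewrite /sup_law (_ : [set _ | _ in _] = [set c]) ?sup1 //.
apply/seteqP; split=> [_ [i Di <-]|_ ->]; first exact: h.
by case: D0 => i Di; exists i => //; exact: h.
Qed.

Lemma sup_law_law : law sup_law.
Proof.
split=> [f g hf hg h|c|f g hf hg|c f hf c0].
- apply: sup_law_le => i Di; apply: le_trans (sup_law_ge hg Di).
  exact: (law_mono (hp Di)).
- by apply: sup_law_cst => i Di; exact: (law_cst (hp Di)).
- apply: sup_law_le => i Di; apply: le_trans (law_subadd (hp Di) hf hg) _.
  by rewrite lerD ?sup_law_ge.
rewrite /sup_law -(sup_imageZ D0 (hbound hf) c0); congr sup.
by apply: eq_imagel => i Di; exact: (law_poshom (hp Di)).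
Qed.

End SupLaw.

Section PairLaw.
Context {R : realType} (d m : nat) (m0 : (0 < m)%N).

(* The factor [sqrt m] makes [B B^T] the covariance matrix. *)
Definition pair_law (B : 'M[R]_(d, m)) (f : 'cV[R]_d -> R) : R :=
  (2 * m%:R)^-1 * \sum_(j < m) (f (Num.sqrt m%:R *: col j B)
    + f (- (Num.sqrt m%:R *: col j B))).

Let mR : 0 < m%:R :> R. Proof. by rewrite ltr0n. Qed.
Let mi : 0 <= (2 * m%:R)^-1 :> R.
Proof. by rewrite invr_ge0 mulr_ge0 // ltW. Qed.

Lemma pair_law_le B f c :
  (forall j : 'I_m, f (Num.sqrt m%:R *: col j B)
     + f (- (Num.sqrt m%:R *: col j B)) <= 2 * c) ->
  pair_law B f <= c.
Proof.
move=> h; rewrite /pair_law mulrC ler_pdivrMr ?mulr_gt0 //.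
apply: (@le_trans _ _ (\sum_(j < m) 2 * c)); first by apply: ler_sum.
by rewrite sumr_const card_ord -[leLHS]mulr_natl le_eqVlt; apply/orP; left;
  apply/eqP; ring.
Qed.

Lemma pair_law_law B : law (pair_law B).
Proof.
split=> [f g _ _ h|c|f g _ _|c f _ c0]; rewrite /pair_law.
- by rewrite ler_wpM2l //; apply: ler_sum => j _; rewrite lerD.
- rewrite sumr_const card_ord -[_ *+ m]mulr_natl; field; by rewrite gt_eqF.
- rewrite -mulrDr -big_split /= le_eqVlt; apply/orP; left; apply/eqP.
  by congr (_ * _); apply: eq_bigr => j _; ring.
- rewrite mulrCA; congr (_ * _); rewrite mulr_sumr; apply: eq_bigr => j _; ring.
Qed.

Lemma pair_law_centered B : centered (pair_law B).
Proof.
move=> g; rewrite /pair_law big1 ?mulr0 // => j _.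
by rewrite dotpNr subrr.
Qed.

Lemma trace_mul_tr (A : 'M[R]_d) (B : 'M[R]_(d, m)) :
  \sum_(j < m) dotp (A *m col j B) (col j B) = \tr (A *m (B *m B^T)).
Proof.
rewrite mulmxA mxtrace_mulC /mxtrace; apply: eq_bigr => j _.
rewrite mxE /dotp; apply: eq_bigr => i _.
have -> : (A *m col j B) i 0 = (A *m B) i j.
  by rewrite !mxE; apply: eq_bigr => k _; rewrite mxE.
by rewrite [col j B i 0]mxE [B^T j i]mxE mulrC.
Qed.

Lemma pair_law_half_cov B (A : 'M[R]_d) :
  half_cov (pair_law B) A = 2^-1 * \tr (A *m (B *m B^T)).
Proof.
rewrite /half_cov /pair_law -trace_mul_tr !mulr_sumr; apply: eq_bigr => j _.
rewrite mulmxN dotpNl dotpNr opprK -scalemxAr dotpZl dotpZr.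
rewrite (mulrA (Num.sqrt _)) -expr2 sqr_sqrtr ?ltW //.
by field; rewrite gt_eqF.
Qed.

Lemma enorm_col_le (B : 'M[R]_(d, m)) j : enorm (col j B) <= enorm B.
Proof.
rewrite -ler_sqr ?nnegrE ?enorm_ge0 // enorm_cV_sqr enorm_sqrE.
rewrite -(pair_bigA _ (fun i j => B i j ^+ 2)) /= /dotp.
apply: ler_sum => i _; rewrite mxE -expr2 (bigD1 j) //= lerDl.
by apply: sumr_ge0 => k _; exact: sqr_ge0.
Qed.

(** The diagonal entries of [B *m B^T] are the squared norms of the rows of [B]; a bounded set of
    covariances therefore has bounded factors. *)
Lemma enorm_factor_le (B : 'M[R]_(d, m)) :
  enorm B ^+ 2 <= d%:R * enorm (B *m B^T).
Proof.
rewrite enorm_sqrE -(pair_bigA _ (fun i j => B i j ^+ 2)) /=.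
apply: (@le_trans _ _ (\sum_(i < d) enorm (B *m B^T))); last first.
  by rewrite sumr_const card_ord -[leLHS]mulr_natl.
apply: ler_sum => i _; apply: le_trans (enorm_entry _ i i).
apply: le_trans (ler_norm _); rewrite mxE le_eqVlt; apply/orP; left; apply/eqP.
by apply: eq_bigr => j _; rewrite mxE expr2.
Qed.

End PairLaw.

(** * Even moments under symmetric two-point increments *)

Section EvenMomentPair.
Context {R : realType}.

(** Sum M and difference D of the two powers are propagated together: M becomes (a + w) M + b D and
    D becomes (a + w) D + b M. Both [b] and D carry a factor [r], so their product adds only a term
    in r^2 to the sum. *)
Lemma even_power_pair (beta : R) k : 0 <= beta -> exists C E, [/\ 0 <= C, 0 <= E &
  forall a b w r, 0 <= r <= beta -> 0 <= a -> `|b| <= 2 * a * r ->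
    0 <= w <= r ^+ 2 * a ->
    `|(a + b + w) ^+ k + (a - b + w) ^+ k| <= 2 * (a ^+ k * (1 + C * r ^+ 2)) /\
    `|(a + b + w) ^+ k - (a - b + w) ^+ k| <= 2 * (E * a ^+ k * r)].
Proof.
move=> b0; elim: k => [|k [C [E [C0 E0 IH]]]].
  exists 0, 0; split=> // a b w r _ _ _ _; rewrite !expr0 !mul0r addr0 mulr1 mulr0.
  by rewrite subrr normr0 ger0_norm //; split=> //; lra.
have beta2 : 0 <= beta ^+ 2 by exact: sqr_ge0.
have Cb : 0 <= C * beta ^+ 2 by exact: mulr_ge0.
have Eb : 0 <= E * beta ^+ 2 by exact: mulr_ge0.
exists (1 + C + C * beta ^+ 2 + 2 * E), (E + E * beta ^+ 2 + 2 * (1 + C * beta ^+ 2)).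
split; [lra|lra|move=> a b w r hr a0 hb hw].
have [hM hD] := IH a b w r hr a0 hb hw.
case/andP: hr => r0 rb; case/andP: hw => w0 w1.
have r2 : 0 <= r ^+ 2 by exact: sqr_ge0.
have rb2 : r ^+ 2 <= beta ^+ 2 by rewrite lerXn2r ?nnegrE.
have ak : 0 <= a ^+ k by rewrite exprn_ge0.
have Cr : C * r ^+ 2 <= C * beta ^+ 2 by rewrite ler_wpM2l.
have Er : E * r ^+ 2 <= E * beta ^+ 2 by rewrite ler_wpM2l.
move: hM hD; rewrite !(exprS _ k).
set M := (a + b + w) ^+ k + (a - b + w) ^+ k.
set D := (a + b + w) ^+ k - (a - b + w) ^+ k => hM hD.
have aw : `|a + w| <= a * (1 + r ^+ 2) by rewrite ger0_norm ?addr_ge0 //; lra.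
have awM : `|(a + w) * M| <= a * (1 + r ^+ 2) * (2 * (a ^+ k * (1 + C * r ^+ 2))).
  by rewrite normrM ler_pM.
have awD : `|(a + w) * D| <= a * (1 + r ^+ 2) * (2 * (E * a ^+ k * r)).
  by rewrite normrM ler_pM.
have bM : `|b * M| <= 2 * a * r * (2 * (a ^+ k * (1 + C * r ^+ 2))).
  by rewrite normrM ler_pM.
have bD : `|b * D| <= 2 * a * r * (2 * (E * a ^+ k * r)).
  by rewrite normrM ler_pM.
have aak : 0 <= a * a ^+ k by rewrite mulr_ge0.
split.
  rewrite (_ : _ + _ = (a + w) * M + b * D); last by rewrite /M /D; ring.
  apply: le_trans (ler_normD _ _) _; apply: le_trans (lerD awM bD) _.
  rewrite [leLHS](_ : _ = 2 * (a * a ^+ k * (1 + r ^+ 2 * (1 + C + C * r ^+ 2 + 2 * E))));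
    last by ring.
  rewrite ler_wpM2l // ler_wpM2l // lerD2l mulrC ler_wpM2r //; lra.
rewrite (_ : _ - _ = (a + w) * D + b * M); last by rewrite /M /D; ring.
apply: le_trans (ler_normD _ _) _; apply: le_trans (lerD awD bM) _.
rewrite [leLHS](_ : _ = 2 * ((E + E * r ^+ 2 + 2 * (1 + C * r ^+ 2)) * (a * a ^+ k) * r));
  last by ring.
by rewrite ler_wpM2l // ler_wpM2r // ler_wpM2r //; lra.
Qed.

(** The bases are a + b + w and a - b + w with a = 1 + |x|^2, b = 2 <x,z> and w = |z|^2; the
    symmetry of the increment cancels the first order in [z]. *)
Lemma even_moment_pair d (beta : R) k : 0 <= beta -> exists C, 0 <= C /\
  forall (c : R) (x z : 'cV[R]_d), 0 <= c <= 1 -> enorm z <= c * beta ->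
    even_moment k (x + z) + even_moment k (x - z)
    <= 2 * ((1 + C * c ^+ 2) * even_moment k x).
Proof.
move=> beta0; have [C [E [C0 E0 h]]] := even_power_pair k beta0.
exists (C * beta ^+ 2); split=> [|c x z /andP[c0 c1] hz].
  by rewrite mulr_ge0 ?sqr_ge0.
pose r := c * beta.
have hr : 0 <= r <= beta by rewrite /r mulr_ge0 //= ler_piMl.
have r0 : 0 <= r by case/andP: hr.
have x0 := enorm_ge0 x; have z0 := enorm_ge0 z.
have x2 : 0 <= enorm x ^+ 2 by exact: sqr_ge0.
pose a := 1 + enorm x ^+ 2.
have a0 : 0 <= a by rewrite /a; lra.
have xa : enorm x <= a.
  by have := sqr_ge0 (enorm x - 1); rewrite sqrrB /a; lra.
have hb : `|2 * dotp x z| <= 2 * a * r.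
  rewrite normrM ger0_norm // -mulrA ler_wpM2l //.
  by apply: le_trans (dotp_le _ _) _; rewrite ler_pM.
have hw : 0 <= enorm z ^+ 2 <= r ^+ 2 * a.
  rewrite sqr_ge0 /=; apply: (@le_trans _ _ (r ^+ 2)).
    by rewrite lerXn2r ?nnegrE.
  by rewrite ler_peMr ?sqr_ge0 // /a; lra.
have [hM _] := h a _ _ r hr a0 hb hw.
have e1 : 1 + enorm (x + z) ^+ 2 = a + 2 * dotp x z + enorm z ^+ 2.
  by rewrite /a !enorm_cV_sqr !(dotpDl, dotpDr) (dotpC z x); ring.
have e2 : 1 + enorm (x - z) ^+ 2 = a - 2 * dotp x z + enorm z ^+ 2.
  by rewrite /a !enorm_cV_sqr !(dotpDl, dotpDr, dotpNl, dotpNr) (dotpC z x); ring.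
rewrite /even_moment e1 e2 -/a; apply: le_trans (ler_norm _) (le_trans hM _).
by rewrite /r le_eqVlt; apply/orP; left; apply/eqP; ring.
Qed.

End EvenMomentPair.

(** * Existence of a G-normal vector with a given set of covariances *)

Section Existence.
Context {R : realType} (d : nat) (Theta : set 'M[R]_d) (hTheta : @Xi R d Theta).

Let D := [set B : 'M[R]_(d, d.+1) | Theta (B *m B^T)].
(** A law of bounded support whose function G is [G_of Theta]: the worst case over the factors of
    all matrices in [Theta]. *)
Let t := sup_law D (@pair_law R d d.+1).

Let D_image : [set B *m B^T | B in D] = Theta.
Proof.
case: hTheta => hS _ _ _; apply/seteqP; split=> [_ [B DB <-]|Q TQ] //.
by have [B hB] := psd_factor (hS Q TQ); exists B; rewrite -?hB // /D /= -hB.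
Qed.

Let D_nonempty : D !=set0.
Proof.
case: hTheta => _ [Q TQ] _ _; move: TQ; rewrite -D_image => -[B DB _].
by exists B.
Qed.

Let D_bounded : exists beta, 0 <= beta /\ forall B j, D B ->
  enorm (Num.sqrt d.+1%:R *: col j B) <= beta.
Proof.
case: hTheta => _ _ [K hK] _.
exists (Num.sqrt d.+1%:R * Num.sqrt (d%:R * K)); split.
  by rewrite mulr_ge0 ?sqrtr_ge0.
move=> B j DB; rewrite enormZ ger0_norm ?sqrtr_ge0 // ler_wpM2l ?sqrtr_ge0 //.
apply: le_trans (enorm_col_le _ _) _.
have h : enorm B ^+ 2 <= d%:R * K.
  by apply: le_trans (enorm_factor_le _) _; rewrite ler_wpM2l // hK.
by rewrite -(ger0_norm (enorm_ge0 B)) -sqrtr_sqr ler_wsqrtr.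
Qed.

Let pair_bounded f : C_l_Lip f ->
  exists M, forall B, D B -> pair_law B f <= M.
Proof.
move=> /C_l_Lip_growth[C [k [C0 hf]]]; have [beta [beta0 hb]] := D_bounded.
exists (C * (1 + beta) ^+ k) => B DB; apply: pair_law_le => // j.
have h (z : 'cV[R]_d) : enorm z <= beta -> f z <= C * (1 + beta) ^+ k.
  move=> hz; apply: le_trans (ler_norm _) (le_trans (hf z) _).
  by rewrite ler_wpM2l // lerXn2r ?nnegrE ?addr_ge0 ?enorm_ge0 // lerD2l.
by rewrite mulr_natl mulr2n lerD // h ?enormN ?hb.
Qed.

Let t_law : law t.
Proof. by apply: sup_law_law => // B DB; exact: pair_law_law. Qed.

Let t_centered : centered t.
Proof. by move=> g; apply: sup_law_cst => // B DB; exact: pair_law_centered. Qed.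

Let t_half_cov A : half_cov t A = G_of Theta A.
Proof.
rewrite /G_of -(@sup_imageZ _ _ Theta (fun Q => \tr (A *m Q)) 2^-1) //; first last.
- case: hTheta => _ _ [K hK] _; exists (enorm A * K) => Q TQ.
  apply: le_trans (ler_norm _) (le_trans (trace_mul_le _ _) _).
  by rewrite ler_wpM2l ?enorm_ge0 ?hK.
- by case: hTheta.
rewrite /half_cov /t /sup_law -[in RHS]D_image; congr sup; rewrite image_comp.
apply: eq_imagel => B _; exact: pair_law_half_cov.
Qed.

Let t_moment : moment_stable t.
Proof.
move=> k; have [beta [beta0 hb]] := D_bounded.
have [C [C0 hC]] := @even_moment_pair R d beta k beta0.
exists C; split=> // c c01 x; apply: sup_law_le => // B DB.
apply: pair_law_le => // j; rewrite scalerN; apply: hC => //.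
case/andP: c01 => c0 _.
by rewrite enormZ ger0_norm // ler_wpM2l // hb.
Qed.

Lemma G_normal_exists : exists (S : sublinear_space R) (Z : S -> 'cV[R]_d),
  G_normal_law Theta Z.
Proof.
have [U [hU U_oo]] := ultrafilter_exists.
have hP := stable_law t_law t_moment hU U_oo.
exists (product_space hP), (@product_fst _ _ _ hP); split.
  apply: product_fst_G_normal => f a b hf a0 b0.
  exact: (stable_semigroup t_law t_centered t_moment hU U_oo hf a0 b0).
move=> A sA; rewrite -t_half_cov -(stable_half_cov t_law t_centered hU U_oo sA).
exact: (product_fst_E hP (fun x => 2^-1 * dotp (A *m x) x)).
Qed.

End Existence.

(** * Limit of a Hausdorff-Cauchy sequence *)

Section LimitSet.
Context {R : realType} (d : nat) (Theta : nat -> set 'M[R]_d).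
Hypothesis hXi : forall i, @Xi R d (Theta i).

Lemma dist_set_lt (x : 'M[R]_d) (D : set 'M[R]_d) e : D !=set0 ->
  dist_set x D < e -> exists y, D y /\ enorm (x - y) < e.
Proof.
move=> [y0 Dy0] /inf_lt; have ne : [set enorm (x - y) | y in D] !=set0.
  by exists (enorm (x - y0)), y0.
by move=> /(_ ne) [_ [y Dy <-] h]; exists y.
Qed.

Lemma dist_set_le (x y : 'M[R]_d) (D : set 'M[R]_d) : D y ->
  dist_set x D <= enorm (x - y).
Proof.
move=> Dy; apply: ge_inf; last by exists y.
by exists 0 => _ [z _ <-]; exact: enorm_ge0.
Qed.

Lemma hausdorff_dist_lt (D1 D2 : set 'M[R]_d) e : Xi D1 -> Xi D2 ->
  hausdorff_dist D1 D2 < e ->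
  forall Q, D1 Q -> exists Q', D2 Q' /\ enorm (Q - Q') < e.
Proof.
move=> [s1 [y1 Dy1] [K1 h1] _] [s2 [y2 Dy2] [K2 h2] _] /inf_lt h Q DQ.
have K10 : 0 <= K1 := le_trans (enorm_ge0 _) (h1 _ Dy1).
have K20 : 0 <= K2 := le_trans (enorm_ge0 _) (h2 _ Dy2).
have far (x y : 'M[R]_d) : enorm x <= K1 + K2 -> enorm y <= K1 + K2 ->
    enorm (x - y) < 2 * (K1 + K2) + 1.
  by move=> hx hy; have := enormD x (- y); rewrite enormN; lra.
(* The infimum of an empty set would carry no information; boundedness of both sets provides an
   admissible radius. *)
have [|e' [e'0 h12 _] e'e] := h.
  exists (2 * (K1 + K2) + 1); split; first lra.
    move=> x D1x; split; first exact: s1.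
    apply: le_lt_trans (dist_set_le _ Dy2) _; apply: far.
      by have := h1 _ D1x; lra.
    by have := h2 _ Dy2; lra.
  move=> x D2x; split; first exact: s2.
  apply: le_lt_trans (dist_set_le _ Dy1) _; apply: far.
    by have := h2 _ D2x; lra.
  by have := h1 _ Dy1; lra.
have [_ hQ] := h12 _ DQ.
have [|Q' [D2Q' hQ']] := dist_set_lt _ hQ; first by exists y2.
by exists Q'; split=> //; exact: lt_trans e'e.
Qed.

Hypothesis hcauchy : hausdorff_cauchy Theta.

Lemma Theta_cauchy e : 0 < e -> exists N, forall i j Q, (N <= i)%N -> (N <= j)%N ->
  Theta i Q -> exists Q', Theta j Q' /\ enorm (Q - Q') < e.
Proof.
move=> /hcauchy [N hN]; exists N => i j Q Ni Nj.
exact: (hausdorff_dist_lt (hXi i) (hXi j) (hN i j Ni Nj)).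
Qed.

Definition limit_set : set 'M[R]_d := [set Q | forall e, 0 < e ->
  exists N, forall i, (N <= i)%N -> exists Q', Theta i Q' /\ enorm (Q - Q') < e].

Lemma eventually_bounded : exists K N, forall i Q, (N <= i)%N -> Theta i Q ->
  enorm Q <= K.
Proof.
have [N hN] := Theta_cauchy ltr01; have [_ _ [K hK] _] := hXi N.
exists (K + 1), N => i Q Ni TQ; have [Q' [TQ' hQ]] := hN i N Q Ni (leqnn N) TQ.
have := hK _ TQ'; have := enormD Q' (Q - Q'); rewrite addrC subrK; lra.
Qed.

Lemma limit_set_far Q : limit_set Q -> forall e N, 0 < e ->
  exists i Q', [/\ (N <= i)%N, Theta i Q' & enorm (Q - Q') < e].
Proof.
move=> hQ e N e0; have [N' hN'] := hQ e e0.
have [Q' [TQ' hd]] := hN' (maxn N N') (leq_maxr _ _).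
by exists (maxn N N'), Q'; split=> //; exact: leq_maxl.
Qed.

Lemma limit_set_near e : 0 < e -> exists N, forall i Q, (N <= i)%N ->
  limit_set Q -> exists Q', Theta i Q' /\ enorm (Q - Q') < e.
Proof.
move=> e0; have e2 : 0 < e / 2 by rewrite divr_gt0.
have [N hN] := Theta_cauchy e2; exists N => i Q Ni hQ.
have [j [Q1 [Nj TQ1 h1]]] := limit_set_far hQ N e2.
have [Q2 [TQ2 h2]] := hN j i Q1 Nj Ni TQ1; exists Q2; split=> //.
by have := enorm_distD Q1 Q Q2; lra.
Qed.

Lemma ultralim_matrix (U : set_system nat) (hU : UltraFilter U) (Q : nat -> 'M[R]_d) K :
  (forall n, enorm (Q n) <= K) ->
  exists L : 'M[R]_d, forall e, 0 < e -> U [set n | enorm (L - Q n) < e].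
Proof.
move=> hK; exists (\matrix_(i, j) ultralim U (fun n => Q n i j)) => e e0.
pose c := \sum_(p : 'I_d * 'I_d) (1 : R).
have c0 : 0 <= c by apply: sumr_ge0.
(* One is added because the number [c] of entries is 0 in dimension 0. *)
have ec : 0 < e / (c + 1) by rewrite divr_gt0 //; lra.
have hp (p : 'I_d * 'I_d) :
    \forall n \near U, `|ultralim U (fun n => Q n p.1 p.2) - Q n p.1 p.2| < e / (c + 1).
  have hb n : `|Q n p.1 p.2| <= K by apply: le_trans (hK n); exact: enorm_entry.
  by have /cvgrPdist_lt := ultralim_cvg hU hb; apply.
have hall : U [set n | forall p : 'I_d * 'I_d,
    `|ultralim U (fun n => Q n p.1 p.2) - Q n p.1 p.2| < e / (c + 1)].
  exact: filter_forall hp.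
apply: (filterS _ hall) => n h /=.
apply: le_lt_trans (enorm_le_sum _) _.
apply: (@le_lt_trans _ _ (\sum_(p : 'I_d * 'I_d) e / (c + 1))).
  by apply: ler_sum => p _; rewrite !mxE; exact: ltW (h p).
under eq_bigr do rewrite -[e / _]mulr1.
rewrite -mulr_sumr -/c mulrAC ltr_pdivrMr; last by lra.
by rewrite ltr_pM2l //; lra.
Qed.

(** Points of later sets within e/2 of [Q] form a bounded sequence. Its ultralimit belongs to
    [limit_set]: it is approached by points [q n] of late sets, and by the Cauchy property every
    late set has a point near those. *)
Lemma near_limit_set e : 0 < e -> exists N, forall i Q, (N <= i)%N ->
  Theta i Q -> exists Q', limit_set Q' /\ enorm (Q - Q') < e.
Proof.
move=> e0; have e2 : 0 < e / 2 by rewrite divr_gt0.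
have [N hN] := Theta_cauchy e2; exists N => i Q Ni TQ.
have [K [NK hK]] := eventually_bounded.
have hloc n : exists Q', Theta (maxn N NK + n)%N Q' /\ enorm (Q - Q') < e / 2.
  apply: (hN i) => //.
  by rewrite (leq_trans (leq_maxl _ NK)) // leq_addr.
have [q hq] := choice hloc.
have [U [hU U_oo]] := ultrafilter_exists.
have qK n : enorm (q n) <= K.
  apply: hK (hq n).1; by rewrite (leq_trans (leq_maxr N _)) // leq_addr.
have [L hL] := ultralim_matrix hU qK.
have witness (e' : R) n0 : 0 < e' -> exists n, (n0 <= n)%N /\ enorm (L - q n) < e'.
  move=> e'0; have h1 : U [set n | (n0 <= n)%N].
    by apply: U_oo; exists n0.
  have [n [/= h2 h3]] := @filter_ex _ U (@ultra_proper _ _ hU) _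
    (@filterI _ U (@filter_filter _ _ (@ultra_proper _ _ hU)) _ _ h1 (hL e' e'0)).
  by exists n.
exists L; split; last first.
  have [n [_ hn]] := witness (e / 2) 0%N e2.
  by have := enorm_distD (q n) Q L; have := (hq n).2; rewrite (enormB (q n) L); lra.
move=> e' e'0; have e'2 : 0 < e' / 2 by rewrite divr_gt0.
have [N' hN'] := Theta_cauchy e'2; exists N' => j Nj.
have [n [Nn hn]] := witness (e' / 2) N' e'2.
have [|Q' [TQ' hQ']] := hN' (maxn N NK + n)%N j (q n) _ Nj (hq n).1.
  by rewrite (leq_trans Nn) // leq_addl.
by exists Q'; split=> //; have := enorm_distD (q n) L Q'; lra.
Qed.

Lemma limit_set_S_plus : limit_set `<=` @S_plus R d.
Proof.
move=> Q hQ; split.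
  apply/matrixP => i j; rewrite mxE; apply/eqP; rewrite -subr_eq0 -normr_le0.
  apply/ler_addgt0Pr => e e0; rewrite add0r.
  have e2 : 0 < e / 2 by rewrite divr_gt0.
  have [k [Q' [_ TQ' hQ']]] := limit_set_far hQ 0%N e2.
  have [hS _ _ _] := hXi k; have [sQ' _] := hS _ TQ'.
  have -> : Q j i - Q i j = (Q - Q') j i - (Q - Q') i j.
    by rewrite !mxE (sym_mxE i j sQ'); ring.
  apply: le_trans (ler_normB _ _) _.
  by have := enorm_entry (Q - Q') i j; have := enorm_entry (Q - Q') j i; lra.
move=> x; rewrite -oppr_le0; apply/ler_addgt0Pr => e e0; rewrite add0r.
have x0 : 0 < enorm x ^+ 2 + 1 by have := sqr_ge0 (enorm x); lra.
have e2 : 0 < e / (enorm x ^+ 2 + 1) by rewrite divr_gt0.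
have [k [Q' [_ TQ' hQ']]] := limit_set_far hQ 0%N e2.
have [hS _ _ _] := hXi k; have [_ pQ'] := hS _ TQ'.
have := quad_le (Q - Q') x; have := pQ' x; rewrite mulmxBl dotpDl dotpNl.
have : enorm (Q - Q') * enorm x ^+ 2 <= e.
  apply: (@le_trans _ _ (e / (enorm x ^+ 2 + 1) * (enorm x ^+ 2 + 1))).
    by rewrite ler_pM ?enorm_ge0 ?sqr_ge0 ?(ltW hQ') //; lra.
  by rewrite divfK ?gt_eqF.
rewrite ler_norml => h1 h2 /andP[h3 _]; lra.
Qed.

Lemma limit_set_closed : closed limit_set.
Proof.
move=> Q clQ e e0; have e2 : 0 < e / 2 by rewrite divr_gt0.
pose c := \sum_(p : 'I_d * 'I_d) (1 : R).
have c0 : 0 <= c by apply: sumr_ge0.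
have ec : 0 < e / 2 / (c + 1) by rewrite divr_gt0 //; lra.
have [Q1 [hQ1 hb]] := clQ _ (nbhsx_ballx Q _ ec).
have h1 : enorm (Q - Q1) < e / 2.
  apply: le_lt_trans (enorm_le_sum _) _.
  apply: (@le_lt_trans _ _ (\sum_(p : 'I_d * 'I_d) e / 2 / (c + 1))).
    apply: ler_sum => p _; rewrite !mxE; case: hb => _ hb.
    exact: ltW (hb p.1 p.2).
  under eq_bigr do rewrite -[e / 2 / _]mulr1.
  rewrite -mulr_sumr -/c mulrAC ltr_pdivrMr; last by lra.
  by rewrite ltr_pM2l //; lra.
have [N hN] := hQ1 (e / 2) e2; exists N => i Ni.
have [Q' [TQ' h2]] := hN i Ni; exists Q'; split=> //.
by have := enorm_distD Q1 Q Q'; lra.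
Qed.

Lemma limit_set_Xi : Xi limit_set.
Proof.
split; [exact: limit_set_S_plus| | |exact: limit_set_closed].
  have [N hN] := near_limit_set ltr01; have [_ [Q TQ] _ _] := hXi N.
  by have [Q' [hQ' _]] := hN N Q (leqnn N) TQ; exists Q'.
have [K [N hK]] := eventually_bounded; exists (K + 1) => Q hQ.
have [i [Q' [Ni TQ' h]]] := limit_set_far hQ N ltr01.
by have := hK _ _ Ni TQ'; have := enormD Q' (Q - Q'); rewrite addrC subrK; lra.
Qed.

Lemma limit_set_convex :
  (forall i, convex_set (Theta i : set (convex_lmodType 'M[R]_d))) ->
  convex_set (limit_set : set (convex_lmodType 'M[R]_d)).
Proof.
move=> hconv x y l; rewrite !inE => hx hy e e0.
have [N1 h1] := hx e e0; have [N2 h2] := hy e e0.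
exists (maxn N1 N2) => i; rewrite geq_max => /andP[Ni1 Ni2].
have [x' [Tx' hx']] := h1 i Ni1; have [y' [Ty' hy']] := h2 i Ni2.
exists (conv l (x' : convex_lmodType 'M[R]_d) y'); split.
  by have := hconv i x' y' l; rewrite !inE; apply.
have l0 : 0 <= l%:num by [].
have l1 : l%:num <= 1 by [].
have -> : (conv l x y : 'M[R]_d) - conv l (x' : convex_lmodType 'M[R]_d) y'
    = l%:num *: ((x : 'M[R]_d) - x') + (1 - l%:num) *: ((y : 'M[R]_d) - y').
  by rewrite !scalerBr opprD addrACA.
apply: le_lt_trans (enormD _ _) _; rewrite !enormZ !ger0_norm ?subr_ge0 //.
(* Strictness is drawn from the first summand, so a zero weight is treated apart. *)
have [->|ln] := eqVneq (l%:num : R) 0; first by rewrite mul0r add0r subr0 mul1r.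
have lp : 0 < l%:num :> R by rewrite lt_neqAle eq_sym ln.
apply: (@lt_le_trans _ _ (l%:num * e + (1 - l%:num) * e)); last by lra.
by rewrite ltr_leD // ?ltr_pM2l // ler_wpM2l ?subr_ge0 // ltW.
Qed.

Lemma G_of_le (D1 D2 : set 'M[R]_d) A e : Xi D1 -> Xi D2 ->
  (forall Q, D1 Q -> exists Q', D2 Q' /\ enorm (Q - Q') < e) ->
  G_of D1 A - G_of D2 A <= e * enorm A.
Proof.
move=> [_ [Q1 TQ1] _ _] [_ _ [K hK] _] h.
have e0 : 0 <= e.
  by have [Q' [_ hQ']] := h _ TQ1; apply: ltW (le_lt_trans (enorm_ge0 _) hQ').
have hs : sup [set \tr (A *m Q) | Q in D1]
    <= sup [set \tr (A *m Q) | Q in D2] + e * enorm A.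
  apply: ge_sup; first by exists (\tr (A *m Q1)), Q1.
  move=> _ [Q DQ <-]; have [Q' [DQ' hQ']] := h Q DQ.
  have : \tr (A *m Q') <= sup [set \tr (A *m Q) | Q in D2].
    apply: ub_le_sup; last by exists Q'.
    exists (enorm A * K) => _ [P DP <-].
    apply: le_trans (ler_norm _) (le_trans (trace_mul_le _ _) _).
    by rewrite ler_wpM2l ?enorm_ge0 ?hK.
  have := trace_mul_le A (Q - Q'); rewrite mulmxBr linearB /=.
  have := ler_wpM2l (enorm_ge0 A) (ltW hQ').
  by rewrite ler_norml => h1 /andP[_ h2]; lra.
have eA : 0 <= e * enorm A by rewrite mulr_ge0 ?enorm_ge0.
rewrite /G_of; lra.
Qed.

Lemma G_of_limit_set e : 0 < e -> exists N, forall i A, (N <= i)%N ->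
  `|G_of (Theta i) A - G_of limit_set A| <= e * enorm A.
Proof.
move=> e0; have [N1 h1] := limit_set_near e0; have [N2 h2] := near_limit_set e0.
exists (maxn N1 N2) => i A; rewrite geq_max => /andP[Ni1 Ni2].
have hl := limit_set_Xi.
rewrite ler_norml; apply/andP; split; last first.
  by apply: G_of_le => // Q; exact: h2.
rewrite lerNl opprB; apply: G_of_le => // Q; exact: h1.
Qed.

End LimitSet.

(** * Central limit theorem *)

Section RandomVectors.
Context {R : realType} (d : nat).

Definition rv_law (S : sublinear_space R) (X : S -> 'cV[R]_d) :=
  fun f : 'cV[R]_d -> R => sl_E (fun w => f (X w)).

Lemma rv_law_law (S : sublinear_space R) (X : S -> 'cV[R]_d) :
  random_vector X -> law (rv_law X).
Proof.
move=> hX; split=> [f g hf hg h|c|f g hf hg|c f hf c0]; rewrite /rv_law.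
- by apply: sl_E_mono => [||w]; [exact: sl_H_comp|exact: sl_H_comp|exact: h].
- exact: sl_E_cst.
- by apply: sl_E_subadd; exact: sl_H_comp.
- by apply: sl_E_poshom => //; exact: sl_H_comp.
Qed.

Lemma random_vectorD (S : sublinear_space R) (X Y : S -> 'cV[R]_d) :
  random_vector X -> random_vector Y -> random_vector (fun w => X w + Y w).
Proof.
move=> hX hY i; have := sl_H_add (hX i) (hY i).
by congr sl_H; apply/funext => w; rewrite mxE.
Qed.

Lemma random_vectorZ (S : sublinear_space R) (X : S -> 'cV[R]_d) (c : R) :
  random_vector X -> random_vector (fun w => c *: X w).
Proof.
move=> hX i; have := sl_H_scale c (hX i).
by congr sl_H; apply/funext => w; rewrite mxE.
Qed.

Definition clip (N x : R) := Num.max (- N) (Num.min N x).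

Lemma clip_dist (N x y : R) : `|clip N x - clip N y| <= `|x - y|.
Proof.
rewrite /clip; have := ler_norm (x - y); have := ler_norm (- (x - y)).
rewrite normrN ler_norml => h1 h2; apply/andP.
case: (leP N x) => ?; case: (leP N y) => ?;
  [case: (leP (- N) N) => ?|case: (leP (- N) N) => ?; case: (leP (- N) y) => ?
  |case: (leP (- N) x) => ?; case: (leP (- N) N) => ?
  |case: (leP (- N) x) => ?; case: (leP (- N) y) => ?]; split; lra.
Qed.

Lemma clip_bounded (N x : R) : 0 <= N -> `|clip N x| <= N.
Proof.
move=> N0; rewrite ler_norml /clip le_max lexx /= ge_max ge_min lexx /=.
by rewrite ge0_cp.
Qed.

Lemma clip_approx (N x : R) : 0 < N -> `|x - clip N x| <= N^-1 * x ^+ 2.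
Proof.
move=> N0; rewrite mulrC ler_pdivlMr // /clip.
case: (leP N x) => h1; [|case: (leP (- N) x) => h2].
- rewrite max_r; last by lra.
  by rewrite ger0_norm ?subr_ge0 //; nra.
- by rewrite subrr normr0 mul0r sqr_ge0.
- by rewrite ler0_norm; nra.
Qed.

(** Equality of laws tests bounded functions only, so the linear form is clipped at [N]. The
    clipping error is at most its square divided by [N], and both second moments are finite. *)
Lemma same_law_linear (S1 S2 : sublinear_space R) (X1 : S1 -> 'cV[R]_d)
    (X2 : S2 -> 'cV[R]_d) g : random_vector X1 -> random_vector X2 ->
  same_law X1 X2 -> rv_law X1 (dotp g) = rv_law X2 (dotp g).
Proof.
move=> hX1 hX2 hs; have l1 := rv_law_law hX1; have l2 := rv_law_law hX2.
have hsq : C_l_Lip (fun x => dotp g x ^+ 2) by apply: C_l_LipX; exact: C_l_Lip_linear.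
pose B := rv_law X1 (fun x => dotp g x ^+ 2) + rv_law X2 (fun x => dotp g x ^+ 2).
have B0 : 0 <= B by apply: addr_ge0; apply: law_ge0 => // y; exact: sqr_ge0.
apply/eqP; rewrite -subr_eq0 -normr_le0; apply/ler_addgt0Pr => e e0.
rewrite add0r; pose N := (B + 1) / e.
have N0 : 0 < N by rewrite divr_gt0 //; lra.
have hc : C_b_Lip (fun x => clip N (dotp g x)).
  split; first by exists N => x; apply: clip_bounded; exact: ltW.
  exists (enorm g) => x y; apply: le_trans (clip_dist _ _ _) _.
  by rewrite -dotpNr -dotpDr; exact: dotp_le.
have close (p : ('cV[R]_d -> R) -> R) : law p ->
    `|p (dotp g) - p (fun x => clip N (dotp g x))|
      <= N^-1 * p (fun x => dotp g x ^+ 2).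
  move=> hp; have hl := @C_l_Lip_linear R d g; have hcl := C_b_Lip_C_l_Lip hc.
  apply: le_trans (law_dist hp hl hcl) _.
  rewrite -(law_poshom hp) ?invr_ge0 ?(ltW N0) //; apply: (law_mono hp).
  - exact: C_l_Lip_norm (C_l_LipB hl hcl).
  - exact: C_l_LipZ.
  by move=> x; exact: clip_approx.
have := close _ l1; have := close _ l2.
have -> : rv_law X1 (fun x => clip N (dotp g x)) = rv_law X2 (fun x => clip N (dotp g x)).
  exact: hs.
have : N^-1 * B <= e.
  rewrite /N invf_div mulrAC ler_pdivrMr; last by lra.
  by rewrite ler_wpM2l ?(ltW e0) //; lra.
rewrite /B mulrDr !ler_norml => h /andP[h1 h2] /andP[h3 h4].
by apply/andP; split; lra.
Qed.

Lemma C_l_Lip_pair (f : 'cV[R]_d -> R) (a b : R) : C_l_Lip f ->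
  C_l_Lip (fun v : 'cV[R]_(d + d) => f (a *: usubmx v + b *: dsubmx v)).
Proof.
apply: C_l_Lip_comp => i; under eq_fun do rewrite !mxE.
by apply: C_l_LipD; apply: C_l_LipZ; exact: C_l_Lip_coord.
Qed.

Lemma independent_pair (S : sublinear_space R) (X Y : S -> 'cV[R]_d) f (a b : R) :
  C_l_Lip f -> independent_from Y X ->
  sl_E (fun w => f (a *: X w + b *: Y w))
  = rv_law X (fun x => rv_law Y (fun y => f (a *: x + b *: y))).
Proof.
move=> hf /(_ _ (C_l_Lip_pair a b hf)).
have -> : (fun w => f (a *: usubmx (col_mx (X w) (Y w))
      + b *: dsubmx (col_mx (X w) (Y w))))
    = (fun w => f (a *: X w + b *: Y w)).
  by apply/funext => w; rewrite col_mxKu col_mxKd.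
move=> ->; congr (sl_E _); apply/funext => w; congr (sl_E _).
by apply/funext => w'; rewrite col_mxKu col_mxKd.
Qed.

End RandomVectors.

(** * Stability and centering of G-normal vectors *)

Section GNormal.
Context {R : realType} (d : nat) (S : sublinear_space R) (Z : S -> 'cV[R]_d).
Hypothesis hZ : G_normal Z.

Let hrv : random_vector Z. Proof. by case: hZ. Qed.
Let hlaw := rv_law_law hrv.

(** Independence turns the joint expectation into an iterated one, and equality of laws replaces the
    copy by [Z], so that only the law of [Z] remains. *)
Lemma G_normal_semigroup f (a b : R) : C_b_Lip f -> 0 <= a -> 0 <= b ->
  rv_law Z (fun x => rv_law Z (fun y => f (a *: x + b *: y)))
  = rv_law Z (fun x => f (Num.sqrt (a ^+ 2 + b ^+ 2) *: x)).
Proof.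
move=> hf a0 b0; have [_ [Zb [[hb hsame hind] hstab]]] := hZ.
rewrite -[RHS](hstab a b a0 b0 f hf) (independent_pair a b (C_b_Lip_C_l_Lip hf) hind).
congr (rv_law Z _); apply/funext => x; apply/esym/hsame.
have [K [L [K0 L0 hKL]]] := C_b_Lip_bounded_lip hf.
exact: bounded_lip_C_b_Lip (bounded_lip_affine (a *: x) b0 hKL).
Qed.

(** The definition of [G_normal] does not mention the mean. Stability with [a = b = 1] gives m + m =
    sqrt 2 * m for the value m of a linear form, hence m = 0. *)
Lemma G_normal_centered : centered (rv_law Z).
Proof.
move=> g; have [_ [Zb [[hb hsame hind] hstab]]] := hZ.
set m := rv_law Z (dotp g).
have hlb := rv_law_law hb.
have hm : rv_law Zb (dotp g) = m by exact: same_law_linear.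
have h1 := @same_law_linear _ _ _ _ _ _ g
  (random_vectorD (random_vectorZ 1 hrv) (random_vectorZ 1 hb))
  (random_vectorZ (Num.sqrt (1 ^+ 2 + 1 ^+ 2)) hrv) (hstab 1 1 ler01 ler01).
have hlin := @C_l_Lip_linear R d g.
have h2 : rv_law (fun w => 1 *: Z w + 1 *: Zb w) (dotp g) = m + m.
  rewrite /rv_law (independent_pair 1 1 hlin hind).
  rewrite -{2}/m -(law_addc hlaw _ hlin); congr (rv_law Z _); apply/funext => x.
  rewrite -hm addrC -(law_addc hlb _ hlin).
  by congr (rv_law Zb _); apply/funext => y; rewrite !scale1r dotpDr.
have h3 : rv_law (fun w => Num.sqrt (1 ^+ 2 + 1 ^+ 2) *: Z w) (dotp g)
    = Num.sqrt (1 ^+ 2 + 1 ^+ 2) * m.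
  rewrite -(law_poshom hlaw hlin) ?sqrtr_ge0 //.
  by congr (sl_E _); apply/funext => w; rewrite dotpZr.
move: h1; rewrite h2 h3 !expr1n -mulr2n -[m *+ 2]mulr_natl => /eqP.
rewrite -subr_eq0 -mulrBl mulf_eq0 => /orP[|/eqP //].
rewrite subr_eq0 => /eqP h; have := @sqr_sqrtr R (1 + 1) ltac:(lra).
rewrite -h; lra.
Qed.

(** By the semigroup property, one more step of variance 1/n turns the total variance k/n into (k +
    1)/n. *)
Lemma G_normal_chain n k f x : C_b_Lip f ->
  chain (fun _ => scale_law (Num.sqrt n%:R)^-1 (rv_law Z)) k f x
  = rv_law Z (fun y => f (x + (Num.sqrt k%:R / Num.sqrt n%:R) *: y)).
Proof.
elim: k f => [|k IH] f hf /=.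
  rewrite sqrtr0 mul0r -[LHS](law_cst hlaw); congr (rv_law Z _).
  by apply/funext => y; rewrite scale0r addr0.
set c : R := (Num.sqrt n%:R)^-1.
have c0 : 0 <= c by rewrite invr_ge0 sqrtr_ge0.
have [K [L [K0 L0 hKL]]] := C_b_Lip_bounded_lip hf.
have hst := step_bounded_lip (scale_law_law hlaw c) hKL.
rewrite IH; last exact: bounded_lip_C_b_Lip hst.
have hfx : C_b_Lip (fun u => f (x + u)).
  have := bounded_lip_C_b_Lip (bounded_lip_affine x ler01 hKL).
  by under eq_fun do rewrite scale1r.
have a0 : 0 <= Num.sqrt k%:R * c by rewrite mulr_ge0 ?sqrtr_ge0.
have := G_normal_semigroup hfx a0 c0.
have -> : Num.sqrt ((Num.sqrt k%:R * c) ^+ 2 + c ^+ 2) = Num.sqrt k.+1%:R * c.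
  rewrite exprMn sqr_sqrtr ?ler0n // -{2}[c ^+ 2]mul1r -mulrDl natr1.
  by rewrite sqrtrM ?ler0n // sqrtr_sqr ger0_norm.
move=> <-; congr (rv_law Z _); apply/funext => y.
by rewrite /step /scale_law; congr (rv_law Z _); apply/funext => z; rewrite addrA.
Qed.

Lemma G_normal_divisible n f : (0 < n)%N -> C_b_Lip f ->
  chain (fun _ => scale_law (Num.sqrt n%:R)^-1 (rv_law Z)) n f 0 = rv_law Z f.
Proof.
move=> n0 hf; rewrite G_normal_chain // mulfV ?gt_eqF ?sqrtr_gt0 ?ltr0n //.
by congr (rv_law Z _); apply/funext => y; rewrite add0r scale1r.
Qed.

End GNormal.

(** * Partial sums of independent increments as chains *)

Section PartialSums.
Context {R : realType} (S : sublinear_space R) (d : nat) (X : nat -> S -> 'cV[R]_d).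
Hypothesis hX : forall i, random_vector (X i).
Hypothesis hind : forall i : nat,
  independent_from (X i.+1) (fun w => \mxcol_(j < i.+1) X j w).

Lemma sum_chain n f : C_l_Lip f ->
  sl_E (fun w => f (\sum_(i < n) X i w)) = chain (fun i => rv_law (X i)) n f 0.
Proof.
elim: n f => [|n IH] f hf.
  by under eq_fun do rewrite big_ord0; rewrite sl_E_cst.
under eq_fun do rewrite big_ord_recr.
have hst := step_C_l_Lip (rv_law_law (hX n)) hf.
rewrite /= -(IH _ hst); case: n {IH hst} => [|n].
  (* The first increment has an empty past; the independence hypothesis starts with the second
     one. *)
  under [in RHS]eq_fun do rewrite big_ord0.
  rewrite sl_E_cst; congr (sl_E _); apply/funext => w.
  by rewrite big_ord0.
(* The partial sum is a function of the stacked vector of the past, which is the vector that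
   independence refers to. *)
pose sig (u : 'cV[R]_(\sum_(j < n.+1) d)) := \sum_(j < n.+1) submxcol u j.
pose phi (v : 'cV[R]_(\sum_(j < n.+1) d + d)) := f (sig (usubmx v) + dsubmx v).
have hphi : C_l_Lip phi.
  apply: C_l_Lip_comp hf => i.
  have -> : (fun v => (sig (usubmx v) + dsubmx v) i 0)
      = (fun v : 'cV[R]_(\sum_(j < n.+1) d + d) =>
           \sum_(j < n.+1) submxcol (usubmx v) j i 0 + dsubmx v i 0).
    by apply/funext => v; rewrite mxE summxE.
  apply: C_l_LipD; last first.
    by rewrite (_ : (fun v => _) = fun v : 'cV[R]_(\sum_(j < n.+1) d + d) =>
      v (rshift _ i) 0); [exact: C_l_Lip_coord|apply/funext => v; rewrite mxE].
  apply: C_l_Lip_sum => j.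
  rewrite (_ : (fun v => _) = fun v : 'cV[R]_(\sum_(j < n.+1) d + d) =>
    v (lshift d (tagnat.Rank j i)) 0); first exact: C_l_Lip_coord.
  by apply/funext => v; rewrite !mxE.
have sigE w : sig (\mxcol_(j < n.+1) X j w) = \sum_(j < n.+1) X j w.
  by apply: eq_bigr => j _; rewrite mxcolK.
have := hind hphi.
have -> : (fun w => phi (col_mx (\mxcol_(j < n.+1) X j w) (X n.+1 w)))
    = (fun w => f (\sum_(j < n.+1) X j w + X n.+1 w)).
  by apply/funext => w; rewrite /phi col_mxKu col_mxKd sigE.
move=> ->; congr (sl_E _); apply/funext => w; congr (sl_E _); apply/funext => w'.
by rewrite /phi col_mxKu col_mxKd sigE.
Qed.

End PartialSums.

(** The functions G are close only eventually. The first [N1] increments get the crude bound [B],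
    and after scaling their total covariance error is at most [N1 * B / n]. *)
Lemma central_limit (R : realType) (S S' : sublinear_space R) (d : nat)
    (X : nat -> S -> 'cV[R]_d) (Z : S' -> 'cV[R]_d) (M : R) :
  (forall i, random_vector (X i)) ->
  (forall i, independent_from (X i.+1) (fun w => \mxcol_(j < i.+1) X j w)) ->
  (forall i, centered (rv_law (X i))) ->
  (forall i, moment3 (rv_law (X i)) <= M) ->
  G_normal Z ->
  (forall e, 0 < e -> exists N, forall i A, (N <= i)%N -> sym_mx A ->
    `|half_cov (rv_law (X i)) A - half_cov (rv_law Z) A| <= e * enorm A) ->
  cvg_in_law (fun (n : nat) w => (Num.sqrt n%:R)^-1 *: \sum_(i < n) X i w) Z.
Proof.
move=> hX hind hcent hM hZ hcov f hf.
have hrvZ : random_vector Z by case: hZ.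
have lZ := rv_law_law hrvZ; have cZ := G_normal_centered hZ.
have lX i := rv_law_law (hX i).
have [K [L [K0 L0 hKL]]] := C_b_Lip_bounded_lip hf.
have mX0 i := moment3_ge0 (lX i); have mZ0 := moment3_ge0 lZ.
set mZ := moment3 (rv_law Z) in mZ0.
have M0 : 0 <= M := le_trans (mX0 0%N) (hM 0%N).
apply/cvgrPdist_le => e e0.
pose h := e / (8 * (L + 1)).
have h0 : 0 < h by rewrite divr_gt0 //; lra.
have hLh : 2 * L * h <= e / 4.
  have L1 : 0 < 8 * (L + 1) by lra.
  rewrite /h mulrA ler_pdivrMr // [leRHS](_ : _ = 2 * (L + 1) * e); last by field.
  by rewrite ler_wpM2r ?(ltW e0) //; lra.
have [C [C0 hC]] := @chain_compare_uniform R d h h0.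
have CK0 : 0 <= C * K by rewrite mulr_ge0.
pose del := e / (4 * (C * K + 1)).
have del0 : 0 < del by rewrite divr_gt0 //; lra.
have hdel : C * K * del <= e / 4.
  have CK1 : 0 < 4 * (C * K + 1) by lra.
  rewrite /del mulrA ler_pdivrMr // [leRHS](_ : _ = (C * K + 1) * e); last by field.
  by rewrite ler_wpM2r ?(ltW e0) //; lra.
have [N1 hN1] := hcov del del0.
(* This is (1 + M) + (1 + mZ), from [half_cov_le] applied to both laws. *)
pose B := 2 + M + mZ.
have B0 : 0 <= B by rewrite /B; lra.
have a0 : 0 <= C * K * (N1%:R * B + M + mZ).
  by apply: mulr_ge0 => //; have : 0 <= N1%:R * B by [exact: mulr_ge0]; lra.
have e4 : 0 < e / 4 by rewrite divr_gt0.
have [N2 [N20 hN2]] := div_sqrt_small a0 e4.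
exists N2 => // n /= Nn; have n0 : (0 < n)%N := leq_trans N20 Nn.
have nR : 0 < n%:R :> R by rewrite ltr0n.
pose c : R := (Num.sqrt n%:R)^-1.
have c0 : 0 <= c by rewrite invr_ge0 sqrtr_ge0.
have c2 : c ^+ 2 = n%:R^-1 by rewrite /c inv_sqrt_sqr.
have nc2 : n%:R * c ^+ 2 = 1 by rewrite c2 mulfV ?gt_eqF.
pose ps i := scale_law c (rv_law (X i)).
pose qs (i : nat) := scale_law c (rv_law Z).
have -> : sl_E (fun w => f (c *: \sum_(i < n) X i w)) = chain ps n f 0.
  rewrite (sum_chain hX hind n (C_l_Lip_scale c (C_b_Lip_C_l_Lip hf))).
  by rewrite -{2}(scaler0 _ c) chain_scale.
rewrite (_ : sl_E (fun w => f (Z w)) = chain qs n f 0); last first.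
  exact: esym (G_normal_divisible hZ n0 hf).
rewrite distrC.
pose es i := c ^+ 2 * (if (i < N1)%N then B else del).
have hes i : 0 <= es i.
  by rewrite /es; case: ifP => _; rewrite mulr_ge0 ?sqr_ge0 ?(ltW del0).
have hps i : law (ps i) /\ centered (ps i).
  by split; [exact: scale_law_law|exact: scale_law_centered].
have hqs i : law (qs i) /\ centered (qs i).
  by split; [exact: scale_law_law|exact: scale_law_centered].
have hcov' i A : (i < n)%N -> sym_mx A ->
    `|half_cov (ps i) A - half_cov (qs i) A| <= es i * enorm A.
  move=> _ sA; rewrite !scale_law_half_cov // -mulrBr normrM.
  rewrite ger0_norm ?sqr_ge0 // /es -mulrA ler_wpM2l ?sqr_ge0 //.
  case: ifP => iN; last by apply: hN1; rewrite // leqNgt iN.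
  apply: le_trans (ler_normB _ _) _.
  have := half_cov_le (lX i) A; have := half_cov_le lZ A.
  move=> h1 h2; apply: le_trans (lerD h2 h1) _; rewrite -/mZ.
  rewrite [leRHS](_ : _ = enorm A * (1 + M) + enorm A * (1 + mZ)); last first.
    by rewrite /B; ring.
  by rewrite lerD2r ler_wpM2l ?enorm_ge0 // lerD2l.
have := hC K L n ps qs es K0 L0 hps hqs hes hcov' f 0 hKL.
move=> /le_trans; apply.
rewrite [leRHS](_ : _ = e / 4 + (e / 4 + e / 4) + e / 4); last by field.
suff hsum : \sum_(k < n) (es k + moment3 (ps k) + moment3 (qs k))
    <= del + (N1%:R * B + M + mZ) * c.
  have h2 : C * K * ((N1%:R * B + M + mZ) * c) <= e / 4.
    by have := hN2 n Nn; rewrite -/c -mulrA.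
  apply: le_trans (lerD hLh (ler_wpM2l CK0 hsum)) _.
  have := lerD hdel h2; rewrite -mulrDr => h3.
  apply: le_trans (lerD (lexx _) h3) _; lra.
(* Used to weaken the factor c^2 of the first [N1] terms to [c], the rate of the third moments. *)
have c1 : c <= 1.
  by rewrite invf_le1 ?sqrtr_gt0 // -{1}sqrtr1 ler_sqrt ?ler1n.
apply: (@le_trans _ _ (\sum_(k < n) (es k + c ^+ 3 * (M + mZ)))).
  apply: ler_sum => k _; rewrite -addrA lerD2l !scale_law_moment3 // -/mZ.
  by rewrite -mulrDr ler_wpM2l ?exprn_ge0 // lerD2r.
rewrite big_split /= sumr_const card_ord -[_ *+ n]mulr_natl.
have -> : n%:R * (c ^+ 3 * (M + mZ)) = c * (M + mZ).
  have -> : n%:R * (c ^+ 3 * (M + mZ)) = n%:R * c ^+ 2 * (c * (M + mZ)) by ring.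
  by rewrite nc2 mul1r.
have hes1 : \sum_(k < n) es k <= del + N1%:R * B * c.
  apply: (@le_trans _ _ (\sum_(k < n) c ^+ 2 * (del + (k < N1)%N%:R * B))).
    apply: ler_sum => k _; rewrite /es ler_wpM2l ?sqr_ge0 //.
    by case: ifP => _; rewrite ?mul1r ?mul0r ?addr0 // lerDr ltW.
  rewrite -mulr_sumr big_split /= sumr_const card_ord -[_ *+ n]mulr_natl.
  rewrite mulrDr (mulrCA _ n%:R) mulrA nc2 mul1r lerD2l -mulr_suml.
  have hcount : \sum_(k < n) (k < N1)%N%:R <= N1%:R :> R.
    rewrite -natr_sum ler_nat; elim: (n) => [|k IH]; first by rewrite big_ord0.
    rewrite big_ord_recr /=; have [kN|kN] := ltnP k N1; last by rewrite addn0.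
    rewrite addn1; apply: leq_ltn_trans kN.
    apply: (@leq_trans (\sum_(i < k) 1)).
      by apply: leq_sum => i _; exact: leq_b1.
    by rewrite sum1_card card_ord.
  rewrite mulrC ler_pM ?mulr_ge0 ?sqr_ge0 ?sumr_ge0 //.
    by rewrite ler_wpM2r.
  by rewrite expr2 ler_piMl.
by rewrite [leRHS](_ : _ = del + N1%:R * B * c + c * (M + mZ)) ?lerD2r //; ring.
Qed.

(** With signs absorbed into the coordinates, a linear form is a combination, with coefficients
    |g_k| >= 0, of functions of value 0. Sub-additivity then gives a value of at most 0, and the
    same for [- g] forces equality. *)
Lemma centered_of_coord (R : realType) (d : nat) (p : ('cV[R]_d -> R) -> R) : law p ->
  (forall k, p (fun x => x k 0) = 0 /\ p (fun x => - x k 0) = 0) -> centered p.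
Proof.
move=> hp h; have hlin := @C_l_Lip_linear R d.
have le0 (g : 'cV[R]_d) : p (dotp g) <= 0.
  have hk k : p (fun x => Num.sg (g k 0) * x k 0) = 0.
    have [h1 h2] := h k; case: (sgrP (g k 0)) => _.
    - by under eq_fun do rewrite mul0r; exact: (law_cst hp).
    - by under eq_fun do rewrite mul1r.
    - by under eq_fun do rewrite mulN1r.
  have hc k : C_l_Lip (fun x : 'cV[R]_d => Num.sg (g k 0) * x k 0).
    by apply: C_l_LipZ; exact: C_l_Lip_coord.
  have := law_sum_le hp (fun k => normr_ge0 (g k 0)) hc.
  rewrite [X in _ <= X]big1; last by move=> k _; rewrite hk mulr0.
  have -> // : (fun y : 'cV[R]_d => \sum_i `|g i 0| * (Num.sg (g i 0) * y i 0)) = dotp g.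
  apply/funext => y; apply: eq_bigr => k _.
  by rewrite mulrA (mulrC `|_|) -numEsg.
move=> g; apply/eqP; rewrite eq_le le0 /=.
have := law_subadd hp (hlin g) (hlin (- g)); have := le0 (- g).
under [X in p X <= p _ + _]eq_fun do rewrite dotpNl subrr.
by rewrite (law_cst hp); lra.
Qed.

(* The sequences are indexed from 0: [X i] is X_(i+1), [Theta i] is Theta_(i+1). *)
Theorem corollary3p5 (R : realType) (S : sublinear_space R) (d : nat)
    (X : nat -> S -> 'cV[R]_d) (M : R) (Theta : nat -> set 'M[R]_d)
    (hX : forall i, random_vector (X i))
    (h_i : forall i : nat,
       independent_from (X i.+1) (fun w => \mxcol_(j < i.+1) X j w))
    (h_ii : forall (i : nat) (k : 'I_d),
       sl_E (fun w => X i w k 0) = 0 /\ sl_E (fun w => - X i w k 0) = 0)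
    (hM : 0 < M)
    (h_iii : forall i : nat, sl_E (fun w => enorm (X i w) ^+ 3) <= M)
    (h_viiXi : forall i : nat, @Xi R d (Theta i))
    (h_viiconvex : forall i : nat,
       convex_set (Theta i : set (convex_lmodType 'M[R]_d)))
    (h_viiG : forall (i : nat) (A : 'M[R]_d), sym_mx A ->
       2^-1 * sl_E (fun w => dotp (A *m X i w) (X i w)) = G_of (Theta i) A)
    (h_viicauchy : hausdorff_cauchy Theta) :
  exists Theta_lim : set 'M[R]_d,
    [/\ @Xi R d Theta_lim,
        convex_set (Theta_lim : set (convex_lmodType 'M[R]_d)),
        exists (S' : sublinear_space R) (Z : S' -> 'cV[R]_d),
          G_normal_law Theta_lim Z
      & forall (S' : sublinear_space R) (Z : S' -> 'cV[R]_d),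
          G_normal_law Theta_lim Z ->
          cvg_in_law
            (fun (n : nat) w => (Num.sqrt n%:R)^-1 *: \sum_(i < n) X i w) Z].
Proof.
have lX i : law (rv_law (X i)) by exact: rv_law_law.
have hl := limit_set_Xi h_viiXi h_viicauchy.
exists (limit_set Theta); split=> //.
- exact: limit_set_convex.
- exact: G_normal_exists.
move=> S' Z [hZ hG]; apply: (@central_limit _ _ _ _ _ _ M) => //.
  by move=> i; apply: centered_of_coord => // k; exact: h_ii.
move=> e e0; have [N hN] := G_of_limit_set h_viiXi h_viicauchy e0.
exists N => i A Ni sA.
have -> : half_cov (rv_law Z) A = G_of (limit_set Theta) A by exact: hG.
have -> : half_cov (rv_law (X i)) A = G_of (Theta i) A; last exact: hN.
rewrite -h_viiG // /half_cov (law_poshom (lX i)) ?invr_ge0 //.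
exact: C_l_Lip_quad.
Qed.
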